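(* Let $\mathbb{K}$ be a field of characteristic $0$. Let $\mathfrak{g},\mathfrak{h}$ be two pronilpotent dg Lie algebras over $\mathbb{K}$, and let $\phi:\mathfrak{g}\to\mathfrak{h}$ be the linear dual of a weak equivalence of conilpotent Lie coalgebras. Then $\phi$ induces a bijection $$\overline{\mathrm{MC}}(\mathfrak{g})\cong\overline{\mathrm{MC}}(\mathfrak{h})$$ between the moduli spaces of Maurer--Cartan elements.
   Context: All complexes are cochain complexes over $\mathbb{K}$ with differentials of degree $+1$. A conilpotent Lie coalgebra is a (dg) conilpotent coalgebra $C$ over the cooperad $\mathsf{coLie}=\mathsf{Lie}^\vee$, the linear dual of the operad of Lie algebras; its structure map is $\Delta_C:C\to\bigoplus_{k\ge1}(\mathsf{coLie}(k)\otimes C^{\otimes k})^{\mathbb{S}_k}$. Its coradical filtration, indexed from $1$, is $F_nC=\{c\in C\mid \Delta_C(c)\text{ has components only in arities }k\le n\}$; it is exhaustive. Weak equivalences: a morphism $f:D\to C$ of conilpotent Lie coalgebras is a weak equivalence if $\Omega_\kappa f$ is a quasi-isomorphism, where $\Omega_\kappa$ is the cobar construction associated to the Koszul twisting morphism $\kappa:\mathsf{coLie}\to\mathscr{S}\otimes\mathsf{Com}$ (with $\mathscr{S}$ the operadic suspension). Concretely, up to a shift, $\Omega_\kappa C$ is the non-unital commutative dg algebra $\mathrm{Sym}^{\ge1}(sC)$, where $s$ raises degree by $1$, with the derivation differential extending the sum of $d_C$ and the map induced by the Lie cobracket. (Equivalently, the weak equivalences form the smallest class containing the filtered quasi-isomorphisms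 of conilpotent Lie coalgebras and closed under 2-out-of-3.) Pronilpotent dg Lie algebras: the linear dual $C^\vee$ of a conilpotent Lie coalgebra is a dg Lie algebra; pronilpotent dg Lie algebras are the dg Lie algebras of this form. Such $\mathfrak{g}=C^\vee$ is complete for the filtration $F_n\mathfrak{g}=(F_nC)^\perp$, with $F_\bullet C$ the coradical filtration, i.e. $\mathfrak{g}\cong\lim_n\mathfrak{g}/F_n\mathfrak{g}$. That $\phi:\mathfrak{g}\to\mathfrak{h}$ is the dual of a weak equivalence means $\mathfrak{g}=C^\vee$, $\mathfrak{h}=D^\vee$ and $\phi=f^\vee$ for a weak equivalence $f:D\to C$. Maurer--Cartan elements: $\mathrm{MC}(\mathfrak{g})=\{x\in\mathfrak{g}^1\mid dx+\tfrac12[x,x]=0\}$. Two elements $x_0,x_1\in\mathrm{MC}(\mathfrak{g})$ are gauge equivalent if there is $\lambda\in\mathfrak{g}^0$ such that the solution of $\dot x(t)=d\lambda-[\lambda,x(t)]$, $x(0)=x_0$ (which exists for all times in the complete algebra $\mathfrak{g}$) satisfies $x(1)=x_1$. The moduli space is $\overline{\mathrm{MC}}(\mathfrak{g})=\mathrm{MC}(\mathfrak{g})/\!\sim_{\mathrm{gauge}}$, where $\sim_{\mathrm{gauge}}$ is the equivalence relation generated by this. Any dg Lie algebra morphism between pronilpotent algebras which is the dual of a coalgebra morphism induces a map of moduli spaces. *)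

(* Defs.v *)
From Stdlib Require Relation_Operators.
From HB Require Import structures.
From mathcomp Require Import all_boot all_order all_algebra.
From mathcomp Require Import boolp functions.
Set Implicit Arguments.
Unset Strict Implicit.
Unset Printing Implicit Defensive.
Import GRing.Theory.
Local Open Scope ring_scope.
Local Open Scope quotient_scope.

(* The K-module presented by generators X and the linear relations encoded by
   adm: a map X -> W is admissible when it satisfies the relations, and two
   formal sums are identified when every admissible map into every K-module
   takes the same value on them.  Hence [presented] is the universal admissible
   target: [pgen] is the generating map and [plift g] the linear map induced by
   an admissible g ([plift g] is meaningful only for admissible g). *)
Section Presented.
Variables (K : fieldType) (X : choiceType).
Variable adm : forall W : lmodType K, (X -> W) -> Prop.

Definition feval (W : lmodType K) (g : X -> W) (s : seq (K * X)) : W :=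
  \sum_(p <- s) p.1 *: g p.2.

Definition frel (s t : seq (K * X)) : bool :=
  `[< forall (W : lmodType K) (g : X -> W), adm g -> feval g s = feval g t >].

Lemma frel_refl : reflexive frel. Proof. by move=> s; apply/asboolP. Qed.
Lemma frel_sym : symmetric frel.
Proof.
by move=> s t; apply/idP/idP => /asboolP h; apply/asboolP => W g ag; rewrite h.
Qed.
Lemma frel_trans : transitive frel.
Proof.
move=> t s u /asboolP h1 /asboolP h2; apply/asboolP => W g ag.
by rewrite h1 // h2.
Qed.
Canonical frel_equiv := EquivRel frel frel_refl frel_sym frel_trans.

Definition presented : Type := {eq_quot frel}.
HB.instance Definition _ := Choice.on presented.
HB.instance Definition _ := Quotient.on presented.
HB.instance Definition _ : EqQuotient _ frel presented :=
  EqQuotient.on presented.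

Definition plift (W : lmodType K) (g : X -> W) (a : presented) : W :=
  feval g (repr a).

Lemma plift_pi (W : lmodType K) (g : X -> W) s :
  adm g -> plift g (\pi_presented s) = feval g s.
Proof.
move=> ag; rewrite /plift.
by have /eqmodP/asboolP := reprK (\pi_presented s); apply.
Qed.

Lemma presentedP (a b : presented) :
  (forall (W : lmodType K) (g : X -> W), adm g -> plift g a = plift g b) ->
  a = b.
Proof.
move=> h; rewrite -[a]reprK -[b]reprK; apply/eqmodP/asboolP.
exact: h.
Qed.

Definition padd (a b : presented) : presented :=
  \pi_presented (repr a ++ repr b).
Definition pscale (k : K) (a : presented) : presented :=
  \pi_presented [seq (k * p.1, p.2) | p <- repr a].
Definition pzero : presented := \pi_presented [::].

Lemma plift_add (W : lmodType K) (g : X -> W) : adm g ->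
  {morph plift g : a b / padd a b >-> a + b}.
Proof. by move=> ag a b; rewrite plift_pi // /feval big_cat. Qed.
Lemma plift_scale (W : lmodType K) (g : X -> W) k : adm g ->
  {morph plift g : a / pscale k a >-> k *: a}.
Proof.
move=> ag a; rewrite plift_pi // /feval big_map /= scaler_sumr.
by apply: eq_bigr => p _; rewrite scalerA.
Qed.
Lemma plift_zero (W : lmodType K) (g : X -> W) : adm g -> plift g pzero = 0.
Proof. by move=> ag; rewrite plift_pi // /feval big_nil. Qed.

Let pE := (plift_add, plift_scale, plift_zero).

Lemma paddA : associative padd.
Proof. by move=> a b c; apply: presentedP => W g ag; rewrite !pE // addrA. Qed.
Lemma paddC : commutative padd.
Proof. by move=> a b; apply: presentedP => W g ag; rewrite !pE // addrC. Qed.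
Lemma padd0 : left_id pzero padd.
Proof. by move=> a; apply: presentedP => W g ag; rewrite !pE // add0r. Qed.
Lemma paddN : left_inverse pzero (pscale (-1)) padd.
Proof.
by move=> a; apply: presentedP => W g ag; rewrite !pE // scaleN1r addNr.
Qed.
HB.instance Definition _ := GRing.isZmodule.Build presented
  paddA paddC padd0 paddN.

Lemma pscaleA a b v : pscale a (pscale b v) = pscale (a * b) v.
Proof. by apply: presentedP => W g ag; rewrite !pE // scalerA. Qed.
Lemma pscale1 : left_id 1 pscale.
Proof. by move=> v; apply: presentedP => W g ag; rewrite !pE // scale1r. Qed.
Lemma pscaleDr : right_distributive pscale +%R.
Proof.
by move=> a u v; apply: presentedP => W g ag; rewrite !pE // scalerDr.
Qed.
Lemma pscaleDl v : {morph pscale^~ v : a b / a + b}.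
Proof. by move=> a b; apply: presentedP => W g ag; rewrite !pE // scalerDl. Qed.
HB.instance Definition _ := GRing.Zmodule_isLmodule.Build K presented
  pscaleA pscale1 pscaleDr pscaleDl.

Definition pgen (x : X) : presented := \pi_presented [:: (1, x)].

Lemma plift_gen (W : lmodType K) (g : X -> W) x :
  adm g -> plift g (pgen x) = g x.
Proof. by move=> ag; rewrite plift_pi // /feval big_seq1 scale1r. Qed.

Lemma plift_is_linear (W : lmodType K) (g : X -> W) : adm g -> linear (plift g).
Proof. by move=> ag k a b; rewrite !pE. Qed.

Lemma pgen_span (a : presented) :
  a = \sum_(p <- repr a) p.1 *: pgen p.2.
Proof.
apply: presentedP => W g ag; rewrite {1}/plift /feval.
elim: (repr a) => [|p s IH]; first by rewrite !big_nil plift_zero.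
by rewrite !big_cons plift_add // -IH plift_scale // plift_gen.
Qed.
End Presented.

Section LinearFacts.
Variables (K : fieldType) (U V : lmodType K) (f : U -> V).
Hypothesis lf : linear f.
Lemma lin0 : f 0 = 0.
Proof. by have := lf (-1) 0 0; rewrite scaler0 addr0 scaleN1r addNr. Qed.
Lemma linD : {morph f : x y / x + y}.
Proof. by move=> x y; have := lf 1 x y; rewrite !scale1r. Qed.
Lemma linZ a : {morph f : x / a *: x}.
Proof. by move=> x; have := lf a x 0; rewrite !addr0 lin0 addr0. Qed.
Lemma linN : {morph f : x / - x}.
Proof. by move=> x; rewrite -scaleN1r linZ scaleN1r. Qed.
Lemma lin_sum (I : Type) (r : seq I) (F : I -> U) :
  f (\sum_(i <- r) F i) = \sum_(i <- r) f (F i).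
Proof. exact: (big_morph _ linD lin0). Qed.
End LinearFacts.

Lemma linP (K : fieldType) (U V : lmodType K) (f : {linear U -> V}) :
  linear f.
Proof. exact: linearP. Qed.

Lemma lin_id (K : fieldType) (U : lmodType K) : linear (@id U).
Proof. by []. Qed.
Lemma lin_comp (K : fieldType) (U V W : lmodType K) (f : V -> W) (g : U -> V) :
  linear f -> linear g -> linear (fun x => f (g x)).
Proof. by move=> lf lg a x y; rewrite lg lf. Qed.
Lemma lin_add (K : fieldType) (U V : lmodType K) (f g : U -> V) :
  linear f -> linear g -> linear (fun x => f x + g x).
Proof. by move=> lf lg a x y; rewrite lg lf scalerDr addrACA. Qed.
Lemma lin_opp (K : fieldType) (U V : lmodType K) (f : U -> V) :
  linear f -> linear (fun x => - f x).
Proof. by move=> lf a x y; rewrite lf opprD scalerN. Qed.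
Lemma lin_scale (K : fieldType) (U V : lmodType K) (f : U -> V) k :
  linear f -> linear (fun x => k *: f x).
Proof. by move=> lf a x y; rewrite lf scalerDr !scalerA mulrC. Qed.
Lemma lin_zero (K : fieldType) (U V : lmodType K) :
  linear (fun _ : U => 0 : V).
Proof. by move=> a x y; rewrite scaler0 addr0. Qed.
Lemma lin_bigsum (K : fieldType) (U V : lmodType K) (I : Type) (r : seq I)
  (F : I -> U -> V) :
  (forall i, linear (F i)) -> linear (fun x => \sum_(i <- r) F i x).
Proof.
move=> lF; elim: r => [|i r IH] a x y; first by rewrite !big_nil scaler0 addr0.
by rewrite !big_cons IH lF scalerDr addrACA.
Qed.

Definition bilin (K : fieldType) (V W U : lmodType K) (g : V -> W -> U) :=
  (forall w, linear (g^~ w)) /\ (forall v, linear (g v)).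

Section Tensor.
Variables (K : fieldType) (V W : lmodType K).

(* A plain family of generators v (x) w, with bilinearity as relations. *)
Definition tens_adm (U : lmodType K) (g : V * W -> U) : Prop :=
  bilin (fun v w => g (v, w)).

Definition tensor : lmodType K := @presented K (V * W)%type tens_adm.

Definition tens (v : V) (w : W) : tensor :=
  @pgen K (V * W)%type tens_adm (v, w).

Definition tlift (U : lmodType K) (g : V -> W -> U) : tensor -> U :=
  @plift K (V * W)%type tens_adm U (fun p => g p.1 p.2).

Lemma tlift_tens (U : lmodType K) (g : V -> W -> U) v w :
  bilin g -> tlift g (tens v w) = g v w.
Proof. by move=> bg; rewrite /tlift plift_gen. Qed.

Lemma tlift_linear (U : lmodType K) (g : V -> W -> U) :
  bilin g -> linear (tlift g).
Proof. by move=> bg; apply: plift_is_linear. Qed.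

Lemma tens_bilin : bilin tens.
Proof.
split=> [w|v] a x y; apply: presentedP => U g [g1 g2];
  by rewrite plift_is_linear // !plift_gen // ?g1 ?g2.
Qed.

Lemma tens_ext (U : lmodType K) (f g : tensor -> U) :
  linear f -> linear g -> (forall v w, f (tens v w) = g (tens v w)) -> f =1 g.
Proof.
move=> lf lg h a; rewrite (pgen_span a) !lin_sum //.
by apply: eq_bigr => -[k [v w]] _; rewrite !linZ // h.
Qed.
End Tensor.

Lemma tlift_param (K : fieldType) (V W U Z : lmodType K)
    (g : Z -> V -> W -> U) :
  (forall z, bilin (g z)) -> (forall v w, linear (fun z => g z v w)) ->
  forall t, linear (fun z => tlift (g z) t).
Proof.
move=> bg lg t a x y.
have tl z : linear (tlift (g z)) by apply: tlift_linear.
apply: (tens_ext (tl (a *: x + y)) (lin_add (lin_scale a (tl x)) (tl y))).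
by move=> v w; rewrite !tlift_tens //; apply: lg.
Qed.

Definition tmap (K : fieldType) (V V' W W' : lmodType K)
    (f : V -> V') (g : W -> W') : tensor V W -> tensor V' W' :=
  tlift (fun v w => tens (f v) (g w)).

Section Tmap.
Variables (K : fieldType) (V V' W W' : lmodType K).
Variables (f : V -> V') (g : W -> W').
Hypotheses (lf : linear f) (lg : linear g).
Lemma tmap_bilin : bilin (fun v w => tens (f v) (g w)).
Proof.
have [t1 t2] := tens_bilin V' W'.
by split=> [w|v] a x y; [rewrite lf t1 | rewrite lg t2].
Qed.
Lemma tmap_tens v w : tmap f g (tens v w) = tens (f v) (g w).
Proof. by rewrite /tmap tlift_tens //; apply: tmap_bilin. Qed.
Lemma tmap_linear : linear (tmap f g).
Proof. by apply: tlift_linear; apply: tmap_bilin. Qed.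
End Tmap.

Section Assoc.
Variables (K : fieldType) (U V W : lmodType K).
Definition tassoc : tensor (tensor U V) W -> tensor U (tensor V W) :=
  tlift (fun t w => tlift (fun u v => tens u (tens v w)) t).

Lemma tassoc_bilin1 (w : W) : bilin (fun (u : U) (v : V) => tens u (tens v w)).
Proof.
have [s1 s2] := tens_bilin U (tensor V W); have [t1 t2] := tens_bilin V W.
by split=> [v|u] a x y; [rewrite s1 | rewrite t1 s2].
Qed.

Lemma tassoc_bilin : bilin (fun (t : tensor U V) (w : W) =>
  tlift (fun u v => tens u (tens v w)) t).
Proof.
split=> [w|t]; first by apply: tlift_linear; apply: tassoc_bilin1.
apply: tlift_param; first exact: tassoc_bilin1.
have [s1 s2] := tens_bilin U (tensor V W); have [t1 t2] := tens_bilin V W.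
by move=> u v a x y; rewrite t2 s2.
Qed.

Lemma tassoc_tens u v w :
  tassoc (tens (tens u v) w) = tens u (tens v w).
Proof.
rewrite /tassoc tlift_tens; last exact: tassoc_bilin.
by rewrite tlift_tens //; apply: tassoc_bilin1.
Qed.

Lemma tassoc_linear : linear tassoc.
Proof. by apply: tlift_linear; apply: tassoc_bilin. Qed.
End Assoc.

Definition sgn (K : fieldType) (n : int) : K := (-1) ^ n.
Arguments sgn : clear implicits.

Section Sgn.
Definition par (n : int) : bool := odd (absz n).

Lemma signz (R : unitRingType) (n : int) : (-1 : R) ^ n = (-1) ^+ par n.
Proof.
have V k : ((-1 : R) ^+ k)^-1 = (-1) ^+ k.
  by rewrite -signr_odd; case: (odd k); rewrite ?expr0 ?expr1 ?invrN invr1.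
case: n => n; rewrite /par signr_odd //.
exact: V.
Qed.

Lemma parD (m n : int) : par (m + n) = par m (+) par n.
Proof.
have : (-1 : rat) ^ (m + n) = (-1) ^ m * (-1) ^ n by apply: expfzDr.
by rewrite !signz; case: (par m); case: (par n); case: (par (m + n)).
Qed.
Lemma parM (m n : int) : par (m * n) = par m && par n.
Proof. by rewrite /par abszM oddM. Qed.
Lemma parN (m : int) : par (- m) = par m.
Proof. by rewrite /par abszN. Qed.
Lemma sgnE (K : fieldType) n : sgn K n = (-1) ^+ par n.
Proof. exact: signz. Qed.
End Sgn.

(* A Z-graded vector space is given by its total space V = (+)_n V^n and the
   projections onto the V^n; V^n is the image of [gproj n].  The support of a
   vector is chosen by [gsupp]; [hsum F v] is the sum of F n v_n over the
   homogeneous components v_n of v, and extends a formula given on homogeneous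
   elements. *)
Record gradedMod (K : fieldType) := Gmod {
  gm_sort :> lmodType K;
  gproj : int -> gm_sort -> gm_sort;
  gproj_linear : forall n, linear (gproj n);
  gprojK : forall m n v, gproj m (gproj n v) = if m == n then gproj n v else 0;
  gproj_fin : forall v, exists s : seq int,
    uniq s /\ v = \sum_(n <- s) gproj n v }.

Definition homog (K : fieldType) (V : gradedMod K) (n : int) (v : V) : Prop :=
  gproj n v = v.

Definition gsupp (K : fieldType) (V : gradedMod K) (v : V) : seq int :=
  projT1 (cid (gproj_fin v)).

Definition hsum (K : fieldType) (V : gradedMod K) (U : lmodType K)
    (F : int -> V -> U) (v : V) : U :=
  \sum_(n <- gsupp v) F n (gproj n v).

Section GradedFacts.
Variables (K : fieldType) (V : gradedMod K).
Implicit Types v w : V.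

Lemma gsupp_uniq v : uniq (gsupp v).
Proof. by rewrite /gsupp; case: cid => s []. Qed.
Lemma gsuppE v : v = \sum_(n <- gsupp v) gproj n v.
Proof. by rewrite /gsupp; case: cid => s []. Qed.

Lemma homog_gproj n v : homog n (gproj n v).
Proof. by rewrite /homog gprojK eqxx. Qed.
Lemma homog_other m n v : homog n v -> m != n -> gproj m v = 0.
Proof. by move=> <- /negPf h; rewrite gprojK h. Qed.
Lemma homog_lin a n v w : homog n v -> homog n w -> homog n (a *: v + w).
Proof. by rewrite /homog gproj_linear => -> ->. Qed.

Lemma homog0 n : homog n (0 : V).
Proof. exact: (lin0 (@gproj_linear K V n)). Qed.
Lemma homogZ a n v : homog n v -> homog n (a *: v).
Proof. by move=> hv; rewrite /homog (linZ (gproj_linear n)) hv. Qed.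
Lemma homogD n v w : homog n v -> homog n w -> homog n (v + w).
Proof. by move=> hv hw; rewrite /homog (linD (gproj_linear n)) hv hw. Qed.
Lemma homogN n v : homog n v -> homog n (- v).
Proof. by move=> hv; rewrite /homog (linN (gproj_linear n)) hv. Qed.

Lemma gsupp_out n v : n \notin gsupp v -> gproj n v = 0.
Proof.
move=> hn; rewrite (gsuppE v) (lin_sum (@gproj_linear K V n)).
apply: big1_seq => m /= hm; rewrite gprojK.
by case: eqP => // E; rewrite E hm in hn.
Qed.

Lemma hsumE (U : lmodType K) (F : int -> V -> U) v (s : seq int) :
  (forall n, linear (F n)) -> uniq s ->
  (forall n, n \notin s -> gproj n v = 0) ->
  hsum F v = \sum_(n <- s) F n (gproj n v).
Proof.
move=> lF us hs.
have key r : uniq r -> (forall n, n \notin r -> gproj n v = 0) ->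
    \sum_(n <- r) F n (gproj n v) =
    \sum_(n <- undup (r ++ s ++ gsupp v)) F n (gproj n v).
  move=> ur hr; rewrite [RHS](bigID (fun n => n \in r)) /=.
  rewrite [X in _ + X]big1 ?addr0; last by move=> n /hr ->; rewrite lin0.
  rewrite -[RHS]big_filter; apply: perm_big; apply: uniq_perm => //.
    by rewrite filter_uniq ?undup_uniq.
  by move=> n; rewrite mem_filter mem_undup !mem_cat; case: (n \in r).
rewrite /hsum key ?gsupp_uniq //; last by move=> n; apply: gsupp_out.
rewrite [RHS]key //; apply: perm_big; apply: uniq_perm; rewrite ?undup_uniq //.
move=> n; rewrite !mem_undup !mem_cat; by do !case: (n \in _).
Qed.

Lemma hsum_linear (U : lmodType K) (F : int -> V -> U) :
  (forall n, linear (F n)) -> linear (hsum F).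
Proof.
move=> lF a v w; pose s := undup (gsupp v ++ gsupp w).
have us : uniq s by apply: undup_uniq.
have hs n : n \notin s -> gproj n v = 0 /\ gproj n w = 0.
  rewrite mem_undup mem_cat negb_or => /andP[h1 h2].
  by split; apply: gsupp_out.
rewrite !(@hsumE _ _ _ s) //; try by move=> n /hs[].
  rewrite scaler_sumr -big_split; apply: eq_bigr => n _ /=.
  by rewrite gproj_linear lF.
by move=> n /hs[h1 h2]; rewrite gproj_linear h1 h2 scaler0 addr0.
Qed.

Lemma hsum_homog (U : lmodType K) (F : int -> V -> U) n v :
  (forall n, linear (F n)) -> homog n v -> hsum F v = F n v.
Proof.
move=> lF hv; rewrite (@hsumE _ _ _ [:: n]) // ?big_seq1 ?hv //.
by move=> m; rewrite inE => h; apply: homog_other hv _.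
Qed.

Lemma homog_ext (U : lmodType K) (f g : V -> U) :
  linear f -> linear g -> (forall n v, homog n v -> f v = g v) -> f =1 g.
Proof.
move=> lf lg h v; rewrite (gsuppE v) !lin_sum //.
by apply: eq_bigr => n _; apply: h; apply: homog_gproj.
Qed.

(* v |-> (-1)^|v| v. *)
Definition parity (v : V) : V := hsum (fun n x => sgn K n *: x) v.
Lemma parity_linear : linear parity.
Proof. by apply: hsum_linear => n; apply: lin_scale. Qed.
Lemma parity_homog n v : homog n v -> parity v = sgn K n *: v.
Proof.
by move=> h; rewrite /parity (hsum_homog _ h) // => m; apply: lin_scale.
Qed.
End GradedFacts.

Section TensorGraded.
Variables (K : fieldType) (V W : gradedMod K).

Lemma tens_homog_ext (U : lmodType K) (f g : tensor V W -> U) :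
  linear f -> linear g ->
  (forall p q v w, homog p v -> homog q w ->
    f (tens v w) = g (tens v w)) -> f =1 g.
Proof.
have [t1 t2] := tens_bilin V W.
move=> lf lg h; apply: tens_ext => // v w.
move: v; apply: homog_ext; try by apply: lin_comp.
move=> p v hv; move: w; apply: homog_ext; try by apply: lin_comp.
by move=> q w hw; apply: h hv hw.
Qed.

Definition tens_proj (n : int) : tensor V W -> tensor V W :=
  tlift (fun v w => hsum (fun p v' => tens v' (gproj (n - p) w)) v).

Lemma tens_proj_bilin n :
  bilin (fun (v : V) (w : W) =>
    hsum (fun p v' => tens v' (gproj (n - p) w)) v).
Proof.
have [t1 t2] := tens_bilin V W.
split=> [w|v]; first by apply: hsum_linear => p; apply: t1.
apply: lin_bigsum => p; apply: lin_comp; first exact: t2.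
exact: gproj_linear.
Qed.

Lemma tens_proj_linear n : linear (tens_proj n).
Proof. by apply: tlift_linear; apply: tens_proj_bilin. Qed.

Lemma tens_proj_tens n p q v w : homog p v -> homog q w ->
  tens_proj n (tens v w) = if n == p + q then tens v w else 0.
Proof.
have [t1 t2] := tens_bilin V W.
move=> hv hw; rewrite /tens_proj tlift_tens; last exact: tens_proj_bilin.
rewrite (hsum_homog _ hv); last by move=> r; apply: t1.
rewrite -subr_eq0 opprD addrA subr_eq0.
case: eqP => [->|/eqP h]; first by rewrite hw.
by rewrite (homog_other hw h) lin0.
Qed.

Lemma tens_projK m n t :
  tens_proj m (tens_proj n t) = if m == n then tens_proj n t else 0.
Proof.
move: t; apply: tens_homog_ext.
- by apply: lin_comp; apply: tens_proj_linear.
- case: eqP => _; [exact: tens_proj_linear | exact: lin_zero].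
move=> p q v w hv hw; rewrite (tens_proj_tens n hv hw).
have [->|h] := eqVneq n (p + q).
  by rewrite (tens_proj_tens _ hv hw).
by rewrite lin0 ?if_same //; apply: tens_proj_linear.
Qed.

Lemma tens_proj_fin t : exists s : seq int,
  uniq s /\ t = \sum_(n <- s) tens_proj n t.
Proof.
have [t1 t2] := tens_bilin V W.
pose P (t : tensor V W) := exists s : seq int,
  forall r, uniq r -> {subset s <= r} -> t = \sum_(n <- r) tens_proj n t.
have P0 : P 0.
  exists [::] => r _ _; rewrite big1 // => n _; apply: lin0.
  exact: tens_proj_linear.
have PL a x y : P x -> P y -> P (a *: x + y).
  move=> [s hs] [s' hs']; exists (s ++ s') => r ur h.
  transitivity (\sum_(n <- r) (a *: tens_proj n x + tens_proj n y)); last first.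
    by apply: eq_bigr => n _; rewrite tens_proj_linear.
  rewrite big_split -scaler_sumr -hs -?hs' // => n hn; apply: h;
    by rewrite mem_cat hn ?orbT.
have Psum (I : Type) (l : seq I) (F : I -> tensor V W) :
    (forall i, P (F i)) -> P (\sum_(i <- l) F i).
  move=> hF; elim: l => [|i l IH]; first by rewrite big_nil.
  by rewrite big_cons -[F i]scale1r; apply: PL.
have Ph p q v w : homog p v -> homog q w -> P (tens v w).
  move=> hv hw; exists [:: p + q] => r ur h.
  have hr : p + q \in r by apply: h; rewrite inE.
  rewrite (bigD1_seq (p + q)) //= (tens_proj_tens _ hv hw) eqxx big1 ?addr0 //.
  by move=> n /negPf hn; rewrite (tens_proj_tens _ hv hw) hn.
have [s hs] : P t.
  rewrite (pgen_span t); apply: (Psum _ _ _) => -[k [v w]] /=.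
  rewrite -[X in P X]addr0; apply: (PL _ _ _ _ P0).
  rewrite -/(tens v w) (gsuppE v) (lin_sum (t1 w)); apply: (Psum _ _ _) => p.
  rewrite (gsuppE w) (lin_sum (t2 _)); apply: (Psum _ _ _) => q.
  by apply: Ph; apply: homog_gproj.
exists (undup s); split; first exact: undup_uniq.
by apply: hs; [exact: undup_uniq | move=> n; rewrite mem_undup].
Qed.

Definition gtensor : gradedMod K :=
  Gmod tens_proj_linear tens_projK tens_proj_fin.

Lemma homog_tens p q (v : V) (w : W) : homog p v -> homog q w ->
  @homog K gtensor (p + q) (tens v w).
Proof. by move=> hv hw; rewrite /homog /= (tens_proj_tens _ hv hw) eqxx. Qed.

Lemma gtensor_ext n (U : lmodType K) (f g : tensor V W -> U) :
  linear f -> linear g ->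
  (forall p q v w, p + q = n -> homog p v -> homog q w ->
    f (tens v w) = g (tens v w)) ->
  forall t : gtensor, homog n t -> f t = g t.
Proof.
move=> lf lg h t <-.
rewrite -[LHS]/((fun t => f (tens_proj n t)) t).
rewrite -[RHS]/((fun t => g (tens_proj n t)) t).
move: t; apply: tens_homog_ext; try by apply: lin_comp;
  try exact: tens_proj_linear.
move=> p q v w hv hw; rewrite (tens_proj_tens _ hv hw).
by case: eqP => [/esym E|_]; [apply: h E hv hw | rewrite !lin0].
Qed.

(* v (x) w |-> (-1)^(|v||w|) w (x) v. *)
Definition tswap : tensor V W -> tensor W V :=
  tlift (fun v w =>
    hsum (fun p v' => hsum (fun q w' => sgn K (p * q) *: tens w' v') w) v).

Lemma tswap_bilin : bilin (fun (v : V) (w : W) =>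
  hsum (fun p v' => hsum (fun q w' => sgn K (p * q) *: tens w' v') w) v).
Proof.
have [t1 t2] := tens_bilin W V.
split=> [w|v].
  apply: hsum_linear => p; apply: lin_bigsum => q; apply: lin_scale.
  exact: t2.
apply: lin_bigsum => p; apply: hsum_linear => q; apply: lin_scale; exact: t1.
Qed.

Lemma tswap_linear : linear tswap.
Proof. by apply: tlift_linear; apply: tswap_bilin. Qed.

Lemma tswap_tens p q v w : homog p v -> homog q w ->
  tswap (tens v w) = sgn K (p * q) *: tens w v.
Proof.
have [t1 t2] := tens_bilin W V.
move=> hv hw; rewrite /tswap tlift_tens; last exact: tswap_bilin.
rewrite (hsum_homog _ hv) ?(hsum_homog _ hw) //.
  by move=> r; apply: lin_scale; apply: t1.
move=> r; apply: lin_bigsum => s; apply: lin_scale; exact: t2.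
Qed.
End TensorGraded.

Record complex (K : fieldType) := Cplx {
  cx_gradedMod :> gradedMod K;
  cdiff : cx_gradedMod -> cx_gradedMod;
  cdiff_linear : linear cdiff;
  cdiff_homog : forall n v, homog n v -> homog (n + 1) (cdiff v);
  cdiffK : forall v, cdiff (cdiff v) = 0 }.

Record chain_map (K : fieldType) (V W : complex K) := ChainMap {
  chain_fun :> V -> W;
  chain_linear : linear chain_fun;
  chain_homog : forall n v, homog n v -> homog n (chain_fun v);
  chain_diff : forall v, chain_fun (cdiff v) = cdiff (chain_fun v) }.

Section TensorCplx.
Variables (K : fieldType) (V W : complex K).

Definition tens_diff : tensor V W -> tensor V W :=
  tlift (fun v w => tens (cdiff v) w + tens (parity v) (cdiff w)).

Lemma tens_diff_bilin : bilin (fun (v : V) (w : W) =>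
  tens (cdiff v) w + tens (parity v) (cdiff w)).
Proof.
have [t1 t2] := tens_bilin V W.
split=> [w|v]; apply: lin_add => //.
- apply: (lin_comp (t1 _)); exact: cdiff_linear.
- apply: (lin_comp (t1 _)); exact: parity_linear.
- apply: (lin_comp (t2 _)); exact: cdiff_linear.
Qed.

Lemma tens_diff_linear : linear tens_diff.
Proof. by apply: tlift_linear; apply: tens_diff_bilin. Qed.

Lemma tens_diff_tens p (v : V) (w : W) : homog p v ->
  tens_diff (tens v w) = tens (cdiff v) w + sgn K p *: tens v (cdiff w).
Proof.
have [t1 t2] := tens_bilin V W.
move=> hv; rewrite /tens_diff tlift_tens; last exact: tens_diff_bilin.
by rewrite (parity_homog hv) (linZ (t1 _)).
Qed.
End TensorCplx.

Section TensorCplx2.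
Variables (K : fieldType) (V W : complex K).
Lemma tens_diff_homog n (t : gtensor V W) :
  homog n t -> @homog K (gtensor V W) (n + 1) (tens_diff t).
Proof.
have lP := @tens_proj_linear K V W (n + 1).
have lD := @tens_diff_linear K V W.
apply: (gtensor_ext (f := fun t => tens_proj (n + 1) (tens_diff t)))
  => //; first exact: (lin_comp lP lD).
move=> p q v w hn hv hw; rewrite (tens_diff_tens _ hv) (linD lP) (linZ lP).
congr (_ + _ *: _); rewrite -hn.
  rewrite (tens_proj_tens _ (cdiff_homog hv) hw) ifT //.
  by apply/eqP; rewrite addrAC.
rewrite (tens_proj_tens _ hv (cdiff_homog hw)) ifT //.
by apply/eqP; rewrite addrA.
Qed.

Lemma tens_diffK (t : gtensor V W) : tens_diff (tens_diff t) = 0.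
Proof.
have lD := @tens_diff_linear K V W.
have [t1 t2] := tens_bilin V W.
move: t; apply: tens_homog_ext; [exact: (lin_comp lD lD) | exact: lin_zero |].
move=> p q v w hv hw; rewrite (tens_diff_tens _ hv) (linD lD) (linZ lD).
rewrite (tens_diff_tens _ (cdiff_homog hv)) (tens_diff_tens _ hv).
rewrite !cdiffK (lin0 (t1 _)) (lin0 (t2 _)) scaler0 addr0 add0r -scalerDl.
by rewrite !sgnE parD /=; case: (par p); rewrite ?addrN ?addNr scale0r.
Qed.

Definition ctensor : complex K :=
  @Cplx K (gtensor V W) _ (@tens_diff_linear K V W) tens_diff_homog tens_diffK.
End TensorCplx2.

(* Conilpotent coalgebras over coLie = Lie^dual.  Since
   (coLie(k) (x) C^k)^(S_k) = Hom_(S_k)(Lie(k), C^k), the structure map is a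
   family of cooperations C -> C^k indexed by Lie(k).  The operad Lie is
   generated by an antisymmetric bracket subject to the Jacobi identity, so the
   family is determined by the cobracket.  The bracketings of k labelled letters
   span Lie(k), so the arity k component of the structure map vanishes on c iff
   the iterated cobrackets [cobracket_tree T] do, for all binary trees T with k
   leaves (relabelling the leaves only permutes the tensor factors).  The
   structure map lands in the direct sum over k iff [cobracket_conil] holds. *)
Inductive btree : Type := Leaf | Node (l r : btree).

Fixpoint leaves (T : btree) : nat :=
  if T is Node l r then (leaves l + leaves r)%N else 1%N.

Section LieCoalgDef.
Variables (K : fieldType) (C : complex K).

(* (x (x) y) (x) z |-> (-1)^(|x|(|y|+|z|)) (y (x) z) (x) x. *)
Definition cyc3 : tensor (tensor C C) C -> tensor (tensor C C) C :=
  fun t => @tswap K C (gtensor C C) (@tassoc K C C C t).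

Definition tens3_sum_cyc (t : tensor (tensor C C) C) :=
  t + cyc3 t + cyc3 (cyc3 t).

Fixpoint tpow (T : btree) : lmodType K :=
  if T is Node l r then tensor (tpow l) (tpow r) else C.

Variable delta : C -> tensor C C.

Fixpoint cobracket_tree (T : btree) : C -> tpow T :=
  match T return C -> tpow T with
  | Leaf => id
  | Node l r => fun c => tmap (cobracket_tree l) (cobracket_tree r) (delta c)
  end.

Definition coradical (n : nat) (c : C) : Prop :=
  forall T, (n < leaves T)%N -> cobracket_tree T c = 0.
End LieCoalgDef.

Record lieCoalg (K : fieldType) := LieCoalg {
  lc_complex :> complex K;
  cobracket : chain_map lc_complex (ctensor lc_complex lc_complex);
  cobracket_anti : forall c, tswap (cobracket c) = - (cobracket c : tensor _ _);
  cobracket_jacobi : forall c,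
    tens3_sum_cyc (tmap cobracket id (cobracket c)) = 0;
  cobracket_conil : forall c, exists n, coradical cobracket n c }.

Arguments cobracket {K l}.

Record lieCoalgMor (K : fieldType) (D C : lieCoalg K) := LieCoalgMor {
  lcm_chain :> chain_map D C;
  lcm_cobracket : forall c,
    cobracket (lcm_chain c) = tmap lcm_chain lcm_chain (cobracket c) }.

Section Sym.
Variables (K : fieldType) (V : gradedMod K).

(* The free non-unital graded commutative algebra Sym^(>=1)(V), generated as a
   vector space by the words in V; the condition on [::] removes Sym^0. *)
Definition sym_adm (W : lmodType K) (g : seq V -> W) : Prop :=
  [/\ g [::] = 0,
      forall u s, linear (fun x => g (u ++ x :: s)) &
      forall u s p q x y, homog p x -> homog q y ->
        g (u ++ x :: y :: s) = sgn K (p * q) *: g (u ++ y :: x :: s)].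

Definition sym : lmodType K := @presented K (seq V) sym_adm.
Definition word (w : seq V) : sym := @pgen K (seq V) sym_adm w.
Definition slift (W : lmodType K) (g : seq V -> W) : sym -> W :=
  @plift K (seq V) sym_adm W g.

Lemma slift_word (W : lmodType K) (g : seq V -> W) w :
  sym_adm g -> slift g (word w) = g w.
Proof. exact: plift_gen. Qed.
Lemma slift_linear (W : lmodType K) (g : seq V -> W) :
  sym_adm g -> linear (slift g).
Proof. exact: plift_is_linear. Qed.

Lemma word_adm : sym_adm word.
Proof.
split=> [|u s a x y|u s p q x y hx hy]; apply: presentedP => W g [g0 g1 g2].
- by rewrite plift_gen // lin0 // ; apply: plift_is_linear.
- by rewrite plift_is_linear // !plift_gen // g1.
- rewrite plift_gen // (linZ (plift_is_linear _)) // plift_gen //.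
  exact: g2 hx hy.
Qed.

Lemma word0 : word [::] = 0. Proof. by case: word_adm. Qed.
Lemma word_lin u s : linear (fun x => word (u ++ x :: s)).
Proof. by case: word_adm. Qed.
Lemma word_swap u s p q x y : homog p x -> homog q y ->
  word (u ++ x :: y :: s) = sgn K (p * q) *: word (u ++ y :: x :: s).
Proof. by case: word_adm => _ _; apply. Qed.
Lemma word1_lin : linear (fun x => word [:: x]).
Proof. exact: (word_lin [::] [::]). Qed.

Lemma sym_ext (U : lmodType K) (f g : sym -> U) :
  linear f -> linear g -> (forall v s, f (word (v :: s)) = g (word (v :: s))) ->
  f =1 g.
Proof.
move=> lf lg h a; rewrite (pgen_span a) !lin_sum //.
apply: eq_bigr => -[k w] _; rewrite !linZ // -[pgen _ _]/(word w).
case: w => [|v s]; last by rewrite h.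
by rewrite word0 (lin0 lf) (lin0 lg).
Qed.

Definition smul (a b : sym) : sym :=
  slift (fun w => slift (fun w' =>
    if nilp w || nilp w' then 0 else word (w ++ w')) b) a.

Lemma nilp_cat (u s : seq V) x : nilp (u ++ x :: s) = false.
Proof. by case: u. Qed.

Lemma smul_adm1 w :
  sym_adm (fun w' => if nilp w || nilp w' then 0 else word (w ++ w')).
Proof.
split=> [|u s a x y|u s p q x y hx hy]; first by rewrite orbT.
  rewrite !nilp_cat orbF; case: nilp; first by rewrite scaler0 addr0.
  by rewrite !catA word_lin.
rewrite !nilp_cat orbF; case: nilp; first by rewrite scaler0.
by rewrite !catA (word_swap _ _ hx hy).
Qed.

Lemma smul_adm2 b : sym_adm (fun w => slift (fun w' =>
    if nilp w || nilp w' then 0 else word (w ++ w')) b).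
Proof.
have L w := slift_linear (smul_adm1 w).
split=> [|u s a x y|u s p q x y hx hy]; move: b.
- apply: (sym_ext (L [::]) (@lin_zero K sym sym)).
  by move=> v s; rewrite (slift_word _ (smul_adm1 [::])).
- apply: (sym_ext (L (u ++ (a *: x + y) :: s))
    (lin_add (lin_scale a (L (u ++ x :: s))) (L (u ++ y :: s)))) => v s'.
  rewrite !slift_word; try exact: smul_adm1.
  by rewrite !nilp_cat /= -!catA !cat_cons word_lin.
- apply: (sym_ext (L (u ++ x :: y :: s))
    (lin_scale (sgn K (p * q)) (L (u ++ y :: x :: s)))) => v s'.
  rewrite !slift_word; try exact: smul_adm1.
  by rewrite !nilp_cat /= -!catA !cat_cons (word_swap _ _ hx hy).
Qed.

Lemma smul_bilin : bilin smul.
Proof.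
split=> [b|a]; first exact: (slift_linear (smul_adm2 b)).
move=> k b b'; move: a.
have L c := slift_linear (smul_adm2 c).
apply: (sym_ext (L (k *: b + b')) (lin_add (lin_scale k (L b)) (L b'))) => v s.
rewrite !slift_word; try exact: smul_adm2.
exact: (slift_linear (smul_adm1 (v :: s))).
Qed.

Lemma smul_word v s v' s' :
  smul (word (v :: s)) (word (v' :: s')) = word (v :: s ++ v' :: s').
Proof.
by rewrite /smul slift_word ?slift_word //; [apply: smul_adm1|apply: smul_adm2].
Qed.

Lemma smulA a b c : smul a (smul b c) = smul (smul a b) c.
Proof.
have [m1 m2] := smul_bilin.
move: a; apply: (sym_ext (m1 (smul b c)) (lin_comp (m1 c) (m1 b))) => v s.
have mw := m2 (word (v :: s)).
move: b; apply: (sym_ext (lin_comp mw (m1 c)) (lin_comp (m1 c) mw)) => v' s'.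
move: c; apply: (sym_ext (lin_comp mw (m2 (word (v' :: s')))) (m2 _)).
by move=> v2 s2; rewrite !smul_word -catA.
Qed.

(* The part of the word u ++ w in which the letters of w have total degree n. *)
Fixpoint wproj (u : seq V) (n : int) (w : seq V) : sym :=
  if w is v :: s then hsum (fun p v' => wproj (rcons u v') (n - p) s) v
  else if n == 0 then word u else 0.

Lemma wproj_lin1 w : forall u s n,
  linear (fun x => wproj (u ++ x :: s) n w).
Proof.
elim: w => [|v w IH] u s n /=.
  by case: eqP => _; [exact: word_lin | exact: lin_zero].
apply: lin_bigsum => p a x y; rewrite !rcons_cat /=.
exact: (IH u (rcons s (gproj p v)) (n - p) a x y).
Qed.

Lemma wproj_lin1r w u n : linear (fun x => wproj (rcons u x) n w).
Proof. by move=> a x y; rewrite -!cats1; apply: wproj_lin1. Qed.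

Lemma wproj_lin2 u : forall u0 s n, linear (fun x => wproj u0 n (u ++ x :: s)).
Proof.
elim: u => [|v u IH] u0 s n /=.
  by apply: hsum_linear => p; apply: wproj_lin1r.
by apply: lin_bigsum => p; apply: IH.
Qed.

Lemma wproj_swap1 p q x y (w : seq V) : homog p x -> homog q y ->
  forall u s n, wproj (u ++ x :: y :: s) n w =
    sgn K (p * q) *: wproj (u ++ y :: x :: s) n w.
Proof.
move=> hx hy; elim: w => [|v w IH] u s n /=.
  case: eqP => _; [exact: word_swap | by rewrite scaler0].
rewrite /hsum scaler_sumr; apply: eq_bigr => r _.
by rewrite !rcons_cat /= IH.
Qed.

Lemma wproj_homog u n v s p : homog p v ->
  wproj u n (v :: s) = wproj (rcons u v) (n - p) s.
Proof. by move=> hv /=; rewrite (hsum_homog _ hv) // => q; apply: wproj_lin1r. Qed.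

Lemma wproj_adm n : sym_adm (wproj [::] n).
Proof.
split=> [/=|u s|u s p q x y hx hy].
- by rewrite word0; case: eqP.
- exact: wproj_lin2.
elim: u [::] n => [|v u IH] u0 n.
  rewrite !cat0s (wproj_homog _ _ _ hx) (wproj_homog _ _ _ hy).
  rewrite (wproj_homog _ _ _ hy) (wproj_homog _ _ _ hx).
  rewrite -!cats1 -!catA (wproj_swap1 _ hx hy) /=.
  by congr (_ *: wproj _ _ _); rewrite addrAC.
by rewrite /= /hsum scaler_sumr; apply: eq_bigr => r _; apply: IH.
Qed.

Definition sproj (n : int) : sym -> sym := slift (wproj [::] n).
Lemma sproj_linear n : linear (sproj n).
Proof. exact: (slift_linear (wproj_adm n)). Qed.

Fixpoint hword (ds : seq int) (w : seq V) : Prop :=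
  match ds, w with
  | d :: ds', v :: w' => homog d v /\ hword ds' w'
  | [::], [::] => True
  | _, _ => False
  end.

Lemma wproj_hword ds w u n : hword ds w ->
  wproj u n w = if n == \sum_(d <- ds) d then word (u ++ w) else 0.
Proof.
elim: ds w u n => [|d ds IH] [|v w] u n; try by [].
  by rewrite /= big_nil cats0.
move=> [hv hw]; rewrite (wproj_homog _ _ _ hv) (IH _ _ _ hw) cat_rcons.
by rewrite big_cons subr_eq addrC.
Qed.

Lemma sproj_hword n ds w : hword ds w ->
  sproj n (word w) = if n == \sum_(d <- ds) d then word w else 0.
Proof.
move=> h; rewrite /sproj slift_word; last exact: wproj_adm.
exact: wproj_hword.
Qed.

Lemma multilin_hext (U : lmodType K) (f g : seq V -> U) :
  (forall u s, linear (fun x => f (u ++ x :: s))) ->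
  (forall u s, linear (fun x => g (u ++ x :: s))) ->
  (forall ds w, hword ds w -> f w = g w) -> f =1 g.
Proof.
move=> lf lg h w.
suff key u s : (exists ds, hword ds u) -> f (u ++ s) = g (u ++ s).
  by apply: (key [::] w); exists [::].
elim: s u => [|x s IH] u hu; first by case: hu => ds hu; rewrite cats0 (h ds).
move: x; apply: (homog_ext (lf u s) (lg u s)) => n x hx.
rewrite -cat_rcons; apply: IH; case: hu => ds hu; exists (rcons ds n).
by elim: ds u hu {h} => [|d ds IH] [|v u] //= [hv hu]; split=> //; apply: IH.
Qed.

Lemma sym_hext (U : lmodType K) (f g : sym -> U) :
  linear f -> linear g ->
  (forall ds w, hword ds w -> f (word w) = g (word w)) -> f =1 g.
Proof.
move=> lf lg h; apply: sym_ext => // v s; move: (v :: s) => {v s} w.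
move: w; apply: multilin_hext => // u s;
  [exact: (lin_comp lf (word_lin u s)) | exact: (lin_comp lg (word_lin u s))].
Qed.

Lemma sprojK m n a : sproj m (sproj n a) = if m == n then sproj n a else 0.
Proof.
have L := sproj_linear.
move: a; apply: sym_hext; first exact: (lin_comp (L m) (L n)).
  by case: eqP => _; [exact: L | exact: lin_zero].
move=> ds w hw; rewrite (sproj_hword n hw).
have [->|hn] := eqVneq n (\sum_(d <- ds) d); first by rewrite (sproj_hword _ hw).
by rewrite (lin0 (L m)) if_same.
Qed.

Lemma sproj_fin a : exists s : seq int,
  uniq s /\ a = \sum_(n <- s) sproj n a.
Proof.
have L := sproj_linear.
pose P (t : sym) := exists s : seq int,
  forall r, uniq r -> {subset s <= r} -> t = \sum_(n <- r) sproj n t.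
have P0 : P 0 by exists [::] => r _ _; rewrite big1 // => n _; apply: lin0.
have PL k x y : P x -> P y -> P (k *: x + y).
  move=> [s hs] [s' hs']; exists (s ++ s') => r ur h.
  transitivity (\sum_(n <- r) (k *: sproj n x + sproj n y)); last first.
    by apply: eq_bigr => n _; rewrite L.
  rewrite big_split -scaler_sumr -hs -?hs' // => n hn; apply: h;
    by rewrite mem_cat hn ?orbT.
have Psum (I : Type) (l : seq I) (F : I -> sym) :
    (forall i, P (F i)) -> P (\sum_(i <- l) F i).
  move=> hF; elim: l => [|i l IH]; first by rewrite big_nil.
  by rewrite big_cons -[F i]scale1r; apply: PL.
have Ph ds w : hword ds w -> P (word w).
  move=> hw; exists [:: \sum_(d <- ds) d] => r ur h.
  have hr : \sum_(d <- ds) d \in r by apply: h; rewrite inE.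
  rewrite (bigD1_seq _ hr) //= (sproj_hword _ hw) eqxx big1 ?addr0 //.
  by move=> n /negPf hn; rewrite (sproj_hword _ hw) hn.
have Pw u s : (exists ds, hword ds u) -> P (word (u ++ s)).
  elim: s u => [|x s IH] u hu; first by case: hu => ds /Ph; rewrite cats0.
  rewrite (gsuppE x) (lin_sum (word_lin u s)); apply: (Psum _ _ _) => n.
  rewrite -cat_rcons; apply: IH; case: hu => ds hu; exists (rcons ds n).
  elim: ds u hu => [|d ds IH] [|v u] //=; first by split=> //; apply: homog_gproj.
  by move=> [hv hu]; split=> //; apply: IH.
have [s hs] : P a.
  rewrite (pgen_span a); apply: (Psum _ _ _) => -[k w] /=.
  rewrite -[X in P X]addr0; apply: (PL _ _ _ _ P0).
  by apply: (Pw [::] w); exists [::].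
exists (undup s); split; first exact: undup_uniq.
by apply: hs; [exact: undup_uniq | move=> n; rewrite mem_undup].
Qed.

Definition gsym : gradedMod K := Gmod sproj_linear sprojK sproj_fin.

Lemma homog_word ds w : hword ds w -> @homog K gsym (\sum_(d <- ds) d) (word w).
Proof. by move=> h; rewrite /homog /= (sproj_hword _ h) eqxx. Qed.

Lemma gsym_ext n (U : lmodType K) (f g : sym -> U) :
  linear f -> linear g ->
  (forall ds w, hword ds w -> \sum_(d <- ds) d = n -> f (word w) = g (word w)) ->
  forall a : gsym, homog n a -> f a = g a.
Proof.
move=> lf lg h a <-; have L := sproj_linear.
rewrite -[LHS]/((fun t => f (sproj n t)) a).
rewrite -[RHS]/((fun t => g (sproj n t)) a).
move: a; apply: sym_hext; [exact: (lin_comp lf (L n))|exact: (lin_comp lg (L n))|].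
move=> ds w hw; rewrite (sproj_hword _ hw).
by case: eqP => [/esym E|_]; [apply: h E | rewrite !lin0].
Qed.
End Sym.

Section SymFacts.
Variables (K : fieldType) (V : gradedMod K).
Implicit Types (a b : sym V).

Lemma hword_cat ds ds' (w w' : seq V) :
  hword ds w -> hword ds' w' -> hword (ds ++ ds') (w ++ w').
Proof.
elim: ds w => [|d ds IH] [|v w] //= [hv hw] h'; split=> //; exact: IH.
Qed.

Lemma smul_homog m n a b : @homog K (gsym V) m a -> @homog K (gsym V) n b ->
  @homog K (gsym V) (m + n) (smul a b).
Proof.
have [m1 m2] := smul_bilin V; have L := @sproj_linear K V (m + n).
move=> ha; move: b.
apply: (gsym_ext (lin_comp L (m2 a)) (m2 a)) => ds w hw dw; move: a ha.
apply: (gsym_ext (lin_comp L (m1 _)) (m1 _)) => ds' w' hw' dw'.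
case: w hw => [|v w] hw; first by rewrite word0 (lin0 (m2 _)) (lin0 L).
case: w' hw' => [|v' w'] hw'.
  by rewrite word0 (lin0 (m1 _)) (lin0 L).
rewrite smul_word -dw -dw' -big_cat; apply: homog_word.
exact: hword_cat hw' hw.
Qed.

Lemma word_move p x ds (w : seq V) u : homog p x -> hword ds w ->
  word (u ++ x :: w) = sgn K (p * \sum_(d <- ds) d) *: word (u ++ w ++ [:: x]).
Proof.
move=> hx; elim: ds w u => [|d ds IH] [|v w] u; try by [].
  by rewrite big_nil mulr0 /sgn expr0z scale1r.
move=> [hv hw]; rewrite (word_swap _ _ hx hv) -cat_rcons (IH _ _ hw) scalerA.
rewrite big_cons cat_rcons; congr (_ *: _).
by rewrite !sgnE !(parM, parD) -signr_addb; case: (par p).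
Qed.

Lemma smul_comm p x n a : homog p x -> @homog K (gsym V) n a ->
  smul (word [:: x]) a = sgn K (p * n) *: smul a (word [:: x]).
Proof.
have [m1 m2] := smul_bilin V.
move=> hx; move: a; apply: (gsym_ext (m2 _) (lin_scale _ (m1 _))) => ds w hw dw.
case: w hw => [|v w] hw.
  by rewrite word0 (lin0 (m2 _)) (lin0 (m1 _)) scaler0.
by rewrite !smul_word -dw -(word_move [::] hx hw).
Qed.
End SymFacts.

(* The suspension sV, with (sV)^n = V^(n-1), has the same total space as V; the
   element s v is written v, with a type ascription. *)
Section Shift.
Variables (K : fieldType) (V : gradedMod K).
Lemma gshiftK m n (v : V) :
  gproj (m - 1) (gproj (n - 1) v) = if m == n then gproj (n - 1) v else 0.
Proof. by rewrite gprojK (can_eq (subrK 1)). Qed.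
Lemma gshift_fin (v : V) :
  exists s : seq int, uniq s /\ v = \sum_(n <- s) gproj (n - 1) v.
Proof.
exists [seq n + 1 | n <- gsupp v]; split.
  by rewrite map_inj_uniq ?gsupp_uniq //; apply: addIr.
rewrite big_map {1}[v]gsuppE; apply: eq_bigr => n _; by rewrite addrK.
Qed.
Definition gshift : gradedMod K :=
  @Gmod K V (fun n => gproj (n - 1)) (fun n => gproj_linear (n - 1))
    gshiftK gshift_fin.

Lemma homog_shift n (v : V) : homog n v -> @homog K gshift (n + 1) v.
Proof. by rewrite /homog /= addrK. Qed.
Lemma homog_unshift n (v : V) : @homog K gshift n v -> homog (n - 1) v.
Proof. by []. Qed.
End Shift.

Section Cobar.
Variables (K : fieldType) (C : lieCoalg K).
Local Notation S := (gshift C).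

(* The cobar differential is the derivation of Sym^(>=1)(sC) with
     d (s c) = - s (d c) - 1/2 sum (-1)^|c'| (s c') (s c''),
   where sum c' (x) c'' is the cobracket of c.  The signs come from moving s
   past d and past c'; with the overall sign of the quadratic part chosen here, the
   algebra maps from the cobar construction to K are the Maurer-Cartan elements
   of the dual Lie algebra.  The value on a word is given by the Leibniz rule,
   and [cobar_diff_smul] is the resulting derivation property. *)
Definition cobar_quad : tensor C C -> sym S :=
  tlift (fun a b : C => word [:: (parity a : S); (b : S)]).

Definition cobar_gen (c : C) : sym S :=
  - word [:: (cdiff c : S)] - 2^-1 *: cobar_quad (cobracket c).

Definition rmulw (a : sym S) (s : seq S) : sym S :=
  if s is [::] then a else smul a (word s).

Fixpoint cobar_word (w : seq S) : sym S :=
  if w is v :: s then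
    rmulw (cobar_gen v) s + smul (word [:: parity v]) (cobar_word s)
  else 0.

Definition cobar_diff : sym S -> sym S := slift cobar_word.

Lemma cobracket_linear : linear (cobracket : C -> tensor C C).
Proof. exact: (chain_linear cobracket). Qed.

Lemma cobar_quad_bilin :
  bilin (fun a b : C => word [:: (parity a : S); (b : S)]).
Proof.
split=> [b|a].
  exact: (lin_comp (@word_lin K S [::] [:: (b : S)]) (@parity_linear K C)).
exact: (@word_lin K S [:: (parity a : S)] [::]).
Qed.
Lemma cobar_quad_linear : linear cobar_quad.
Proof. exact: (tlift_linear cobar_quad_bilin). Qed.
Lemma cobar_quad_tens p (a b : C) : homog p a ->
  cobar_quad (tens a b) = sgn K p *: word [:: (a : S); (b : S)].
Proof.
move=> ha; rewrite /cobar_quad (tlift_tens _ _ cobar_quad_bilin).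
by rewrite (parity_homog ha) (linZ (@word_lin K S [::] [:: (b : S)])).
Qed.

Lemma cobar_gen_linear : linear cobar_gen.
Proof.
apply: lin_add; apply: lin_opp.
  exact: (lin_comp (@word1_lin K S) (@cdiff_linear K C)).
apply: lin_scale; exact: (lin_comp cobar_quad_linear cobracket_linear).
Qed.

Lemma cobar_quad_homog n (t : tensor C C) : @homog K (gtensor C C) n t ->
  @homog K (gsym S) (n + 2) (cobar_quad t).
Proof.
have L := @sproj_linear K S (n + 2); have Q := cobar_quad_linear.
move: t; apply: (gtensor_ext (lin_comp L Q) Q) => p q a b hn ha hb.
rewrite (cobar_quad_tens _ ha) (linZ L); congr (_ *: _).
have -> : n + 2 = \sum_(d <- [:: p + 1; q + 1]) d.
  by rewrite !big_cons big_nil addr0 -hn addrACA.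
apply: homog_word; split; first exact: homog_shift.
by split=> //; apply: homog_shift.
Qed.

Lemma cobar_gen_homog n (v : S) : homog n v ->
  @homog K (gsym S) (n + 1) (cobar_gen v).
Proof.
move=> /homog_unshift hv; apply: homogD; apply: homogN.
  have /homog_shift h := cdiff_homog hv; rewrite subrK in h.
  have -> : n + 1 = \sum_(d <- [:: n + 1]) d by rewrite big_seq1.
  exact: homog_word.
apply: homogZ; have := cobar_quad_homog (chain_homog cobracket hv).
by rewrite -addrA.
Qed.


Lemma rmulw_lin1 s : linear (fun a => rmulw a s).
Proof.
by case: s => [|v s]; [exact: lin_id | have [m1 _] := smul_bilin S; exact: m1].
Qed.
Lemma rmulw_lin2 a u s : linear (fun x => rmulw a (u ++ x :: s)).
Proof.
have [_ m2] := smul_bilin S.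
by case: u => [|v u] /=; apply: (lin_comp (m2 a)); [exact: (word_lin [::] s)
  | exact: (word_lin (v :: u) s)].
Qed.
Lemma rmulw_smul a b s : rmulw (smul a b) s = smul a (rmulw b s).
Proof. by case: s => [|v s] //=; rewrite smulA. Qed.
Lemma rmulw_cons a v s : rmulw a (v :: s) = rmulw (smul a (word [:: v])) s.
Proof. by case: s => [|w s] //=; rewrite -smulA smul_word. Qed.

Lemma cobar_word_adm : sym_adm cobar_word.
Proof.
have [m1 m2] := smul_bilin S.
split=> [|u s|u s p q x y hx hy] //.
  elim: u => [|v u IH] /=.
    apply: lin_add; first exact: (lin_comp (rmulw_lin1 s) cobar_gen_linear).
    exact: (lin_comp (m1 _) (lin_comp (@word1_lin K S) (@parity_linear K S))).
  by apply: lin_add; [exact: rmulw_lin2 | exact: (lin_comp (m2 _) IH)].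
elim: u => [|v u IH]; last first.
  rewrite /= IH (linZ (m2 _)) scalerDr; congr (_ + _).
  case: u {IH} => [|w u] /=.
    by rewrite (word_swap [::] s hx hy) (linZ (m2 _)).
  by rewrite (word_swap (w :: u) s hx hy) (linZ (m2 _)).
have gx := smul_comm hx (cobar_gen_homog hy).
have gy := smul_comm hy (cobar_gen_homog hx).
rewrite !cat0s /= -!/(rmulw _ (_ :: _)).
rewrite !rmulw_cons (parity_homog hx) (parity_homog hy).
rewrite !(linD (m2 _)) -!rmulw_smul !smulA.
rewrite !(linZ (@word1_lin K S)) !(linZ (m1 _)) !(linZ (m2 _)) !(linZ (m1 _)).
rewrite !smul_word /= (word_swap [::] [::] hx hy) gx gy.
rewrite !(linZ (rmulw_lin1 _)) !(linZ (m1 _)) !scalerDr !scalerA.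
rewrite [in RHS]addrCA cat0s.
rewrite !sgnE !(parM, parD); case: (par p); case: (par q) => /=;
  by rewrite !(expr0, expr1, mul1r, mulr1, mulN1r, opprK, scale1r).
Qed.

Lemma cobar_diff_linear : linear cobar_diff.
Proof. exact: (slift_linear cobar_word_adm). Qed.
Lemma cobar_diff_word w : cobar_diff (word w) = cobar_word w.
Proof. exact: (slift_word _ cobar_word_adm). Qed.

Lemma cobar_diff_homog n (a : gsym S) :
  homog n a -> @homog K (gsym S) (n + 1) (cobar_diff a).
Proof.
have L := @sproj_linear K S (n + 1); have D := cobar_diff_linear.
have [m1 m2] := smul_bilin S.
move: a; apply: (gsym_ext (lin_comp L D) D) => ds w hw <- {n L}.
rewrite !cobar_diff_word.
elim: ds w hw => [|d ds IH] [|v w]; try by [].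
  by move=> _; apply: (@homog0 K (gsym S)).
move=> [hv hw]; rewrite big_cons; apply: (@homogD K (gsym S)).
  case: w hw => [|v' w] hw.
    by case: ds hw {IH} => //; rewrite big_nil addr0 => _; apply: cobar_gen_homog.
  rewrite addrAC; apply: smul_homog; first exact: cobar_gen_homog.
  exact: homog_word.
rewrite -addrA; apply: smul_homog; last exact: IH.
rewrite (parity_homog hv) (linZ (@word1_lin K S)).
apply: (@homogZ K (gsym S)).
have -> : d = \sum_(e <- [:: d]) e by rewrite big_seq1.
exact: homog_word.
Qed.

Lemma cobar_diff_smul m (a b : sym S) : @homog K (gsym S) m a ->
  cobar_diff (smul a b) =
    smul (cobar_diff a) b + sgn K m *: smul a (cobar_diff b).
Proof.
have D := cobar_diff_linear; have [m1 m2] := smul_bilin S.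
move: a; apply: (gsym_ext (lin_comp D (m1 b)) (lin_add (lin_comp (m1 b) D)
  (lin_scale _ (m1 _)))) => ds w hw <- {m}.
move: b; apply: (sym_ext (lin_comp D (m2 _)) (lin_add (m2 _)
  (lin_scale _ (lin_comp (m2 _) D)))) => v' s'.
have : nilp (v' :: s') = false by [].
move: (v' :: s') => b nb {v' s'}.
elim: ds w hw => [|d ds IH] [|v w]; try by [].
  by move=> _; rewrite word0 !(lin0 (m1 _)) (lin0 D) (lin0 (m1 _)) scaler0 addr0.
move=> [hv hw].
case: w hw => [|v2 w] hw.
  case: ds hw {IH} => // _; rewrite big_seq1.
  case: b nb => // v' s' _; rewrite smul_word !cobar_diff_word /=.
  by rewrite (lin0 (m2 _)) addr0 (parity_homog hv) (linZ (@word1_lin K S))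
    (linZ (m1 _)).
have IHw := IH _ hw.
have -> : word [:: v, v2 & w] = smul (word [:: v]) (word (v2 :: w)).
  by rewrite smul_word.
have E c : cobar_diff (smul (word [:: v]) c) =
    smul (cobar_gen v) c + sgn K d *: smul (word [:: v]) (cobar_diff c).
  move: c; apply: (sym_ext (lin_comp D (m2 _)) (lin_add (m2 _)
    (lin_scale _ (lin_comp (m2 _) D)))) => v3 s3.
  rewrite smul_word !cobar_diff_word /=.
  by rewrite (parity_homog hv) (linZ (@word1_lin K S)) (linZ (m1 _)).
rewrite -smulA !E IHw (linD (m1 _)) (linZ (m1 _)) !(linD (m2 _)) (linZ (m2 _)).
rewrite !smulA scalerDr scalerA addrA big_cons; congr (_ + _ *: _).
by rewrite !sgnE !parD -signr_addb.
Qed.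

Definition quad3 : tensor (tensor C C) C -> sym S :=
  tlift (fun t (z : C) => smul
    (tlift (fun x y : C => word [:: (x : S); (parity y : S)]) t)
    (word [:: (z : S)])).

Lemma quad3_bilin1 :
  bilin (fun x y : C => word [:: (x : S); (parity y : S)]).
Proof.
split=> [b|a]; first exact: (@word_lin K S [::] [:: (parity b : S)]).
exact: (lin_comp (@word_lin K S [:: (a : S)] [::]) (@parity_linear K C)).
Qed.
Lemma quad3_bilin : bilin (fun (t : tensor C C) (z : C) => smul
    (tlift (fun x y : C => word [:: (x : S); (parity y : S)]) t)
    (word [:: (z : S)])).
Proof.
have [m1 m2] := smul_bilin S.
split=> [z|t]; first exact: (lin_comp (m1 _) (tlift_linear quad3_bilin1)).
exact: (lin_comp (m2 _) (@word1_lin K S)).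
Qed.
Lemma quad3_linear : linear quad3.
Proof. exact: (tlift_linear quad3_bilin). Qed.
Lemma quad3_tens q (x y z : C) : homog q y ->
  quad3 (tens (tens x y) z) = sgn K q *: word [:: (x : S); (y : S); (z : S)].
Proof.
have [m1 m2] := smul_bilin S; move=> hy.
rewrite /quad3 (tlift_tens _ _ quad3_bilin) (tlift_tens _ _ quad3_bilin1).
rewrite (parity_homog hy) (linZ (@word_lin K S [:: (x : S)] [::])).
by rewrite (linZ (m1 _)) smul_word.
Qed.

Lemma cyc3_linear : linear (@cyc3 K C).
Proof.
move=> a x y; rewrite /cyc3 (@tassoc_linear K C C C a x y).
exact: (@tswap_linear K C (gtensor C C)).
Qed.

Lemma tens3_homog_ext (U : lmodType K) (f g : tensor (tensor C C) C -> U) :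
  linear f -> linear g ->
  (forall p q r x y z, homog p x -> homog q y -> homog r z ->
    f (tens (tens x y) z) = g (tens (tens x y) z)) -> f =1 g.
Proof.
move=> lf lg h; have [t1 t2] := tens_bilin (tensor C C) C.
apply: tens_ext => // t z.
move: t; apply: (tens_homog_ext (lin_comp lf (t1 z)) (lin_comp lg (t1 z))).
move=> p q x y hx hy.
move: z; apply: (homog_ext (lin_comp lf (t2 _)) (lin_comp lg (t2 _))).
by move=> r z hz; apply: h hx hy hz.
Qed.

Lemma quad3_cyc t : quad3 (cyc3 t) = quad3 t.
Proof.
move: t; apply: (tens3_homog_ext (lin_comp quad3_linear cyc3_linear)
  quad3_linear) => p q r x y z hx hy hz.
rewrite /cyc3 tassoc_tens (@tswap_tens K C (gtensor C C) p (q + r)) //;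
  last exact: homog_tens.
rewrite (linZ quad3_linear) (quad3_tens _ _ hz) (quad3_tens _ _ hy) scalerA.
have hw : hword [:: q + 1; r + 1] [:: (y : S); (z : S)].
  by split; [exact: homog_shift | split=> //; exact: homog_shift].
rewrite (word_move [::] (homog_shift hx) hw) /= scalerA; congr (_ *: _).
rewrite !big_cons big_nil addr0 !sgnE !(parM, parD) -!signr_addb.
by case: (par p); case: (par q); case: (par r).
Qed.

Lemma cobar_quad_mul p (a b : C) : homog p a ->
  sgn K p *: smul (cobar_quad (cobracket a)) (word [:: (b : S)]) =
  quad3 (tmap cobracket id (tens a b)).
Proof.
have [m1 m2] := smul_bilin S; have [t1 t2] := tens_bilin (tensor C C) C.
move=> ha; rewrite (tmap_tens cobracket_linear (@lin_id K C)) /=.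
have hd := chain_homog cobracket ha.
have LQ := lin_comp (m1 (word [:: (b : S)])) cobar_quad_linear.
apply: (gtensor_ext (lin_scale _ LQ) (lin_comp quad3_linear (t1 b)) _ hd).
move=> r s x y hn hx hy /=.
rewrite (quad3_tens _ _ hy) (cobar_quad_tens _ hx) (linZ (m1 _)) smul_word.
rewrite scalerA -hn; congr (_ *: _).
by rewrite !sgnE !parD -signr_addb; case: (par r); case: (par s).
Qed.

Definition quad2 (t : tensor C C) := quad3 (tmap cobracket id t).

Lemma quad2_linear : linear quad2.
Proof.
exact: (lin_comp quad3_linear (tmap_linear cobracket_linear (@lin_id K C))).
Qed.

Lemma cobar_diff_quad t : cobar_diff (cobar_quad t) =
  cobar_quad (tens_diff t) - 2^-1 *: (quad2 t - quad2 (tswap t)).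
Proof.
have D := cobar_diff_linear; have [m1 m2] := smul_bilin S.
have Q := cobar_quad_linear; have Q2 := quad2_linear.
have Qw := linZ (@word1_lin K S).
move: t; apply: (tens_homog_ext (lin_comp D Q) (lin_add
  (lin_comp Q (@tens_diff_linear K C C)) (lin_opp (lin_scale _ (lin_add Q2
  (lin_opp (lin_comp Q2 (@tswap_linear K C C)))))))) => p q a b ha hb.
rewrite (cobar_quad_tens _ ha) (linZ D) cobar_diff_word.
rewrite (tswap_tens ha hb) (linZ Q2) /quad2 -(cobar_quad_mul b ha).
rewrite -(cobar_quad_mul a hb).
rewrite (tens_diff_tens _ ha) (linD Q) (linZ Q).
rewrite (cobar_quad_tens _ ha) (cobar_quad_tens _ (cdiff_homog ha)) scalerA.
rewrite /= (lin0 (m2 _)) addr0 (parity_homog (homog_shift ha)) Qw.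
rewrite (linZ (m1 _)).
have hqb := cobar_quad_homog (chain_homog cobracket hb).
have := smul_comm (homog_shift ha) hqb.
rewrite /cobar_gen (linD (m1 _)) (linD (m2 _)) !(linN (m1 _)) !(linN (m2 _)).
rewrite (linZ (m1 _)) (linZ (m2 _)) !smul_word /= => ->.
move: (smul (cobar_quad (cobracket a)) _) (smul (cobar_quad (cobracket b)) _) => X Y.
move: (@word K S [:: (a : S); (cdiff b : S)]) => A.
move: (@word K S [:: (cdiff a : S); (b : S)]) => B.
rewrite !sgnE !(parM, parD).
case: (par p); case: (par q) => /=;
  rewrite !(expr0, expr1, mul1r, mulr1, mulN1r, opprK, scale1r, scaleN1r);
  by rewrite ?(scalerN, opprD, opprK, scalerBr, scalerDr) addrACA.
Qed.


Hypothesis charK : [pchar K] =i pred0.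

Lemma cobracket_quad3 (c : C) : quad2 (cobracket c) = 0.
Proof.
have := congr1 quad3 (cobracket_jacobi c); rewrite /tens3_sum_cyc.
rewrite !(linD quad3_linear) !quad3_cyc (lin0 quad3_linear) => /eqP.
rewrite -mulr2n -mulrSr -scaler_nat scaler_eq0 => /orP[|/eqP //].
by rewrite ((pcharf0P _).1 charK).
Qed.

Lemma cobar_diff_gen c : cobar_diff (cobar_gen c) = 0.
Proof.
have D := cobar_diff_linear; have Q := cobar_quad_linear.
rewrite {1}/cobar_gen (linD D) !(linN D) (linZ D) cobar_diff_word /=.
rewrite (lin0 (proj2 (smul_bilin S) _)) addr0 /cobar_gen cdiffK.
rewrite (lin0 (@word1_lin K S)) cobar_diff_quad (chain_diff cobracket).
rewrite cobracket_anti (linN quad2_linear) cobracket_quad3 oppr0 subr0 scaler0 subr0.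
by rewrite sub0r opprK; apply: subrr.
Qed.

Lemma cobar_diffK (a : gsym S) : cobar_diff (cobar_diff a) = 0.
Proof.
have D := cobar_diff_linear; have [m1 m2] := smul_bilin S.
move: a; apply: (sym_hext (lin_comp D D) (@lin_zero K _ _)) => ds w.
rewrite cobar_diff_word; elim: ds w => [|d ds IH] [|v w]; try by [].
  by move=> _; rewrite (lin0 D).
move=> [hv hw]; have IHw := IH _ hw.
have hwd : @homog K (gsym S) d (word [:: v]).
  have -> : d = \sum_(e <- [:: d]) e by rewrite big_seq1.
  exact: homog_word.
rewrite /= (linD D) (parity_homog hv) (linZ (@word1_lin K S)) (linZ (m1 _)).
rewrite (linZ D) (cobar_diff_smul _ hwd) cobar_diff_word /=.
rewrite (lin0 (m2 _)) addr0 IHw (lin0 (m2 _)) scaler0 addr0.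
case: w hw {IH IHw} => [|v' w] hw.
  by rewrite cobar_diff_gen (lin0 (m2 _)) scaler0 addr0.
rewrite /rmulw (cobar_diff_smul _ (cobar_gen_homog hv)) cobar_diff_gen.
rewrite (lin0 (m1 _)) add0r cobar_diff_word -scalerDl.
by rewrite !sgnE parD; case: (par d); rewrite ?addrN ?addNr scale0r.
Qed.

Definition cobar : complex K :=
  @Cplx K (gsym S) _ cobar_diff_linear cobar_diff_homog cobar_diffK.
End Cobar.

Section CobarMap.
Variables (K : fieldType) (charK : [pchar K] =i pred0).
Variables (D C : lieCoalg K) (f : lieCoalgMor D C).
Local Notation SD := (gshift D).
Local Notation SC := (gshift C).

Definition cobar_fun : sym SD -> sym SC :=
  @slift K SD _ (fun w => @word K SC [seq f x | x <- w]).

Lemma cobar_fun_adm : @sym_adm K SD _ (fun w => @word K SC [seq f x | x <- w]).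
Proof.
split=> [|u s a x y|u s p q x y hx hy]; rewrite ?word0 //.
  by rewrite !map_cat /= (chain_linear f) (@word_lin K SC).
by rewrite !map_cat /= (@word_swap K SC _ _ p q) //; apply: (chain_homog f).
Qed.
Lemma cobar_fun_linear : linear cobar_fun.
Proof. exact: (slift_linear cobar_fun_adm). Qed.
Lemma cobar_fun_word w : cobar_fun (word w) = @word K SC [seq f x | x <- w].
Proof. exact: (slift_word _ cobar_fun_adm). Qed.

Lemma hword_map ds (w : seq SD) : hword ds w ->
  @hword K SC ds [seq f x | x <- w].
Proof.
elim: ds w => [|d ds IH] [|v w] //= [hv hw]; split; last exact: IH.
exact: (chain_homog f).
Qed.

Lemma cobar_fun_homog n (a : gsym SD) :
  homog n a -> @homog K (gsym SC) n (cobar_fun a).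
Proof.
have F := cobar_fun_linear; have L := @sproj_linear K SC n.
move: a; apply: (gsym_ext (lin_comp L F) F) => ds w hw <-.
rewrite cobar_fun_word; apply: homog_word; exact: hword_map.
Qed.

Lemma cobar_fun_smul a b :
  cobar_fun (smul a b) = smul (cobar_fun a) (cobar_fun b).
Proof.
have F := cobar_fun_linear.
have [m1 m2] := smul_bilin SD; have [n1 n2] := smul_bilin SC.
move: a; apply: (sym_ext (lin_comp F (m1 b)) (lin_comp (n1 _) F)) => v s.
move: b; apply: (sym_ext (lin_comp F (m2 _)) (lin_comp (n2 _) F)) => v' s'.
by rewrite smul_word !cobar_fun_word smul_word /= map_cat.
Qed.

Lemma cobar_fun_quad t :
  cobar_fun (cobar_quad t) = cobar_quad (tmap f f t).
Proof.
have F := cobar_fun_linear; have lf := chain_linear f.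
move: t; apply: (tens_homog_ext (lin_comp F (@cobar_quad_linear K D))
  (lin_comp (@cobar_quad_linear K C) (tmap_linear lf lf))) => p q a b ha hb.
rewrite (tmap_tens lf lf) (cobar_quad_tens _ ha).
by rewrite (cobar_quad_tens _ (chain_homog f ha)) (linZ F) cobar_fun_word.
Qed.

Lemma cobar_fun_gen c : cobar_fun (cobar_gen c) = cobar_gen (f c).
Proof.
have F := cobar_fun_linear.
rewrite /cobar_gen (linD F) !(linN F) (linZ F) cobar_fun_word cobar_fun_quad /=.
by rewrite (chain_diff f) (lcm_cobracket f).
Qed.

Lemma cobar_fun_diff (a : gsym SD) :
  cobar_fun (cobar_diff a) = cobar_diff (cobar_fun a).
Proof.
have F := cobar_fun_linear.
have DD := @cobar_diff_linear K D; have DC := @cobar_diff_linear K C.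
move: a; apply: (sym_hext (lin_comp F DD) (lin_comp DC F)) => ds w.
rewrite cobar_fun_word !cobar_diff_word.
elim: ds w => [|d ds IH] [|v w]; try by [].
  by rewrite /= (lin0 F).
move=> [hv hw]; have IHw := IH _ hw.
rewrite /= (linD F) cobar_fun_smul IHw cobar_fun_word /=.
rewrite (parity_homog hv) (@parity_homog K SC d (f v) (chain_homog f hv)).
rewrite (linZ (chain_linear f)); congr (_ + _).
by case: w {hw IHw IH} => [|v' w]; rewrite /= ?cobar_fun_smul cobar_fun_gen
  ?cobar_fun_word.
Qed.

Definition cobar_map : chain_map (cobar D charK) (cobar C charK) :=
  @ChainMap K (cobar D charK) (cobar C charK) _
    cobar_fun_linear cobar_fun_homog cobar_fun_diff.
End CobarMap.

(* Injectivity and surjectivity of the map induced on H^n = ker d / im d. *)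
Definition quasi_isomorphism (K : fieldType) (V W : complex K) (F : chain_map V W) :=
  forall n : int,
  (forall v : V, homog n v -> cdiff v = 0 ->
     (exists2 w : W, homog (n - 1) w & F v = cdiff w) ->
     exists2 u : V, homog (n - 1) u & v = cdiff u) /\
  (forall w : W, homog n w -> cdiff w = 0 ->
     exists2 v : V, homog n v /\ cdiff v = 0 &
       exists2 u : W, homog (n - 1) u & w = F v + cdiff u).

Definition weak_equivalence (K : fieldType) (charK : [pchar K] =i pred0)
    (D C : lieCoalg K) (f : lieCoalgMor D C) : Prop :=
  quasi_isomorphism (cobar_map charK f).

Record dgLie (K : fieldType) := DgLie {
  lie_complex :> complex K;
  bracket : lie_complex -> lie_complex -> lie_complex;
  bracket_bilin : bilin bracket;
  bracket_homog : forall m n x y, homog m x -> homog n y -> homog (m + n) (bracket x y);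
  bracket_anti : forall m n x y, homog m x -> homog n y ->
    bracket x y = - (sgn K (m * n) *: bracket y x);
  bracket_jacobi : forall m n r x y z, homog m x -> homog n y -> homog r z ->
    bracket x (bracket y z) = bracket (bracket x y) z + sgn K (m * n) *: bracket y (bracket x z);
  bracket_diff : forall m n x y, homog m x -> homog n y ->
    cdiff (bracket x y) = bracket (cdiff x) y + sgn K m *: bracket x (cdiff y) }.

Record dgLieMor (K : fieldType) (g h : dgLie K) := DgLieMor {
  dlm_chain :> chain_map g h;
  dlm_bracket : forall x y, dlm_chain (bracket x y) = bracket (dlm_chain x) (dlm_chain y) }.

Section MaurerCartan.
Variable K : fieldType.

Definition is_MC (g : dgLie K) (x : g) : Prop :=
  homog 1 x /\ cdiff x + 2^-1 *: bracket x x = 0.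

Definition MC (g : dgLie K) : Type := {x : g | `[< is_MC x >]}.
HB.instance Definition _ (g : dgLie K) := Choice.on (MC g).

Lemma MC_map_subproof (g h : dgLie K) (phi : dgLieMor g h) (x : MC g) :
  `[< is_MC (phi (val x)) >].
Proof.
case: x => x /= /asboolP[hx mx]; have lp := chain_linear phi.
apply/asboolP; split; first exact: (chain_homog phi).
by rewrite -(chain_diff phi) -dlm_bracket -(linZ lp) -(linD lp) mx (lin0 lp).
Qed.

Definition MC_map (g h : dgLie K) (phi : dgLieMor g h) (x : MC g) : MC h :=
  exist (fun y : h => `[< is_MC y >]) (phi (val x)) (MC_map_subproof phi x).

Variables (g : dgLie K) (F : nat -> g -> Prop).

(* F is a filtration for which g is complete.  A path in g is represented by its
   Taylor coefficients X, x(t) = sum_k X k t^k.  The equation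
   x'(t) = d lam - [lam, x(t)] determines X from X 0; [series_to X s] says that
   the X k tend to 0 (so x(t) is polynomial modulo each F n, that is, x lies in
   the limit of the (g / F n)[t]) and that x(1) = s. *)
Definition series_to (X : nat -> g) (s : g) : Prop :=
  forall n, exists N, forall M, (N <= M)%N -> F n (\sum_(k < M) X k - s).

Definition gauge (x y : MC g) : Prop :=
  exists2 lam : g, homog 0 lam & exists X : nat -> g,
    [/\ X 0%N = val x,
        forall k, k.+1%:R *: X k.+1 =
          (if k is 0%N then cdiff lam else 0) - bracket lam (X k) &
        series_to X (val y)].

Definition gauge_equiv (x y : MC g) : bool :=
  `[< Relation_Operators.clos_refl_sym_trans (MC g) gauge x y >].

Lemma gauge_equiv_refl : reflexive gauge_equiv.
Proof. by move=> x; apply/asboolP; apply: Relation_Operators.rst_refl. Qed.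
Lemma gauge_equiv_sym : symmetric gauge_equiv.
Proof.
by move=> x y; apply/asboolP/asboolP; apply: Relation_Operators.rst_sym.
Qed.
Lemma gauge_equiv_trans : transitive gauge_equiv.
Proof.
move=> y x z /asboolP h1 /asboolP h2; apply/asboolP.
exact: Relation_Operators.rst_trans h1 h2.
Qed.
Canonical gauge_equiv_rel :=
  EquivRel gauge_equiv gauge_equiv_refl gauge_equiv_sym gauge_equiv_trans.

Definition moduli : Type := {eq_quot gauge_equiv}.
HB.instance Definition _ := Choice.on moduli.
HB.instance Definition _ := Quotient.on moduli.
HB.instance Definition _ : EqQuotient _ gauge_equiv moduli :=
  EqQuotient.on moduli.
End MaurerCartan.

Section GradedDual.
Variables (K : fieldType) (V : gradedMod K).

(* The dual in graded vector spaces, with degree n part (V^(-n))^*: linear forms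
   on the total space that vanish on all but finitely many of the V^n. *)
Definition gdual_pred : {pred (V -> K^o)} := fun x =>
  `[< linear x /\
      exists s : seq int, forall n v, n \notin s -> homog n v -> x v = 0 >].

Lemma gdual_closed : submod_closed gdual_pred.
Proof.
split.
  by apply/asboolP; split; [exact: lin_zero | exists [::]].
move=> a x y /asboolP[lx [s hs]] /asboolP[ly [r hr]]; apply/asboolP; split.
  exact: (lin_add (lin_scale a lx) ly).
exists (s ++ r) => n v; rewrite mem_cat negb_or => /andP[h1 h2] hv.
rewrite -[LHS]/(a *: x v + y v).
by rewrite (hs n v h1 hv) (hr n v h2 hv) scaler0 addr0.
Qed.
HB.instance Definition _ :=
  GRing.isSubmodClosed.Build K (V -> K^o) gdual_pred gdual_closed.

Record gdual := GDual { gdual_val :> V -> K^o; _ : gdual_val \in gdual_pred }.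
HB.instance Definition _ := [isSub for gdual_val].
HB.instance Definition _ := [Choice of gdual by <:].
HB.instance Definition _ := [SubChoice_isSubLmodule of gdual by <:].
End GradedDual.

Section DualComplex.
Variables (K : fieldType) (C : complex K).
Implicit Types x y : gdual C.

Lemma gdual_linear x : linear x.
Proof. by case: x => x /= /asboolP[]. Qed.
Lemma gdual_bound x : exists s : seq int,
  forall n v, n \notin s -> homog n v -> x v = 0.
Proof. by case: x => x /= /asboolP[]. Qed.
Lemma gdualP x y : (forall c, x c = y c) -> x = y.
Proof. by move=> h; apply: val_inj; apply/funext. Qed.
Lemma gdual_lin a x y c : (a *: x + y) c = a * x c + y c.
Proof. by []. Qed.
Lemma gdual_sum (I : Type) (r : seq I) (F : I -> gdual C) c :
  (\sum_(i <- r) F i) c = \sum_(i <- r) F i c.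
Proof.
elim: r => [|i r IH]; first by rewrite !big_nil.
by rewrite !big_cons -IH.
Qed.

Lemma gdual_in (x : C -> K^o) : linear x ->
  (exists s : seq int, forall n v, n \notin s -> homog n v -> x v = 0) ->
  x \in @gdual_pred K C.
Proof. by move=> lx hx; apply/asboolP. Qed.

Lemma dual_proj_subproof n x :
  (fun c : C => x (gproj (- n) c)) \in @gdual_pred K C.
Proof.
apply: gdual_in; first exact: (lin_comp (gdual_linear x) (gproj_linear _)).
exists [:: - n] => m v; rewrite inE => hm hv.
rewrite (homog_other hv); first exact: (lin0 (gdual_linear x)).
by rewrite eq_sym.
Qed.
Definition dual_proj n x : gdual C := GDual (dual_proj_subproof n x).

Lemma dual_proj_linear n : linear (dual_proj n).
Proof. by move=> a x y; apply: gdualP. Qed.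

Lemma dual_projK m n x :
  dual_proj m (dual_proj n x) = if m == n then dual_proj n x else 0.
Proof.
apply: gdualP => c /=; rewrite gprojK eqr_opp eq_sym.
case: eqP => [->|_] //=.
exact: (lin0 (gdual_linear x)).
Qed.

Lemma dual_proj_fin x : exists s : seq int,
  uniq s /\ x = \sum_(n <- s) dual_proj n x.
Proof.
have lx := gdual_linear x; have [s hs] := gdual_bound x.
exists (undup [seq - n | n <- s]); split; first exact: undup_uniq.
apply: gdualP => c; rewrite gdual_sum /=.
have lR : linear (fun c : C =>
    (\sum_(n <- undup [seq - n | n <- s]) x (gproj (- n) c) : K^o)).
  by apply: lin_bigsum => n; apply: (lin_comp lx (gproj_linear _)).
move: c; apply: (homog_ext lx lR) => m v hv.
have [hm|hm] := boolP (m \in s).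
  have hm' : - m \in undup [seq - n | n <- s].
    by rewrite mem_undup map_f.
  rewrite (bigD1_seq _ hm') ?undup_uniq //= opprK hv big1 ?addr0 // => n hn.
  rewrite (homog_other hv) ?(lin0 lx) //.
  by rewrite eqr_oppLR.
rewrite (hs _ _ hm hv) big1_seq // => n /= _.
have [<-|hn] := eqVneq m (- n); first by rewrite hv (hs _ _ hm hv).
by rewrite (homog_other hv) ?(lin0 lx) // eq_sym.
Qed.

Definition dual_gradedMod : gradedMod K :=
  @Gmod K (gdual C) _ dual_proj_linear dual_projK dual_proj_fin.

Lemma dual_homogP n x : @homog K dual_gradedMod n x <->
  (forall m c, m != - n -> homog m c -> x c = 0).
Proof.
have lx := gdual_linear x.
split=> [hx m c hm hc|h].
  rewrite -hx /= (homog_other hc) ?(lin0 lx) //.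
  by rewrite eq_sym.
apply: gdualP => c /=; move: c.
apply: (homog_ext (lin_comp lx (gproj_linear _)) lx) => m c hc.
have [hm|hm] := eqVneq m (- n); first by rewrite -hm hc.
by rewrite (homog_other hc) ?(h _ _ hm hc) ?(lin0 lx) // eq_sym.
Qed.

(* d x = - (-1)^|x| x o d, the differential of Hom(C, K): as x o d is supported
   in degree -|x| - 1, the sign is (-1)^|c| on homogeneous c. *)
Lemma dual_diff_subproof x :
  (fun c : C => x (cdiff (parity c))) \in @gdual_pred K C.
Proof.
have lx := gdual_linear x; have [s hs] := gdual_bound x.
apply: gdual_in.
  exact: (lin_comp lx (lin_comp (@cdiff_linear K C) (@parity_linear K C))).
exists [seq n - 1 | n <- s] => m c hm hc.
apply: (hs (m + 1)); last first.
  by apply: cdiff_homog; rewrite (parity_homog hc); apply: homogZ.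
apply: contra hm => hm; apply/mapP; exists (m + 1) => //; by rewrite addrK.
Qed.
Definition dual_diff x : gdual C := GDual (dual_diff_subproof x).

Lemma dual_diff_homog_val x m c : homog m c ->
  dual_diff x c = sgn K m * x (cdiff c).
Proof.
move=> hc; rewrite /= (parity_homog hc) (linZ (@cdiff_linear K C)).
exact: (linZ (gdual_linear x)).
Qed.

Lemma dual_diff_linear : linear dual_diff.
Proof. by move=> a x y; apply: gdualP. Qed.

Lemma dual_diff_homog n x : @homog K dual_gradedMod n x ->
  @homog K dual_gradedMod (n + 1) (dual_diff x).
Proof.
move=> /dual_homogP hx; apply/dual_homogP => m c hm hc.
rewrite (dual_diff_homog_val _ hc) (hx (m + 1)) ?mulr0 //.
  by apply: contra hm => /eqP h; rewrite opprD -h addrK.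
exact: cdiff_homog.
Qed.

Lemma dual_diffK x : dual_diff (dual_diff x) = 0.
Proof.
apply: gdualP => c; move: c.
apply: (homog_ext (gdual_linear _) (@lin_zero K C K^o)) => m c hc.
rewrite (dual_diff_homog_val _ hc) (dual_diff_homog_val _ (cdiff_homog hc)).
by rewrite cdiffK (lin0 (gdual_linear x)) !mulr0.
Qed.

Definition dual_complex : complex K :=
  @Cplx K dual_gradedMod _ dual_diff_linear dual_diff_homog dual_diffK.

(* (x (x) y)(a (x) b) = (-1)^(|y||a|) x(a) y(b), where |y| = - |b| whenever
   y(b) <> 0. *)
Definition dual_pair x y : tensor C C -> K^o :=
  tlift (fun a b => hsum (fun p a' =>
    hsum (fun q b' => (sgn K (p * q) * (x a' * y b') : K^o)) b) a).

Lemma scale_regE (k : K) (u : K^o) : k *: u = k * u. Proof. by []. Qed.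

Lemma dual_mul_lin1 x y b : linear (fun a => (x a * y b : K^o)).
Proof.
move=> k a a'; rewrite (gdual_linear x).
by rewrite !scale_regE mulrDl mulrA.
Qed.
Lemma dual_mul_lin2 x y a : linear (fun b => (x a * y b : K^o)).
Proof.
move=> k b b'; rewrite (gdual_linear y).
by rewrite !scale_regE mulrDr mulrCA.
Qed.

Lemma dual_pair_bilin x y : bilin (fun a b : C => hsum (fun p a' =>
    hsum (fun q b' => (sgn K (p * q) * (x a' * y b') : K^o)) b) a).
Proof.
split=> [b|a].
  apply: hsum_linear => p; apply: lin_bigsum => q.
  exact: (lin_scale (sgn K (p * q)) (@dual_mul_lin1 x y _)).
apply: lin_bigsum => p; apply: hsum_linear => q.
exact: (lin_scale (sgn K (p * q)) (@dual_mul_lin2 x y _)).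
Qed.

Lemma dual_pair_linear x y : linear (dual_pair x y).
Proof. exact: (tlift_linear (dual_pair_bilin x y)). Qed.

Lemma dual_pair_tens x y p q (a b : C) : homog p a -> homog q b ->
  dual_pair x y (tens a b) = sgn K (p * q) * (x a * y b).
Proof.
move=> ha hb; rewrite /dual_pair (tlift_tens _ _ (dual_pair_bilin x y)).
rewrite (hsum_homog _ ha) ?(hsum_homog _ hb) //.
  by move=> r; apply: (lin_scale (sgn K (p * r)) (@dual_mul_lin2 x y _)).
move=> r; apply: lin_bigsum => s.
exact: (lin_scale (sgn K (r * s)) (@dual_mul_lin1 x y _)).
Qed.

Definition dual_pair0 x y : tensor C C -> K^o :=
  tlift (fun a b => (x a * y b : K^o)).
Lemma dual_pair0_bilin x y : bilin (fun a b => (x a * y b : K^o)).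
Proof. by split=> ?; [exact: dual_mul_lin1 | exact: dual_mul_lin2]. Qed.
Lemma dual_pair0_linear x y : linear (dual_pair0 x y).
Proof. exact: (tlift_linear (dual_pair0_bilin x y)). Qed.
Lemma dual_pair0_tens x y a b : dual_pair0 x y (tens a b) = x a * y b.
Proof. exact: (tlift_tens _ _ (dual_pair0_bilin x y)). Qed.

Lemma dual_pairE m n x y t : @homog K dual_gradedMod m x -> @homog K dual_gradedMod n y ->
  dual_pair x y t = sgn K (m * n) * dual_pair0 x y t.
Proof.
move=> /dual_homogP hx /dual_homogP hy; move: t.
apply: (tens_homog_ext (dual_pair_linear x y)
  (lin_scale (sgn K (m * n)) (dual_pair0_linear x y))) => p q a b ha hb.
rewrite (dual_pair_tens _ _ ha hb) dual_pair0_tens scale_regE.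
have [Ep|h] := eqVneq p (- m); last by rewrite (hx _ _ h ha) !mul0r !mulr0.
have [Eq|h] := eqVneq q (- n); last by rewrite (hy _ _ h hb) !mulr0.
by rewrite Ep Eq mulrNN.
Qed.

Lemma dual_pair_zero (x y : gdual C) p (t : gtensor C C) :
  (forall q r a b, q + r = p -> homog q a -> homog r b -> x a * y b = 0) ->
  homog p t -> dual_pair x y t = 0.
Proof.
move=> h; apply: (gtensor_ext (dual_pair_linear x y) (@lin_zero K _ K^o)).
move=> q r a b hp ha hb; rewrite (dual_pair_tens _ _ ha hb).
by rewrite (h _ _ _ _ hp ha hb) mulr0.
Qed.
End DualComplex.

Section DualLie.
Variables (K : fieldType) (C : lieCoalg K).
Local Notation G := (dual_complex C).
Implicit Types x y z : G.

Lemma dual_bracket_subproof (x y : gdual C) :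
  (fun c : C => dual_pair x y (cobracket c)) \in @gdual_pred K C.
Proof.
apply: gdual_in; first exact: (lin_comp (dual_pair_linear x y) (@cobracket_linear K C)).
have [s hs] := gdual_bound x; have [r hr] := gdual_bound y.
exists [seq p + q | p <- s, q <- r] => n c hn hc.
apply: (dual_pair_zero _ (chain_homog cobracket hc)) => p q a b hpq ha hb.
have [hp|hp] := boolP (p \in s); last by rewrite (hs _ _ hp ha) mul0r.
have [hq|hq] := boolP (q \in r); last by rewrite (hr _ _ hq hb) mulr0.
by case/negP: hn; rewrite -hpq; apply: allpairs_f.
Qed.
Definition dual_bracket x y : G := GDual (dual_bracket_subproof x y).

Lemma dual_bracket_bilin : bilin dual_bracket.
Proof.
split=> [y k x x'|x k y y']; apply: gdualP => c.
- rewrite -[RHS]/(k * dual_pair x y (cobracket c) + dual_pair x' y (cobracket c)) /=.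
  move: (cobracket c : tensor C C); apply: (tens_homog_ext
    (dual_pair_linear _ y) (lin_add (lin_scale k (dual_pair_linear x y))
    (dual_pair_linear x' y))) => p q a b ha hb.
  rewrite !(dual_pair_tens _ _ ha hb) gdual_lin scale_regE.
  by rewrite mulrDl mulrDr !mulrA [k * _]mulrC.
- rewrite -[RHS]/(k * dual_pair x y (cobracket c) + dual_pair x y' (cobracket c)) /=.
  move: (cobracket c : tensor C C); apply: (tens_homog_ext
    (dual_pair_linear x _) (lin_add (lin_scale k (dual_pair_linear x y))
    (dual_pair_linear x y'))) => p q a b ha hb.
  rewrite !(dual_pair_tens _ _ ha hb) gdual_lin scale_regE.
  by rewrite mulrDr mulrDr [x a * (k * _)]mulrCA [sgn _ _ * (k * _)]mulrCA.
Qed.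

Lemma dual_bracket_homog m n x y :
  homog m x -> homog n y -> homog (m + n) (dual_bracket x y).
Proof.
move=> /dual_homogP hx /dual_homogP hy; apply/dual_homogP => k c hk hc.
apply: (dual_pair_zero _ (chain_homog cobracket hc)) => p q a b hpq ha hb.
have [Ep|h] := eqVneq p (- m); last by rewrite (hx _ _ h ha) mul0r.
have [Eq|h] := eqVneq q (- n); last by rewrite (hy _ _ h hb) mulr0.
by case/negP: hk; rewrite -hpq Ep Eq -opprD.
Qed.

Lemma dual_bracketE m n x y c : homog m x -> homog n y ->
  dual_bracket x y c = sgn K (m * n) * dual_pair0 x y (cobracket c).
Proof. exact: dual_pairE. Qed.

Lemma dual_pair0_swap m n x y t : homog m x -> homog n y ->
  dual_pair0 x y (tswap t) = sgn K (m * n) * dual_pair0 y x t.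
Proof.
move=> /dual_homogP hx /dual_homogP hy; move: t.
apply: (tens_homog_ext (lin_comp (dual_pair0_linear x y) (@tswap_linear K C C))
  (lin_scale (sgn K (m * n)) (dual_pair0_linear y x))) => p q a b ha hb.
rewrite (tswap_tens ha hb) (linZ (dual_pair0_linear x y)) !dual_pair0_tens.
rewrite !scale_regE [x b * _]mulrC.
have [Ep|h] := eqVneq p (- n); last by rewrite (hy _ _ h ha) !mul0r !mulr0.
have [Eq|h] := eqVneq q (- m); last by rewrite (hx _ _ h hb) !mulr0.
by rewrite Ep Eq mulrNN [n * m]mulrC.
Qed.

Lemma dual_bracket_anti m n x y : homog m x -> homog n y ->
  dual_bracket x y = - (sgn K (m * n) *: dual_bracket y x).
Proof.
move=> hx hy; apply: gdualP => c.
rewrite -[RHS]/(- (sgn K (m * n) * dual_bracket y x c)).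
rewrite (dual_bracketE _ hx hy) (dual_bracketE _ hy hx).
have -> : dual_pair0 x y (cobracket c) =
    - (sgn K (m * n) * dual_pair0 y x (cobracket c)).
  rewrite -(dual_pair0_swap _ hx hy) cobracket_anti (linN (dual_pair0_linear x y)).
  by rewrite opprK.
by rewrite mulrN [n * m]mulrC.
Qed.

Definition dual_pair3 x y z : tensor (tensor C C) C -> K^o :=
  tlift (fun t c => (dual_pair0 x y t * z c : K^o)).
Lemma dual_pair3_bilin x y z :
  bilin (fun t c => (dual_pair0 x y t * z c : K^o)).
Proof.
split=> [c k t t'|t k c c'].
  by rewrite (dual_pair0_linear x y) !scale_regE mulrDl mulrA.
by rewrite (gdual_linear z) !scale_regE mulrDr mulrCA.
Qed.
Lemma dual_pair3_linear x y z : linear (dual_pair3 x y z).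
Proof. exact: (tlift_linear (dual_pair3_bilin x y z)). Qed.
Lemma dual_pair3_tens x y z a b c :
  dual_pair3 x y z (tens (tens a b) c) = x a * y b * z c.
Proof.
rewrite /dual_pair3 (tlift_tens _ _ (dual_pair3_bilin x y z)).
by rewrite dual_pair0_tens.
Qed.

Lemma dual_pair3_cyc m n r x y z t : homog m x -> homog n y -> homog r z ->
  dual_pair3 x y z (cyc3 t) = sgn K (r * (m + n)) * dual_pair3 z x y t.
Proof.
move=> /dual_homogP hx /dual_homogP hy /dual_homogP hz; move: t.
apply: (tens3_homog_ext (lin_comp (dual_pair3_linear x y z) (@cyc3_linear K C))
  (lin_scale _ (dual_pair3_linear z x y))) => p q s a b c ha hb hc.
rewrite /cyc3 tassoc_tens (@tswap_tens K C (gtensor C C) p (q + s)) //;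
  last exact: homog_tens.
rewrite (linZ (dual_pair3_linear x y z)) !dual_pair3_tens !scale_regE.
rewrite [_ * z a]mulrC -!mulrA.
have [Ep|h] := eqVneq p (- r); last by rewrite (hz _ _ h ha) !mul0r !mulr0.
have [Eq|h] := eqVneq q (- m); last by rewrite (hx _ _ h hb) !mul0r !mulr0.
have [Es|h] := eqVneq s (- n); last by rewrite (hy _ _ h hc) !mulr0.
by rewrite Ep Eq Es -opprD mulrNN.
Qed.

Lemma dual_bracket3E m n r x y z c : homog m x -> homog n y -> homog r z ->
  dual_bracket (dual_bracket x y) z c =
  sgn K ((m + n) * r + m * n) * dual_pair3 x y z (tmap cobracket id (cobracket c)).
Proof.
move=> hx hy hz; rewrite (dual_bracketE _ (dual_bracket_homog hx hy) hz).
have -> : sgn K ((m + n) * r + m * n) = sgn K ((m + n) * r) * sgn K (m * n).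
  by rewrite !sgnE !parD signr_addb.
rewrite -mulrA; congr (_ * _); move: (cobracket c : tensor C C).
have lT := tmap_linear (@cobracket_linear K C) (@lin_id K C).
apply: (tens_homog_ext (dual_pair0_linear _ _) (lin_scale (sgn K (m * n))
  (lin_comp (dual_pair3_linear x y z) lT))) => p q a b ha hb.
rewrite (tmap_tens (@cobracket_linear K C) (@lin_id K C)) dual_pair0_tens.
rewrite (dual_bracketE _ hx hy) /dual_pair3.
by rewrite (tlift_tens _ _ (dual_pair3_bilin x y z)) -mulrA.
Qed.

Lemma dual_bracket_jacobi m n r x y z : homog m x -> homog n y -> homog r z ->
  dual_bracket x (dual_bracket y z) =
  dual_bracket (dual_bracket x y) z + sgn K (m * n) *: dual_bracket y (dual_bracket x z).
Proof.
move=> hx hy hz; apply: gdualP => c.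
have hyz := dual_bracket_homog hy hz; have hzx := dual_bracket_homog hz hx.
have [b1 b2] := dual_bracket_bilin.
rewrite (dual_bracket_anti hx hyz) (dual_bracket_anti hx hz).
rewrite !(linN (b2 y), linZ (b2 y)).
rewrite (dual_bracket_anti hy hzx).
rewrite -[LHS]/(- (sgn K (m * (n + r)) * dual_bracket (dual_bracket y z) x c)).
rewrite -[RHS]/(dual_bracket (dual_bracket x y) z c + sgn K (m * n) *
  - (sgn K (m * r) * - (sgn K (n * (r + m)) * dual_bracket (dual_bracket z x) y c))).
rewrite (dual_bracket3E _ hy hz hx) (dual_bracket3E _ hx hy hz) (dual_bracket3E _ hz hx hy).
have := congr1 (dual_pair3 x y z) (cobracket_jacobi c).
rewrite /tens3_sum_cyc (lin0 (dual_pair3_linear x y z)).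
rewrite !(linD (dual_pair3_linear x y z)).
rewrite !(dual_pair3_cyc _ hx hy hz) (dual_pair3_cyc _ hz hx hy).
move: (dual_pair3 x y z _) (dual_pair3 z x y _) (dual_pair3 y z x _).
rewrite !sgnE !(parM, parD) => X Y Z E.
have -> : X = - ((-1) ^+ (par r && (par m (+) par n)) * Y +
    (-1) ^+ (par r && (par m (+) par n)) *
    ((-1) ^+ (par n && (par r (+) par m)) * Z)).
  by apply/eqP; rewrite -addr_eq0 addrA; apply/eqP.
case: (par m) {E}; case: (par n); case: (par r) => /=;
  rewrite !(expr0, expr1, mul1r, mulN1r, opprK, opprD) ?(addrK, addrNK) //;
  by rewrite addrAC ?subrr ?addNr add0r.
Qed.

Lemma dual_bracket_diff m n x y : homog m x -> homog n y ->
  dual_diff (dual_bracket x y) =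
  dual_bracket (dual_diff x) y + sgn K m *: dual_bracket x (dual_diff y).
Proof.
move=> hx hy; apply: gdualP => c.
move: c; apply: (homog_ext (gdual_linear _) (gdual_linear _)) => k c hc.
have hdx := dual_diff_homog hx; have hdy := dual_diff_homog hy.
rewrite (dual_diff_homog_val _ hc) (dual_bracketE _ hx hy) (chain_diff cobracket).
rewrite -[RHS]/(dual_bracket (dual_diff x) y c + sgn K m * dual_bracket x (dual_diff y) c).
rewrite (dual_bracketE _ hdx hy) (dual_bracketE _ hx hdy).
suff key : forall t : gtensor C C, homog k t ->
    sgn K k * (sgn K (m * n) * dual_pair0 x y (tens_diff t)) =
    sgn K ((m + 1) * n) * dual_pair0 (dual_diff x) y t +
    sgn K m * (sgn K (m * (n + 1)) * dual_pair0 x (dual_diff y) t).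
  exact: key (chain_homog cobracket hc).
have l1 := lin_scale (sgn K k) (lin_scale (sgn K (m * n))
  (lin_comp (dual_pair0_linear x y) (@tens_diff_linear K C C))).
have l2 := lin_add
  (lin_scale (sgn K ((m + 1) * n)) (dual_pair0_linear (dual_diff x) y))
  (lin_scale (sgn K m) (lin_scale (sgn K (m * (n + 1)))
    (dual_pair0_linear x (dual_diff y)))).
apply: (gtensor_ext l1 l2).
move=> p q a b <- ha hb.
rewrite (tens_diff_tens _ ha) (linD (dual_pair0_linear x y)).
rewrite (linZ (dual_pair0_linear x y)) !dual_pair0_tens !scale_regE.
rewrite (dual_diff_homog_val _ ha) (dual_diff_homog_val _ hb).
move: hx hy => /dual_homogP hx /dual_homogP hy.
rewrite !mulrDr; congr (_ + _).
  have [Ep|h] := eqVneq (p + 1) (- m); last first.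
    by rewrite (hx _ _ h (cdiff_homog ha)) ?(mul0r, mulr0).
  have [Eq|h] := eqVneq q (- n); last by rewrite (hy _ _ h hb) !mulr0.
  have -> : p = - m - 1 by rewrite -Ep addrK.
  rewrite Eq !mulrA; congr (_ * _ * _).
  rewrite !sgnE !(parM, parD, parN) -?signr_addb; congr (_ ^+ _).
  by case: (par m); case: (par n).
have [Ep|h] := eqVneq p (- m); last by rewrite (hx _ _ h ha) ?(mul0r, mulr0).
have [Eq|h] := eqVneq (q + 1) (- n); last first.
  by rewrite (hy _ _ h (cdiff_homog hb)) ?(mul0r, mulr0).
have -> : q = - n - 1 by rewrite -Eq addrK.
rewrite Ep [x a * (_ * _)]mulrCA !mulrA; congr (_ * _ * _).
rewrite !sgnE !(parM, parD, parN) -?signr_addb; congr (_ ^+ _).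
by case: (par m); case: (par n).
Qed.

Definition dual : dgLie K := DgLie dual_bracket_bilin dual_bracket_homog dual_bracket_anti
  dual_bracket_jacobi dual_bracket_diff.

(* F_n (C^dual) is the annihilator of the n-th coradical piece F_n C.  The
   pronilpotent dg Lie algebras are the [dual C] with this filtration. *)
Definition dual_filt (n : nat) (x : dual) : Prop :=
  forall c, coradical cobracket n c -> (x : gdual C) c = 0.
End DualLie.

Section DualMap.
Variables (K : fieldType) (D C : lieCoalg K) (f : lieCoalgMor D C).

Lemma dual_fun_subproof (x : gdual C) :
  (fun d : D => x (f d)) \in @gdual_pred K D.
Proof.
apply: gdual_in; first exact: (lin_comp (gdual_linear x) (chain_linear f)).
have [s hs] := gdual_bound x; exists s => n v hn hv.
exact: hs hn (chain_homog f hv).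
Qed.
Definition dual_fun (x : dual C) : dual D := GDual (dual_fun_subproof x).

Lemma dual_fun_linear : linear dual_fun.
Proof. by move=> a x y; apply: gdualP. Qed.
Lemma dual_fun_homog n (x : dual C) : homog n x -> homog n (dual_fun x).
Proof.
move=> /dual_homogP hx; apply/dual_homogP => m c hm hc /=.
exact: hx hm (chain_homog f hc).
Qed.
Lemma dual_fun_diff (x : dual C) : dual_fun (cdiff x) = cdiff (dual_fun x).
Proof.
apply: gdualP => c /=; congr (x _); rewrite (chain_diff f); congr (cdiff _).
move: c; apply: (homog_ext (lin_comp (@parity_linear K C) (chain_linear f))
  (lin_comp (chain_linear f) (@parity_linear K D))) => n c hc.
rewrite (parity_homog hc) (parity_homog (chain_homog f hc)).
by rewrite (linZ (chain_linear f)).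
Qed.
Lemma dual_fun_bracket (x y : dual C) :
  dual_fun (bracket x y) = bracket (dual_fun x) (dual_fun y).
Proof.
have lf := chain_linear f.
apply: gdualP => c /=; rewrite (lcm_cobracket f); move: (cobracket c : tensor D D).
apply: (tens_homog_ext (lin_comp (dual_pair_linear x y) (tmap_linear lf lf))
  (dual_pair_linear (dual_fun x) (dual_fun y))) => p q a b ha hb.
rewrite (tmap_tens lf lf) (dual_pair_tens _ _ ha hb).
by rewrite (dual_pair_tens _ _ (chain_homog f ha) (chain_homog f hb)).
Qed.

Definition dual_map : dgLieMor (dual C) (dual D) :=
  @DgLieMor K (dual C) (dual D)
    (ChainMap dual_fun_linear dual_fun_homog dual_fun_diff) dual_fun_bracket.
End DualMap.

Arguments dual {K} C.
Arguments dual_filt {K} C n x.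
Arguments moduli {K g} F.

(* Main.v *)
Require Import Defs.
From mathcomp Require Import all_boot all_algebra.
From mathcomp Require Import boolp ring.
From mathcomp Require classical_sets.
Set Implicit Arguments.
Unset Strict Implicit.
Unset Printing Implicit Defensive.
Import GRing.Theory.
Local Open Scope ring_scope.
Local Open Scope quotient_scope.

(* Write Om C for the cobar construction.  A Maurer-Cartan element of C^dual is an
   algebra map Om C -> K, more generally a map C -> X to a cdga satisfying the
   Maurer-Cartan equation ("twisting") is an algebra map Om C -> X, and a gauge
   equivalence by lam is the same as a twisting C -> K[t,dt] whose dt part is the
   constant lam.

   Given a quasi-isomorphism of cdgas A -> B and a twisting psi : C -> B, psi
   lifts to A up to a homotopy C -> B[t,dt] whose dt part is constant in t: by
   conilpotence a lift is the fixed point of a contraction of the kernel of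
   A x_B B[t,dt] -> B, and Dupont's contraction of K[t,dt] onto the Whitney forms
   keeps the dt part constant.  For K -> K[t,dt] this says that arbitrary
   homotopies C -> K[t,dt] connect gauge equivalent elements.  For Om f it gives
   a homotopy right inverse G of Om f, again a quasi-isomorphism, which in turn
   has a homotopy right inverse; so pulling back along Om f and along G are
   mutually inverse on moduli. *)

(** * Contractions of acyclic complexes *)

(** Two obstacles shape the argument. A weak equivalence gives a quasi-isomorphism of cobar
    constructions only; it need not induce quasi-isomorphisms on the graded pieces of the coradical
    filtrations, so the two moduli spaces cannot be compared by induction along them. Conilpotence
    of the source serves instead to make fixed point iterations stabilize on each element. The price
    is that the inverse G is an algebra map Om C -> Om D which in general comes from no coalgebra
    map: pulling back along it is nonlinear and turns a path with constant dt part into one whose dt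
    part varies with t. As a gauge transformation is given by one constant lam, such a path would
    usually call for a time-ordered exponential and the Baker-Campbell-Hausdorff formula.
    Rectification replaces both: the Whitney forms 1 - t, t, dt have constant dt part, Dupont's
    homotopy has none, and so every path it produces is a gauge transformation as it stands.
    Characteristic 0 enters through antiderivatives and through the divisions by 2 and 3. *)

Section LinearProjection.
Variables (K : fieldType) (V : lmodType K) (Z : V -> Prop).
Hypotheses (Z0 : Z 0) (Z_lin : forall a x y, Z x -> Z y -> Z (a *: x + y)).

(** Membership of 0 is left out because Zorn's lemma also requires the union of the empty chain to
    qualify; maximality gives it back. *)
Let isdisj (M : V -> Prop) :=
  (forall a x y, M x -> M y -> M (a *: x + y)) /\ (forall x, M x -> Z x -> x = 0).

Lemma subspace_scale (M : V -> Prop) :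
  M 0 -> (forall a x y, M x -> M y -> M (a *: x + y)) ->
  forall a x, M x -> M (a *: x).
Proof. by move=> M0 ML a x Mx; rewrite -[_ *: _]addr0; apply: ML. Qed.

Lemma linear_complement : exists M : V -> Prop,
  [/\ M 0, isdisj M & forall v, exists2 m, M m & Z (v - m)].
Proof.
have [F FP Ftot|M [[ML MZ] Mmax]] := @classical_sets.Zorn_bigcup V isdisj.
  split=> [a x y [A FA Ax] [B FB By]|x [A FA Ax]]; last first.
    by have [_ h] := FP _ FA; apply: h.
  have [AB|BA] := Ftot _ _ FA FB.
    by exists B => //; have [h _] := FP _ FB; apply: h => //; apply: AB.
  by exists A => //; have [h _] := FP _ FA; apply: h => //; apply: BA.
have M0 : M 0.
  apply: contrapT => nM0.
  apply: (Mmax (fun v => v = 0 \/ M v)).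
    split; first by move=> v Mv; right.
    by move=> h; apply: nM0; apply: h; left.
  split=> [a x y [->|Mx] [->|My]|x [->|Mx]] //.
  - by left; rewrite scaler0 addr0.
  - by right; rewrite scaler0 add0r.
  - case: nM0; have := ML (-1) x x Mx Mx; by rewrite scaleN1r addNr.
  - by right; apply: ML.
  - exact: MZ.
exists M; split=> // v; apply: contrapT => nv.
(* Adjoining v keeps the intersection with [Z] trivial: a vector m + k v of [Z] with k nonzero would
   put v - (- k^-1 m) in [Z]. *)
pose M' u := exists k m, M m /\ u = m + k *: v.
have nMv : ~ M v.
  by move=> Mv; apply: nv; exists v; rewrite ?subrr.
apply: (Mmax M').
  split; first by move=> m Mm; exists 0, m; rewrite scale0r addr0.
  by move=> h; apply: nMv; apply: h; exists 1, 0; rewrite scale1r add0r.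
split=> [a x y [k [m [Mm ->]]] [l [n [Mn ->]]]|x [k [m [Mm ->]]] Zx].
  exists (a * k + l), (a *: m + n); split; first exact: ML.
  by rewrite scalerDr scalerDl scalerA addrACA.
have [k0|k0] := eqVneq k 0.
  by move: Zx; rewrite k0 scale0r addr0; apply: MZ.
case: nv; exists (- k^-1 *: m); first exact: subspace_scale.
have -> : v - - k^-1 *: m = k^-1 *: (m + k *: v).
  by rewrite scalerDr scalerA mulVf // scale1r scaleNr opprK addrC.
exact: subspace_scale.
Qed.

Lemma linear_projection : exists p : V -> V,
  [/\ linear p, forall v, Z (p v) & forall z, Z z -> p z = z].
Proof.
have [M [M0 [ML MZ] MV]] := linear_complement.
have ZB x y : Z x -> Z y -> Z (x - y).
  by move=> Zx Zy; rewrite addrC -scaleN1r; apply: Z_lin.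
have MB x y : M x -> M y -> M (x - y).
  by move=> Zx Zy; rewrite addrC -scaleN1r; apply: ML.
have uniq m n v : M m -> M n -> Z (v - m) -> Z (v - n) -> m = n.
  move=> Mm Mn Zm Zn; apply/eqP; rewrite -subr_eq0; apply/eqP; apply: MZ.
    exact: MB.
  have -> : m - n = (v - n) - (v - m).
    by rewrite opprB [RHS]addrC addrA subrK.
  exact: ZB.
pose q v := s2val (cid2 (MV v)).
have qM v : M (q v) by rewrite /q; case: cid2.
have qZ v : Z (v - q v) by rewrite /q; case: cid2.
exists (fun v => v - q v); split=> [a x y|//|z Zz].
  have -> : q (a *: x + y) = a *: q x + q y.
    apply: (uniq _ _ (a *: x + y)) => //; first exact: ML.
    by rewrite opprD addrACA -scalerBr; apply: Z_lin.
  by rewrite opprD addrACA -scalerBr.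
have -> : q z = 0 by apply: (uniq _ _ z) => //; rewrite subr0.
by rewrite subr0.
Qed.
End LinearProjection.

Section Contraction.
Variables (K : fieldType) (V : complex K).

Definition acyclic := forall n (v : V), homog n v -> cdiff v = 0 ->
  exists2 u : V, homog (n - 1) u & v = cdiff u.

Lemma gproj_diff n (v : V) : gproj (n + 1) (cdiff v) = cdiff (gproj n v).
Proof.
have lg k := @gproj_linear K V k; have ld := @cdiff_linear K V.
move: v; apply: (homog_ext (lin_comp (lg _) ld) (lin_comp ld (lg _))) => m v hv.
have [->|h] := eqVneq n m; first by rewrite (cdiff_homog hv) hv.
rewrite (homog_other hv) // (homog_other (cdiff_homog hv)) ?lin0 //.
by rewrite (can_eq (addrK 1)).
Qed.

(** A degree-preserving projection p onto the cocycles splits V, and by acyclicity d maps the kernel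
    of p isomorphically onto the cocycles. The contraction is p followed by the inverse of this
    isomorphism. *)
Lemma acyclic_contraction : acyclic -> exists h : V -> V,
  [/\ linear h, forall n v, homog n v -> homog (n - 1) (h v) &
      forall v, cdiff (h v) + h (cdiff v) = v].
Proof.
move=> ac; have ld := @cdiff_linear K V.
have [||p0 [lp0 p0Z p0K]] := @linear_projection K V (fun v => cdiff v = 0).
- exact: lin0.
- by move=> a x y hx hy; rewrite ld hx hy scaler0 addr0.
(* [p0] need not preserve degrees; [p] is its part of degree 0. *)
pose p := hsum (fun n v => gproj n (p0 v)).
have lpn n : linear (fun v : V => gproj n (p0 v)).
  exact: (lin_comp (@gproj_linear K V n) lp0).
have lp : linear p by apply: hsum_linear => n.
have ph n v : homog n v -> p v = gproj n (p0 v).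
  by move=> hv; rewrite /p (hsum_homog _ hv).
have pZ v : cdiff (p v) = 0.
  move: v; apply: (homog_ext (lin_comp ld lp) (@lin_zero K V V)) => n v hv.
  by rewrite (ph n v hv) -gproj_diff p0Z (lin0 (@gproj_linear K V _)).
have pK z : cdiff z = 0 -> p z = z.
  move=> hz; rewrite /p /hsum [RHS](gsuppE z); apply: eq_bigr => n _.
  rewrite p0K; first exact: homog_gproj.
  by rewrite -gproj_diff hz (lin0 (@gproj_linear K V _)).
have ex v : exists u : V, cdiff u = p v.
  have [s [us es]] := gproj_fin v.
  have P n : exists u : V, cdiff u = p (gproj n v).
    have [|u hu eu] := ac n (p (gproj n v)) _ (pZ _); last by exists u.
    by rewrite (ph n); exact: homog_gproj.
  rewrite es; elim: s {us es} => [|n s [u hu]].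
    by exists 0; rewrite big_nil !lin0.
  have [w hw] := P n; exists (w + u); rewrite big_cons (linD ld) (linD lp).
  by rewrite hu hw.
pose u v := projT1 (cid (ex v)); have uE v : cdiff (u v) = p v.
  by rewrite /u; case: cid.
(* The preimages [u] are chosen with no control of linearity or degree. They are determined modulo
   cocycles, and x - p x depends on nothing else. *)
have wd x y : cdiff x = cdiff y -> x - p x = y - p y.
  move=> exy; have : p (x - y) = x - y.
    by apply: pK; rewrite (linD ld) (linN ld) exy subrr.
  rewrite (linD lp) (linN lp) => e.
  by apply/eqP; rewrite -subr_eq0 opprD addrACA -opprD e subrr.
have lh : linear (fun v => u v - p (u v)).
  move=> a x y.
  rewrite -[RHS](_ : (a *: u x + u y) - p (a *: u x + u y) = _); last first.
    by rewrite lp opprD scalerBr addrACA.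
  by apply: wd; rewrite ld !uE lp.
exists (fun v => u v - p (u v)); split=> [//|n v hv|v].
  have hpv : homog n (p v) by rewrite (ph n) //; apply: homog_gproj.
  have [w hw ew] := ac n (p v) hpv (pZ v).
  rewrite (wd (u v) w) ?uE // (ph (n - 1) w) //.
  apply: homogD => //; apply: homogN; exact: homog_gproj.
rewrite (linD ld) (linN ld) pZ subr0 uE (wd (u (cdiff v)) v).
  by rewrite addrC subrK.
by rewrite uE pK // cdiffK.
Qed.
End Contraction.

(** * Conilpotence *)

Section Deep.
Variables (K : fieldType) (C : lieCoalg K).

(* The maps that factor through iterated cobrackets with more than k leaves:
   they vanish on F_k C and, unlike the maps vanishing on F_k C, are visibly
   stable under the operations of [deep_left] and [deep_right]. *)
Inductive deep (X : lmodType K) (k : nat) : (C -> X) -> Prop :=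
| deep_tree T (Th : tpow C T -> X) : linear Th -> (k < leaves T)%N ->
    deep k (fun c => Th (cobracket_tree cobracket T c))
| deep0 : deep k (fun _ => 0)
| deepD (u v : C -> X) : deep k u -> deep k v -> deep k (fun c => u c + v c)
| deep_eq (u v : C -> X) : u =1 v -> deep k u -> deep k v.

Lemma cobracket_tree_linear T :
  linear (cobracket_tree (C := C) cobracket T : C -> tpow C T).
Proof.
elim: T => [|l IHl r IHr] /=; first exact: lin_id.
exact: (lin_comp (tmap_linear IHl IHr) (@cobracket_linear K C)).
Qed.

Lemma deep_vanish (X : lmodType K) k (u : C -> X) :
  deep k u -> forall c, coradical cobracket k c -> u c = 0.
Proof.
elim=> [T Th lTh kT|//|{}u v _ IHu _ IHv|{}u v e _ IH] c hc.
- by rewrite hc // lin0.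
- by rewrite IHu // IHv // addr0.
- by rewrite -e IH.
Qed.

Lemma linear_deep0 (X : lmodType K) (u : C -> X) : linear u -> deep 0 u.
Proof. by move=> lu; apply: (@deep_tree X 0%N Leaf u). Qed.

Lemma deep_comp (X Y : lmodType K) k (g : X -> Y) (u : C -> X) :
  linear g -> deep k u -> deep k (fun c => g (u c)).
Proof.
move=> lg; elim=> [T Th lTh kT||{}u v _ IHu _ IHv|{}u v e _ IH].
- exact: (deep_tree (lin_comp lg lTh) kT).
- by apply: (deep_eq _ (deep0 _ _)) => c; rewrite lin0.
- by apply: (deep_eq _ (deepD IHu IHv)) => c; rewrite linD.
- by apply: (deep_eq _ IH) => c; rewrite e.
Qed.

Lemma deep_linear (X : lmodType K) k (u : C -> X) : deep k u -> linear u.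
Proof.
elim=> [T Th lTh _||{}u v _ lu _ lv|{}u v e _ lu].
- exact: (lin_comp lTh (cobracket_tree_linear T)).
- exact: lin_zero.
- exact: (lin_add lu lv).
- by move=> a x y; rewrite -!e lu.
Qed.

Lemma bilin_comp (V W V' W' Y : lmodType K) (b : V' -> W' -> Y)
    (u : V -> V') (v : W -> W') :
  bilin b -> linear u -> linear v -> bilin (fun x y => b (u x) (v y)).
Proof.
move=> [b1 b2] lu lv.
by split=> [y|x]; [exact: (lin_comp (b1 _) lu) | exact: (lin_comp (b2 _) lv)].
Qed.

(** Joining at a root a tree with more than k leaves and one with more than l leaves gives at least
    k + l + 2 leaves. Already for l = 0 a cobracket gains one level, which is how the inductions on
    depth advance. *)
Lemma deep_mul (X X' Y : lmodType K) (b : X -> X' -> Y) k l (u : C -> X)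
    (v : C -> X') : bilin b -> deep k u -> deep l v ->
  deep (k + l).+1
    (fun c => tlift (fun x y => b (u x) (v y)) (cobracket c : tensor C C)).
Proof.
move=> bb; have [b1 b2] := bb; have bc := bilin_comp bb.
move=> hu hv; have := hv; have := deep_linear hv.
elim: hu => [T Th lTh kT||{}u w hu IHu hw IHw|{}u w e hu IH] lv dv.
- have lT := cobracket_tree_linear T; have lu := lin_comp lTh lT.
  elim: dv lv => [T' Th' lTh' kT'||v1 v2 h1 IH1 h2 IH2|v1 v2 e h1 IH1] lv.
  + have lT' := cobracket_tree_linear T'; have lu' := lin_comp lTh' lT'.
    have kTT : ((k + l).+1 < leaves (Node T T'))%N.
      by rewrite /= -addnS -addSn leq_add.
    apply: (deep_eq _ (@deep_tree Y _ (Node T T') _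
      (tlift_linear (bc _ _ _ _ lTh lTh')) kTT)).
    move=> c /=; move: (cobracket c : tensor C C); apply: tens_ext.
    * exact: (lin_comp (tlift_linear (bc _ _ _ _ lTh lTh')) (tmap_linear lT lT')).
    * exact: (tlift_linear (bc _ _ _ _ lu lu')).
    move=> x y; rewrite (tmap_tens lT lT').
    by rewrite (tlift_tens _ _ (bc _ _ _ _ lTh lTh')) (tlift_tens _ _ (bc _ _ _ _ lu lu')).
  + apply: (deep_eq _ (deep0 _ _)) => c; move: (cobracket c : tensor C C).
    have l0 := bc _ _ _ _ lu (@lin_zero K C X').
    apply: tens_ext; [exact: lin_zero | exact: (tlift_linear l0)|].
    by move=> x y; rewrite (tlift_tens _ _ l0) (lin0 (b2 _)).
  + have [l1 l2] := (deep_linear h1, deep_linear h2).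
    apply: (deep_eq _ (deepD (IH1 l1) (IH2 l2))) => c.
    have [c1 c2 c12] := And3 (bc _ _ _ _ lu l1) (bc _ _ _ _ lu l2) (bc _ _ _ _ lu lv).
    move: (cobracket c : tensor C C); apply: tens_ext.
    * exact: (lin_add (tlift_linear c1) (tlift_linear c2)).
    * exact: (tlift_linear c12).
    move=> x y; rewrite (tlift_tens _ _ c1) (tlift_tens _ _ c2) (tlift_tens _ _ c12).
    by rewrite (linD (b2 _)).
  + by have -> : v2 = v1; [apply/funext => x | exact: IH1 (deep_linear h1)].
- apply: (deep_eq _ (deep0 _ _)) => c; move: (cobracket c : tensor C C).
  have l0 := bc _ _ _ _ (@lin_zero K C X) lv.
  apply: tens_ext; [exact: lin_zero | exact: (tlift_linear l0)|].
  by move=> x y; rewrite (tlift_tens _ _ l0) (lin0 (b1 _)).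
- have [l1 l2] := (deep_linear hu, deep_linear hw).
  apply: (deep_eq _ (deepD (IHu lv dv) (IHw lv dv))) => c.
  have [c1 c2 c12] := And3 (bc _ _ _ _ l1 lv) (bc _ _ _ _ l2 lv)
    (bc _ _ _ _ (lin_add l1 l2) lv).
  move: (cobracket c : tensor C C); apply: tens_ext.
  + exact: (lin_add (tlift_linear c1) (tlift_linear c2)).
  + exact: (tlift_linear c12).
  move=> x y; rewrite (tlift_tens _ _ c1) (tlift_tens _ _ c2) (tlift_tens _ _ c12).
  by rewrite (linD (b1 _)).
- by have -> : w = u; [apply/funext => x | exact: IH].
Qed.
End Deep.

(** * Commutative dg algebras and twisting maps *)

Record cdga (K : fieldType) := Cdga {
  cdga_complex :> complex K;
  cmul : cdga_complex -> cdga_complex -> cdga_complex;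
  cmul_bilin : bilin cmul;
  cmul_homog : forall m n x y, homog m x -> homog n y -> homog (m + n) (cmul x y);
  cmulA : forall x y z, cmul x (cmul y z) = cmul (cmul x y) z;
  cmulC : forall m n x y, homog m x -> homog n y ->
    cmul x y = sgn K (m * n) *: cmul y x;
  cmul_diff : forall m x y, homog m x ->
    cdiff (cmul x y) = cmul (cdiff x) y + sgn K m *: cmul x (cdiff y) }.

Record cdgaMor (K : fieldType) (X Y : cdga K) := CdgaMor {
  cdgaMor_chain :> chain_map X Y;
  cdgaMor_mul : forall x y, cdgaMor_chain (cmul x y) =
    cmul (cdgaMor_chain x) (cdgaMor_chain y) }.

Section SignLemmas.
Variable K : fieldType.
Lemma sgn_add1 p : sgn K (p + 1) = - sgn K p.
Proof. by rewrite !sgnE parD addbT; case: (par p); rewrite ?expr0 ?expr1 ?opprK. Qed.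
Lemma sgn_sqr p : sgn K p * sgn K p = 1.
Proof. by rewrite !sgnE -signr_addb addbb. Qed.
Lemma sgnD p q : sgn K (p + q) = sgn K p * sgn K q.
Proof. by rewrite !sgnE parD signr_addb. Qed.
End SignLemmas.

Lemma parity_chain (K : fieldType) (V W : gradedMod K) (f : V -> W) k :
  linear f -> (forall n v, homog n v -> homog (n + k) (f v)) ->
  forall v, parity (f v) = sgn K k *: f (parity v).
Proof.
move=> lf hf; apply: (homog_ext (lin_comp (@parity_linear K W) lf)
  (lin_scale _ (lin_comp lf (@parity_linear K V)))) => n v hv.
by rewrite (parity_homog hv) (parity_homog (hf _ _ hv)) (linZ lf) scalerA sgnD mulrC.
Qed.

Section CProd.
Variables (K : fieldType) (X : cdga K).

(** The empty product is 0, in accordance with [word [::]] being 0: a [cdga] carries no unit. *)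
Fixpoint cprod (w : seq X) : X :=
  match w with
  | [::] => 0
  | [:: x] => x
  | x :: s => cmul x (cprod s)
  end.

Lemma cprod_cat u v s : cprod (u ++ v :: s) =
  if nilp u then cprod (v :: s) else cmul (cprod u) (cprod (v :: s)).
Proof.
elim: u => [//|x [|y u] IH] //.
by rewrite !cat_cons /= -!/(cprod (_ :: _)) -cat_cons IH cmulA.
Qed.

Lemma cprod_linear u s : linear (fun x => cprod (u ++ x :: s)).
Proof.
have [m1 m2] := cmul_bilin X.
have l0 : linear (fun x : X => cprod (x :: s)).
  by case: s => [|y s]; [exact: lin_id | exact: m1].
move=> a x y; rewrite !cprod_cat; case: nilp; first exact: l0.
by rewrite l0 m2.
Qed.

Lemma cprod_swap u s p q x y : homog p x -> homog q y ->
  cprod (u ++ x :: y :: s) = sgn K (p * q) *: cprod (u ++ y :: x :: s).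
Proof.
have [m1 m2] := cmul_bilin X.
move=> hx hy; have l0 : cprod (x :: y :: s) = sgn K (p * q) *: cprod (y :: x :: s).
  case: s => [|z s]; first exact: cmulC.
  by rewrite /= !cmulA (cmulC hx hy) (linZ (m1 _)).
rewrite !cprod_cat; case: nilp; first exact: l0.
by rewrite l0 (linZ (m2 _)).
Qed.
End CProd.

Section Twisting.
Variables (K : fieldType) (C : lieCoalg K) (X : cdga K).
Local Notation S := (gshift C).
Implicit Types (psi phi : C -> X).

Definition degree1 psi :=
  linear psi /\ forall n c, homog n c -> homog (n + 1) (psi c).

Definition tmul (phi psi : C -> X) : tensor C C -> X :=
  tlift (fun a b => cmul (phi a) (psi b)).

(* In Sweedler notation [conv psi t] is the sum of (-1)^(|c'|+1) psi(c') psi(c''). *)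
Definition conv psi : tensor C C -> X := tmul (fun c => parity (psi c)) psi.

(** The Maurer-Cartan curvature in the convolution Lie algebra Hom(C, X), whose differential sends a
    psi of degree 1 to d psi + psi d. By [curvE] it measures on generators how far [ext psi] is from
    commuting with the differentials. *)
Definition curv psi (c : C) : X :=
  cdiff (psi c) + psi (cdiff c) - 2^-1 *: conv psi (cobracket c).

Definition twisting psi := degree1 psi /\ forall c, curv psi c = 0.

Definition ext psi : sym S -> X := slift (fun w : seq S => cprod [seq psi x | x <- w]).

Lemma tmul_bilin phi psi : linear phi -> linear psi ->
  bilin (fun a b => cmul (phi a) (psi b)).
Proof. exact: (bilin_comp (cmul_bilin X)). Qed.
Lemma tmul_linear phi psi : linear phi -> linear psi -> linear (tmul phi psi).
Proof. by move=> h1 h2; apply: (tlift_linear (tmul_bilin h1 h2)). Qed.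
Lemma tmul_tens phi psi a b : linear phi -> linear psi ->
  tmul phi psi (tens a b) = cmul (phi a) (psi b).
Proof. by move=> h1 h2; rewrite /tmul (tlift_tens _ _ (tmul_bilin h1 h2)). Qed.

Lemma deep_tmul k l phi psi : deep k phi -> deep l psi ->
  deep (k + l).+1 (fun c => tmul phi psi (cobracket c)).
Proof. exact: (deep_mul (cmul_bilin X)). Qed.

Lemma tmul_homog phi psi i j : linear phi -> linear psi ->
  (forall n c, homog n c -> homog (n + i) (phi c)) ->
  (forall n c, homog n c -> homog (n + j) (psi c)) ->
  forall n (t : gtensor C C), homog n t -> homog (n + (i + j)) (tmul phi psi t).
Proof.
move=> l1 l2 h1 h2 n; have L := tmul_linear l1 l2.
apply: (gtensor_ext (lin_comp (@gproj_linear K X _) L) L) => p q a b <- ha hb.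
rewrite tmul_tens // addrACA; apply: cmul_homog; [exact: h1|exact: h2].
Qed.

Lemma conv_linear psi : linear psi -> linear (conv psi).
Proof. by move=> h; apply: tmul_linear => //; exact: (lin_comp (@parity_linear K X) h). Qed.

Lemma parity_deg i (phi : C -> X) : (forall n c, homog n c -> homog (n + i) (phi c)) ->
  forall n c, homog n c -> homog (n + i) (parity (phi c)).
Proof.
by move=> h n c hc; rewrite (parity_homog (h _ _ hc)); apply: homogZ; exact: h.
Qed.

Lemma conv_homog psi n c : degree1 psi -> homog n c ->
  homog (n + 2) (conv psi (cobracket c)).
Proof.
move=> [lp hp] hc; apply: (tmul_homog (i := 1) (j := 1)) => //.
- exact: (lin_comp (@parity_linear K X) lp).
- exact: parity_deg.
- exact: (chain_homog cobracket).
Qed.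

Section Ext.
Variables (psi : C -> X) (dpsi : degree1 psi).
Let lpsi : linear psi := proj1 dpsi.

Lemma psi_homog n (c : S) : homog n c -> homog n (psi c).
Proof. by move=> /homog_unshift /(proj2 dpsi); rewrite subrK. Qed.

Lemma ext_adm : @sym_adm K S _ (fun w => cprod [seq psi x | x <- w]).
Proof.
split=> [//|u s a x y|u s p q x y hx hy]; rewrite !map_cat /=.
  by rewrite lpsi cprod_linear.
by rewrite (cprod_swap _ _ (psi_homog hx) (psi_homog hy)).
Qed.
Lemma ext_linear : linear (ext psi).
Proof. exact: (slift_linear ext_adm). Qed.
Lemma ext_word w : ext psi (word w) = cprod [seq psi x | x <- w].
Proof. exact: (slift_word _ ext_adm). Qed.

Lemma ext_smul a b : ext psi (smul a b) = cmul (ext psi a) (ext psi b).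
Proof.
have F := ext_linear.
have [m1 m2] := smul_bilin S; have [n1 n2] := cmul_bilin X.
move: a; apply: (sym_ext (lin_comp F (m1 b)) (lin_comp (n1 _) F)) => v s.
move: b; apply: (sym_ext (lin_comp F (m2 _)) (lin_comp (n2 _) F)) => v' s'.
by rewrite smul_word !ext_word -cat_cons map_cat cprod_cat.
Qed.

Lemma ext_homog n (a : gsym S) : homog n a -> homog n (ext psi a).
Proof.
have F := ext_linear.
move: a; apply: (gsym_ext (lin_comp (@gproj_linear K X n) F) F) => ds w hw <-.
rewrite ext_word; elim: ds w hw => [|d ds IH] [|v w] // => [_|[hv hw]].
  exact: homog0.
have := IH _ hw; rewrite big_cons.
case: w ds hw {IH} => [|v' w] [|d' ds] // => [_ _|_ h].
  by rewrite big_nil addr0; apply: psi_homog.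
by apply: cmul_homog => //; apply: psi_homog.
Qed.

Let pl : linear (fun c => parity (psi c)) := lin_comp (@parity_linear K X) lpsi.

Lemma ext_quad t : ext psi (cobar_quad t) = - conv psi t.
Proof.
have F := ext_linear; have Q := @cobar_quad_linear K C.
move: t; apply: (tens_homog_ext (lin_comp F Q) (lin_opp (conv_linear lpsi))).
move=> p q a b ha hb; rewrite (cobar_quad_tens _ ha) (linZ F) ext_word /=.
rewrite /conv tmul_tens // (parity_homog (proj2 dpsi _ _ ha)).
by rewrite (linZ (proj1 (cmul_bilin X) _)) sgn_add1 scaleNr opprK.
Qed.

Lemma curvE c : curv psi c = cdiff (psi c) - ext psi (cobar_gen c).
Proof.
have F := ext_linear; rewrite /cobar_gen (linD F) !(linN F) (linZ F) ext_quad.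
by rewrite ext_word /= scalerN opprK /curv opprD opprK addrA.
Qed.

Lemma curv_linear : linear (curv psi).
Proof.
apply: lin_add; last first.
  apply: lin_opp; apply: lin_scale.
  exact: (lin_comp (conv_linear lpsi) (@cobracket_linear K C)).
apply: lin_add; first exact: (lin_comp (@cdiff_linear K X) lpsi).
exact: (lin_comp lpsi (@cdiff_linear K C)).
Qed.

Lemma curv_homog n c : homog n c -> homog (n + 2) (curv psi c).
Proof.
move=> hc; have [_ hp] := dpsi; have -> : n + 2 = n + 1 + 1 by rewrite -addrA.
apply: homogD; last first.
  apply: homogN; apply: homogZ; rewrite -addrA.
  exact: conv_homog hc.
by apply: homogD; [apply: cdiff_homog; apply: hp | apply: hp; apply: cdiff_homog].
Qed.

(* The derivation along [ext psi] that extends [curv psi]; the Bianchi identity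
   is what d^2 = 0 in the cobar construction says about it. *)
Let defect (a : sym S) : X := cdiff (ext psi a) - ext psi (cobar_diff a).

Lemma defect_linear : linear defect.
Proof.
apply: lin_add; first exact: (lin_comp (@cdiff_linear K X) ext_linear).
apply: lin_opp; exact: (lin_comp ext_linear (@cobar_diff_linear K C)).
Qed.

Lemma defect_word1 c : defect (word [:: (c : S)]) = curv psi c.
Proof.
rewrite curvE /defect ext_word cobar_diff_word /=.
by rewrite (lin0 (proj2 (smul_bilin S) _)) addr0.
Qed.

Lemma defect_smul m (a b : sym S) : @homog K (gsym S) m a ->
  defect (smul a b) = cmul (defect a) (ext psi b) + sgn K m *: cmul (ext psi a) (defect b).
Proof.
move=> ha; have F := ext_linear; have [n1 n2] := cmul_bilin X.
rewrite /defect (cobar_diff_smul _ ha) ext_smul (linD F) (linZ F) !ext_smul.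
rewrite (cmul_diff _ (ext_homog ha)) !(linD (n1 _)) !(linD (n2 _)) !(linN (n1 _)).
by rewrite !(linN (n2 _)) scalerDr scalerN opprD addrACA.
Qed.

Lemma defect_quad t : defect (cobar_quad t) =
  tmul (fun c => parity (curv psi c)) psi t - tmul psi (curv psi) t.
Proof.
have F := defect_linear; have Q := @cobar_quad_linear K C.
have lc := curv_linear; have lpc := lin_comp (@parity_linear K X) lc.
move: t; apply: (tens_homog_ext (lin_comp F Q)
  (lin_add (tmul_linear lpc lpsi) (lin_opp (tmul_linear lpsi lc)))).
move=> p q a b ha hb; rewrite (cobar_quad_tens _ ha) (linZ F) !tmul_tens //.
have -> : word [:: (a : S); (b : S)] = smul (word [:: (a : S)]) (word [:: (b : S)]).
  by rewrite smul_word.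
have hw : @homog K (gsym S) (p + 1) (word [:: (a : S)]).
  have -> : p + 1 = \sum_(d <- [:: p + 1]) d by rewrite big_seq1.
  by apply: homog_word; split=> //; apply: homog_shift.
rewrite (defect_smul _ hw) !defect_word1 !ext_word /=.
rewrite (parity_homog (curv_homog ha)) (linZ (proj1 (cmul_bilin X) _)).
rewrite scalerDr scalerA sgn_add1 mulrN sgn_sqr scaleN1r; congr (_ *: _ - _).
by rewrite (_ : p + 2 = p + 1 + 1) -?addrA // addrA !sgn_add1 opprK.
Qed.

Lemma bianchi (charK : [pchar K] =i pred0) c :
  cdiff (curv psi c) - curv psi (cdiff c) =
  2^-1 *: (tmul (fun c => parity (curv psi c)) psi (cobracket c) -
           tmul psi (curv psi) (cobracket c)).
Proof.
have E := defect_linear; have F := ext_linear.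
rewrite -defect_quad -!defect_word1.
have -> : cdiff (defect (word [:: (c : S)])) = - defect (cobar_gen c).
  rewrite /defect (linD (@cdiff_linear K X)) (linN (@cdiff_linear K X)) cdiffK.
  rewrite (cobar_diff_gen charK) (lin0 F) subr0 add0r.
  by rewrite cobar_diff_word /= (lin0 (proj2 (smul_bilin S) _)) addr0.
rewrite /cobar_gen (linD E) !(linN E) (linZ E) opprD !opprK.
by rewrite addrAC subrr add0r.
Qed.

(** The right-hand side is linear in the curvature and passes through one more cobracket. Hence the
    curvature factors through iterated cobrackets of every depth, and these kill any given element
    by conilpotence. *)
Lemma curv_vanish (h : X -> X) : linear h ->
  (forall c, curv psi c =
    h (tmul (fun c => parity (curv psi c)) psi (cobracket c) -
       tmul psi (curv psi) (cobracket c))) ->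
  forall c, curv psi c = 0.
Proof.
move=> lh hR; have lR := curv_linear.
have key k : deep k (curv psi).
  elim: k => [|k IH]; first exact: linear_deep0.
  apply: (deep_eq (fun c => esym (hR c))); apply: (deep_comp lh).
  apply: deepD.
    rewrite -[k]addn0; apply: deep_tmul; last exact: linear_deep0.
    exact: deep_comp (@parity_linear K X) IH.
  apply: (deep_comp (lin_opp (@lin_id K X))).
  by rewrite -[k]add0n; apply: deep_tmul => //; exact: linear_deep0.
move=> c; have [n hn] := cobracket_conil c; exact: deep_vanish (key n) _ hn.
Qed.
End Ext.

Lemma ext_uniq psi (dpsi : degree1 psi) (g : sym S -> X) : linear g ->
  (forall a b, g (smul a b) = cmul (g a) (g b)) ->
  (forall c, g (word [:: (c : S)]) = psi c) -> g =1 ext psi.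
Proof.
move=> lg gM g1; apply: (sym_ext lg (ext_linear dpsi)) => v s.
rewrite (ext_word dpsi); elim: s v => [|x s IH] v; first exact: g1.
have -> : word (v :: x :: s) = smul (word [:: v]) (word (x :: s)).
  by rewrite smul_word.
by rewrite gM g1 IH.
Qed.

(** Both sides are derivations along [ext psi], so it suffices to compare them on generators, where
    their difference is the curvature. *)
Lemma ext_diff psi : twisting psi ->
  forall a : sym S, ext psi (cobar_diff a) = cdiff (ext psi a).
Proof.
move=> [dpsi mc]; have F := ext_linear dpsi.
have D := @cobar_diff_linear K C; have [m1 m2] := smul_bilin S.
apply: (sym_hext (lin_comp F D) (lin_comp (@cdiff_linear K X) F)) => ds w.
elim: ds w => [|d ds IH] [|v w] // => [_|[hv hw]].
  by rewrite word0 (lin0 D) (lin0 F) (lin0 (@cdiff_linear K X)).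
have hwd : @homog K (gsym S) d (word [:: v]).
  have -> : d = \sum_(e <- [:: d]) e by rewrite big_seq1.
  exact: homog_word.
have gen : ext psi (cobar_diff (word [:: v])) = cdiff (ext psi (word [:: v])).
  apply/esym/eqP; rewrite -subr_eq0; apply/eqP.
  rewrite cobar_diff_word /= (lin0 (m2 _)) addr0 (ext_word dpsi) /=.
  by rewrite -(curvE dpsi) mc.
case: w hw => [//|v' w] hw.
have -> : word [:: v, v' & w] = smul (word [:: v]) (word (v' :: w)).
  by rewrite smul_word.
rewrite (cobar_diff_smul _ hwd) (linD F) (linZ F) !(ext_smul dpsi) gen (IH _ hw).
by rewrite (cmul_diff _ (ext_homog dpsi hwd)).
Qed.
End Twisting.

(** * Solving the Maurer-Cartan equation by a contraction *)

Lemma tens_fin_ind (K : fieldType) (V W : lmodType K) (P : tensor V W -> Prop) :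
  P 0 -> (forall a v w t, P t -> P (a *: tens v w + t)) -> forall t, P t.
Proof.
move=> P0 PS t; rewrite (pgen_span t).
elim: (repr t) => [|[a [v w]] s IH]; first by rewrite big_nil.
by rewrite big_cons; apply: PS.
Qed.

Section Deformation.
Variables (K : fieldType) (charK : [pchar K] =i pred0).
Variables (C : lieCoalg K) (X : cdga K) (psi0 : C -> X) (I : X -> Prop) (h : X -> X).
Hypotheses (dpsi0 : degree1 psi0).
Hypotheses (I0 : I 0) (I_lin : forall a x y, I x -> I y -> I (a *: x + y)).
Hypotheses (lh : linear h) (hh : forall n x, homog n x -> homog (n - 1) (h x)).
Hypotheses (hI : forall x, I x -> I (h x)).
Hypotheses (hK : forall x, I x -> cdiff (h x) + h (cdiff x) = x).

(** The linear terms of the curvature are frozen at [psi0]; only the quadratic one sees psi. Two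
    successive iterates of [T] therefore differ only after a cobracket. *)
Definition residue (psi : C -> X) (c : C) : X :=
  cdiff (psi0 c) + psi0 (cdiff c) - 2^-1 *: conv psi (cobracket c).

(** In effect, [psi0] solves the equation modulo [I]. This is not phrased with an ideal [I], since
    in [rectification] it is an ideal only of a fibre product and in general not of the whole
    algebra. *)
Hypothesis residueI : forall psi, degree1 psi ->
  (forall c, I (psi c - psi0 c)) -> forall c, I (residue psi c).

Let T (psi : C -> X) (c : C) : X := psi0 c - h (residue psi c).

Lemma residue_linear psi : linear psi -> linear (residue psi).
Proof.
have [lp _] := dpsi0; move=> l; apply: lin_add; last first.
  apply: lin_opp; apply: lin_scale.
  exact: (lin_comp (conv_linear l) (@cobracket_linear K C)).
apply: lin_add; first exact: (lin_comp (@cdiff_linear K X) lp).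
exact: (lin_comp lp (@cdiff_linear K C)).
Qed.

Lemma residue_homog psi n c : degree1 psi -> homog n c ->
  homog (n + 1 + 1) (residue psi c).
Proof.
move=> dp hc; have [_ hp] := dpsi0; apply: homogD; last first.
  apply: homogN; apply: homogZ; rewrite -addrA; exact: conv_homog dp hc.
by apply: homogD; [apply: cdiff_homog; apply: hp | apply: hp; apply: cdiff_homog].
Qed.

Lemma degree1_step psi : degree1 psi -> degree1 (T psi).
Proof.
move=> dp; have [l0 h0] := dpsi0; split.
  apply: lin_add => //; apply: lin_opp; apply: (lin_comp lh).
  exact: residue_linear (proj1 dp).
move=> n c hc; apply: homogD; first exact: h0.
by apply: homogN; rewrite -[n + 1](addrK 1); apply: hh; apply: residue_homog.
Qed.

Let it k : C -> X := iter k T psi0.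

Lemma degree1_it k : degree1 (it k).
Proof. by elim: k => [//|k IH]; apply: degree1_step. Qed.

Lemma I_opp x : I x -> I (- x).
Proof. by move=> hx; rewrite -[- x]addr0 -scaleN1r; apply: I_lin. Qed.

Lemma I_it k c : I (it k c - psi0 c).
Proof.
elim: k c => [|k IH] c; first by rewrite subrr.
rewrite /= /T addrAC subrr add0r; apply: I_opp; apply: hI.
by apply: residueI => //; apply: degree1_it.
Qed.

Lemma conv_sub (u v : C -> X) t : linear u -> linear v ->
  conv u t - conv v t = tmul (fun c => parity (u c - v c)) u t
    + tmul (fun c => parity (v c)) (fun c => u c - v c) t.
Proof.
move=> lu lv; have lP := @parity_linear K X.
have luv := lin_add lu (lin_opp lv).
have [m1 m2] := cmul_bilin X.
move: t; apply: tens_ext.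
- exact: (lin_add (conv_linear lu) (lin_opp (conv_linear lv))).
- apply: lin_add; first exact: (tmul_linear (lin_comp lP luv) lu).
  exact: (tmul_linear (lin_comp lP lv) luv).
move=> a b; rewrite /conv !tmul_tens //;
  try by [exact: (lin_comp lP lu)|exact: (lin_comp lP lv)|exact: (lin_comp lP luv)].
rewrite (linD lP) (linN lP) (linD (m1 _)) (linN (m1 _)) (linD (m2 _)) (linN (m2 _)).
by rewrite addrA subrK.
Qed.

Lemma deep_it k : deep k (fun c => it k.+1 c - it k c).
Proof.
have lP := @parity_linear K X.
have ld j : linear (fun c => it j.+1 c - it j c).
  apply: lin_add; first exact: (proj1 (degree1_it j.+1)).
  apply: lin_opp; exact: (proj1 (degree1_it j)).
elim: k => [|k IH]; first exact: linear_deep0.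
have E c : 2^-1 *: h (tmul (fun c => parity (it k.+1 c - it k c)) (it k.+1) (cobracket c)
   + tmul (fun c => parity (it k c)) (fun c => it k.+1 c - it k c) (cobracket c)) =
   it k.+2 c - it k.+1 c.
  rewrite -conv_sub; [|exact: (proj1 (degree1_it _))..].
  rewrite -(linZ lh) -[RHS]/((psi0 c - h (residue (it k.+1) c)) -
    (psi0 c - h (residue (it k) c))).
  rewrite opprB [RHS]addrC addrA subrK -(linN lh) -(linD lh) /residue.
  by congr (h _); rewrite opprD opprK addrACA subrr add0r scalerBr addrC.
apply: (deep_eq E); apply: (deep_comp (lin_scale _ lh)); apply: deepD.
  have := deep_tmul (deep_comp lP IH) (linear_deep0 (proj1 (degree1_it k.+1))).
  by rewrite addn0.
exact: (deep_tmul (linear_deep0 (lin_comp lP (proj1 (degree1_it k)))) IH).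
Qed.

Lemma it_stable c : exists N, forall k, (N <= k)%N -> it k c = it N c.
Proof.
have [N hN] := cobracket_conil c; exists N => k.
elim: k => [|k IH]; first by rewrite leqn0 => /eqP ->.
rewrite leq_eqVlt => /orP[/eqP -> //|]; rewrite ltnS => hk.
rewrite -IH //; apply/eqP; rewrite -subr_eq0; apply/eqP.
apply: (deep_vanish (deep_it k)) => B hB; apply: hN.
exact: leq_ltn_trans hB.
Qed.

Let N c := projT1 (cid (it_stable c)).
Let psi c := it (N c) c.

Lemma psiE c k : (N c <= k)%N -> it k c = psi c.
Proof. by move=> hk; rewrite /psi /N in hk *; case: cid hk => /= M hM; apply: hM. Qed.

Lemma psi_degree1 : degree1 psi.
Proof.
split=> [a x y|n c hc]; last exact: (proj2 (degree1_it _)).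
pose k := maxn (N (a *: x + y)) (maxn (N x) (N y)).
rewrite -!(@psiE _ k) /k ?leq_max ?leqnn ?orbT //.
exact: (proj1 (degree1_it _)).
Qed.

(** The stage at which the iterates stabilize depends on the element, but a tensor is a finite sum
    of pure tensors, so one stage serves all its factors. *)
Lemma conv_psi t : exists M, forall k, (M <= k)%N -> conv psi t = conv (it k) t.
Proof.
have lc k := conv_linear (proj1 (degree1_it k)).
have lp := conv_linear (proj1 psi_degree1); have lP := @parity_linear K X.
move: t; apply: tens_fin_ind => [|a v w t [M hM]].
  by exists 0%N => k _; rewrite (lin0 lp) (lin0 (lc k)).
exists (maxn M (maxn (N v) (N w))) => k; rewrite !geq_max => /and3P[h1 h2 h3].
rewrite lp (lc k) (hM k) //; congr (_ *: _ + _).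
rewrite /conv tmul_tens; [|exact: (lin_comp lP (proj1 psi_degree1))|
  exact: (proj1 psi_degree1)].
rewrite tmul_tens; [|exact: (lin_comp lP (proj1 (degree1_it k)))|
  exact: (proj1 (degree1_it k))].
by rewrite !psiE.
Qed.

(* For the fixed point psi, with residue Q, the contraction gives
   curv psi c = h (d (Q c) - Q (d c)) = h (d (curv psi c) - curv psi (d c)), which
   by the Bianchi identity is linear in curv psi applied after a cobracket. *)
Lemma deformation : exists psi : C -> X, twisting psi /\
  forall c, psi c = psi0 c - h (residue psi c) /\ I (residue psi c).
Proof.
have fixP c : psi c = psi0 c - h (residue psi c).
  have [M hM] := conv_psi (cobracket c).
  pose k := maxn M (N c); rewrite -[LHS](@psiE c k.+1) ?leqW ?leq_maxr //.
  by rewrite /= /T /residue (hM k) // leq_maxl.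
have Ip c : I (residue psi c).
  by apply: residueI => [|c']; [exact: psi_degree1 | exact: I_it].
have dp := psi_degree1; have lp := proj1 dp.
exists psi; split=> //; split=> // c.
have ld := @cdiff_linear K X.
have RE c' : curv psi c' = h (cdiff (residue psi c') - residue psi (cdiff c')).
  have -> : curv psi c' = residue psi c' - cdiff (h (residue psi c'))
      - h (residue psi (cdiff c')).
    rewrite /curv (fixP c') (fixP (cdiff c')) (linD ld) (linN ld).
    rewrite addrACA -opprD -[_ - _ - _ in RHS]addrA -opprD.
    by rewrite [LHS]addrAC.
  by rewrite -{1}(hK (Ip c')) [X in X - _]addrAC subrr add0r (linD lh) (linN lh).
have dRE c' : cdiff (residue psi c') - residue psi (cdiff c') =
    cdiff (curv psi c') - curv psi (cdiff c').
  rewrite /curv /residue !(linD ld) !(linN ld) !cdiffK (lin0 lp).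
  rewrite (lin0 (proj1 dpsi0)) !addr0 !add0r.
  by rewrite !opprD !addrA; congr (_ + _); rewrite addrAC subrr add0r
    [in RHS]addrAC subrr add0r.
apply: (curv_vanish dp (lin_scale 2^-1 lh)) => c'.
by rewrite RE dRE (bianchi dp charK) (linZ lh).
Qed.
End Deformation.

(** * Constructions of commutative dg algebras *)

Section Concentrated.
Variables (K : fieldType) (V : lmodType K) (k : int).
Definition conc_proj (n : int) (v : V) : V := if n == k then v else 0.
Lemma conc_proj_linear n : linear (conc_proj n).
Proof. by rewrite /conc_proj; case: eqP => _; [exact: lin_id | exact: lin_zero]. Qed.
Lemma conc_projK m n v :
  conc_proj m (conc_proj n v) = if m == n then conc_proj n v else 0.
Proof.
rewrite /conc_proj; have [->|h] := eqVneq n k; first by [].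
by rewrite !if_same.
Qed.
Lemma conc_proj_fin v : exists s : seq int,
  uniq s /\ v = \sum_(n <- s) conc_proj n v.
Proof. by exists [:: k]; rewrite big_seq1 /conc_proj eqxx. Qed.
Definition concentrated := Gmod conc_proj_linear conc_projK conc_proj_fin.

Lemma conc_homogP n (v : V) : @homog K concentrated n v <-> (n != k -> v = 0).
Proof.
rewrite /homog /= /conc_proj; case: eqP => _; first by split.
by split=> [<- //|h]; rewrite h.
Qed.
End Concentrated.

Section ProductGraded.
Variables (K : fieldType) (V W : gradedMod K).
Definition gprod_proj (n : int) (x : V * W) : V * W := (gproj n x.1, gproj n x.2).
Lemma gprod_proj_linear n : linear (gprod_proj n).
Proof.
by move=> a [x x'] [y y']; congr pair; exact: (@gproj_linear K _ n).
Qed.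
Lemma gprod_projK m n x :
  gprod_proj m (gprod_proj n x) = if m == n then gprod_proj n x else 0.
Proof. by rewrite /gprod_proj !gprojK; case: eqP. Qed.
Lemma pair_sum (I : Type) (s : seq I) (F : I -> V) (G : I -> W) :
  \sum_(i <- s) ((F i, G i) : V * W) = (\sum_(i <- s) F i, \sum_(i <- s) G i).
Proof. by elim: s => [|i s IH]; rewrite ?big_nil // !big_cons IH. Qed.
Lemma gproj_sum (U : gradedMod K) (v : U) s : uniq s -> {subset gsupp v <= s} ->
  v = \sum_(n <- s) gproj n v.
Proof.
move=> us h; rewrite -(@hsumE K U U (fun _ => id)) //.
  by rewrite {1}(gsuppE v).
by move=> n hn; apply: gsupp_out; apply: contra hn; apply: h.
Qed.
Lemma gprod_proj_fin x : exists s : seq int,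
  uniq s /\ x = \sum_(n <- s) gprod_proj n x.
Proof.
case: x => v w; exists (undup (gsupp v ++ gsupp w)); split; first exact: undup_uniq.
rewrite pair_sum -!gproj_sum ?undup_uniq // => n hn;
  by rewrite mem_undup mem_cat hn ?orbT.
Qed.
Definition gprod := Gmod gprod_proj_linear gprod_projK gprod_proj_fin.

Lemma gprod_homogP n (x : V * W) :
  @homog K gprod n x <-> homog n x.1 /\ homog n x.2.
Proof.
case: x => v w; split=> [[h1 h2]|[h1 h2]]; first by split.
by rewrite /homog /= /gprod_proj h1 h2.
Qed.
End ProductGraded.

Section PairLinear.
Variables (K : fieldType) (V W U : lmodType K).
Lemma lin_pair (f : U -> V) (g : U -> W) : linear f -> linear g ->
  linear (fun x => (f x, g x) : V * W).
Proof. by move=> lf lg a x y; rewrite lf lg. Qed.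
Lemma lin_fst : linear (fst : V * W -> V). Proof. by []. Qed.
Lemma lin_snd : linear (snd : V * W -> W). Proof. by []. Qed.
End PairLinear.

Section Product.
Variables (K : fieldType) (X Y : cdga K).
Local Notation P := (gprod X Y).
Definition prod_diff (x : P) : P := (cdiff x.1, cdiff x.2).
Definition prod_mul (x y : P) : P := (cmul x.1 y.1, cmul x.2 y.2).
Lemma prod_diff_linear : linear prod_diff.
Proof. by apply: lin_pair => a x y; apply: cdiff_linear. Qed.
Lemma prod_diff_homog n x : @homog K P n x -> @homog K P (n + 1) (prod_diff x).
Proof.
move=> /gprod_homogP[h1 h2]; apply/gprod_homogP; split; exact: cdiff_homog.
Qed.
Lemma prod_diffK x : prod_diff (prod_diff x) = 0.
Proof. by rewrite /prod_diff !cdiffK. Qed.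
Definition prod_complex := Cplx prod_diff_linear prod_diff_homog prod_diffK.
Lemma prod_mul_bilin : bilin prod_mul.
Proof.
have [m1 m2] := cmul_bilin X; have [n1 n2] := cmul_bilin Y.
by split=> [w|w]; apply: lin_pair => a x y; rewrite ?m1 ?n1 ?m2 ?n2.
Qed.
Lemma prod_mul_homog m n x y : @homog K P m x -> @homog K P n y ->
  @homog K P (m + n) (prod_mul x y).
Proof.
move=> /gprod_homogP[h1 h2] /gprod_homogP[h3 h4]; apply/gprod_homogP.
by split; apply: cmul_homog.
Qed.
Lemma prod_mulA x y z : prod_mul x (prod_mul y z) = prod_mul (prod_mul x y) z.
Proof. by rewrite /prod_mul !cmulA. Qed.
Lemma prod_mulC m n x y : @homog K P m x -> @homog K P n y ->
  prod_mul x y = sgn K (m * n) *: prod_mul y x.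
Proof.
move=> /gprod_homogP[h1 h2] /gprod_homogP[h3 h4].
by rewrite /prod_mul (cmulC h1 h3) (cmulC h2 h4).
Qed.
Lemma prod_mul_diff m x y : @homog K P m x ->
  prod_diff (prod_mul x y) =
  prod_mul (prod_diff x) y + sgn K m *: prod_mul x (prod_diff y).
Proof.
move=> /gprod_homogP[h1 h2].
by rewrite /prod_mul /prod_diff /= (cmul_diff _ h1) (cmul_diff _ h2).
Qed.
Definition product : cdga K :=
  @Cdga K prod_complex _ prod_mul_bilin prod_mul_homog prod_mulA prod_mulC
    prod_mul_diff.
End Product.

Section Scalars.
Variable K : fieldType.
Local Notation P := (concentrated K^o 0).
Lemma scal_diff_homog n (x : P) : homog n x -> @homog K P (n + 1) 0.
Proof. by move=> _; apply: homog0. Qed.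
Definition scal_complex : complex K :=
  @Cplx K P _ (@lin_zero K P P) scal_diff_homog (fun _ => erefl).
Lemma scal_mul_bilin : bilin (fun x y : P => x * y : P).
Proof.
split=> [y|x] a u v; rewrite !scale_regE ?mulrDl ?mulrDr ?mulrA //.
by rewrite [x * a]mulrC.
Qed.
Lemma scal_mul_homog m n (x y : P) : homog m x -> homog n y ->
  @homog K P (m + n) (x * y : P).
Proof.
move=> /conc_homogP hx /conc_homogP hy; apply/conc_homogP.
have [->|/hx ->] := eqVneq m 0; last by rewrite mul0r.
by rewrite add0r => /hy ->; rewrite mulr0.
Qed.
Lemma scal_mulC m n (x y : P) : homog m x -> homog n y ->
  x * y = sgn K (m * n) *: (y * x : P).
Proof.
move=> /conc_homogP hx /conc_homogP hy; rewrite scale_regE.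
have [->|/hx ->] := eqVneq m 0; last by rewrite mul0r !mulr0.
by rewrite mul0r /sgn expr0z mul1r mulrC.
Qed.
Lemma scal_mul_diff m (x y : P) : @homog K P m x ->
  (0 : P) = ((0 : P) * y : P) + sgn K m *: (x * (0 : P) : P).
Proof. by move=> _; rewrite mul0r mulr0 scaler0 addr0. Qed.
Definition scalars : cdga K :=
  @Cdga K scal_complex _ scal_mul_bilin scal_mul_homog (@mulrA K) scal_mulC
    scal_mul_diff.
End Scalars.

(* The pair (f, g) stands for the form f(t) + g(t) dt. *)
Section Interval.
Variable K : fieldType.
Local Notation P := (gprod (concentrated {poly K} 0) (concentrated {poly K} 1)).
Definition form_diff (x : P) : P := (0, x.1^`()).
Definition form_mul (x y : P) : P := (x.1 * y.1, x.1 * y.2 + x.2 * y.1).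

Lemma form_homogP n (x : P) :
  homog n x <-> (n != 0 -> x.1 = 0) /\ (n != 1 -> x.2 = 0).
Proof.
by rewrite gprod_homogP; split=> -[/conc_homogP h1 /conc_homogP h2].
Qed.
Lemma form_diff_linear : linear form_diff.
Proof.
apply: lin_pair; first exact: lin_zero.
by move=> a x y; rewrite /= derivD derivZ.
Qed.
Lemma form_diff_homog n (x : P) : homog n x -> homog (n + 1) (form_diff x).
Proof.
move=> /form_homogP[h _]; apply/form_homogP; split=> //= hn.
rewrite h ?derivC ?raddf0 //; apply: contra hn => /eqP ->; exact: eqxx.
Qed.
Lemma form_diffK x : form_diff (form_diff x) = 0.
Proof. by rewrite /form_diff /= raddf0. Qed.
Definition form_complex := Cplx form_diff_linear form_diff_homog form_diffK.
Lemma form_mul_bilin : bilin form_mul.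
Proof.
split=> [w|w]; apply: lin_pair => a x y /=.
- by rewrite mulrDl scalerAl.
- by rewrite !mulrDl -!scalerAl scalerDr addrACA.
- by rewrite mulrDr scalerAr.
- by rewrite !mulrDr -!scalerAr scalerDr addrACA.
Qed.
Lemma form_mul_homog m n (x y : P) : homog m x -> homog n y ->
  homog (m + n) (form_mul x y).
Proof.
move=> /form_homogP[h1 h2] /form_homogP[h3 h4]; apply/form_homogP => /=.
have [m0|m0] := eqVneq m 0; last first.
  rewrite h1 // !mul0r add0r; split=> // hmn.
  have [m1|m1] := eqVneq m 1; last by rewrite h2 // mul0r.
  by rewrite h3 ?mulr0 //; apply: contra hmn => /eqP ->; rewrite m1 addr0.
rewrite m0 add0r h2 ?m0 // mul0r addr0.
by split=> hn; [rewrite h3 // mulr0 | rewrite h4 // mulr0].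
Qed.
Lemma form_mulA x y z : form_mul x (form_mul y z) = form_mul (form_mul x y) z.
Proof. by congr pair => /=; ring. Qed.
Lemma form_mulC m n (x y : P) : homog m x -> homog n y ->
  form_mul x y = sgn K (m * n) *: form_mul y x.
Proof.
move=> /form_homogP[h1 h2] /form_homogP[h3 h4].
have [m0|m0] := eqVneq m 0.
  rewrite m0 mul0r /sgn expr0z scale1r /form_mul.
  by congr pair; ring.
have [n0|n0] := eqVneq n 0.
  rewrite n0 mulr0 /sgn expr0z scale1r /form_mul.
  by congr pair; ring.
by rewrite /form_mul h1 // h3 // !(mul0r, mulr0, addr0) (scaler0 P).
Qed.
Lemma form_mul_diff m (x y : P) : homog m x ->
  form_diff (form_mul x y) =
  form_mul (form_diff x) y + sgn K m *: form_mul x (form_diff y).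
Proof.
move=> /form_homogP[h1 _]; congr pair => /=.
  by rewrite mul0r mulr0 scaler0 addr0.
rewrite derivM !mul0r !mulr0 addr0 add0r.
have [->|m0] := eqVneq m 0; first by rewrite /sgn expr0z scale1r.
by rewrite h1 // !mul0r scaler0.
Qed.
Definition forms : cdga K :=
  @Cdga K form_complex _ form_mul_bilin form_mul_homog form_mulA form_mulC
    form_mul_diff.
End Interval.

Section TensorAlgebra.
Variables (K : fieldType) (A B : cdga K).
Local Notation T := (tensor A B).

(** Kept as a function of four variables so that linearity can be checked in each before lifting to
    two tensors; the sign is the Koszul sign of moving b past a'. *)
Definition tens_mul4 (a : A) (b : B) (a' : A) (b' : B) : T :=
  hsum (fun q b => hsum (fun p a' => sgn K (q * p) *: tens (cmul a a') (cmul b b')) a') b.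

Lemma tens_mul4_lin1 b a' b' : linear (fun a => tens_mul4 a b a' b').
Proof.
have [t1 t2] := tens_bilin A B; have [m1 m2] := cmul_bilin A.
apply: lin_bigsum => q; apply: lin_bigsum => p; apply: lin_scale.
exact: (lin_comp (t1 _) (m1 _)).
Qed.
Lemma tens_mul4_lin2 a a' b' : linear (fun b => tens_mul4 a b a' b').
Proof.
have [t1 t2] := tens_bilin A B; have [m1 m2] := cmul_bilin B.
apply: hsum_linear => q; apply: lin_bigsum => p; apply: lin_scale.
exact: (lin_comp (t2 _) (m1 _)).
Qed.
Lemma tens_mul4_lin3 a b b' : linear (fun a' => tens_mul4 a b a' b').
Proof.
have [t1 t2] := tens_bilin A B; have [m1 m2] := cmul_bilin A.
apply: lin_bigsum => q; apply: hsum_linear => p; apply: lin_scale.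
exact: (lin_comp (t1 _) (m2 _)).
Qed.
Lemma tens_mul4_lin4 a b a' : linear (fun b' => tens_mul4 a b a' b').
Proof.
have [t1 t2] := tens_bilin A B; have [m1 m2] := cmul_bilin B.
apply: lin_bigsum => q; apply: lin_bigsum => p; apply: lin_scale.
exact: (lin_comp (t2 _) (m2 _)).
Qed.
Lemma tens_mul4E p q a b a' b' : homog q b -> homog p a' ->
  tens_mul4 a b a' b' = sgn K (q * p) *: tens (cmul a a') (cmul b b').
Proof.
have [t1 t2] := tens_bilin A B.
have [m1 m2] := cmul_bilin A; have [n1 n2] := cmul_bilin B.
move=> hb ha; rewrite /tens_mul4 (hsum_homog _ hb) ?(hsum_homog _ ha) //.
  by move=> r; apply: lin_scale; exact: (lin_comp (t1 _) (m2 _)).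
move=> r; apply: lin_bigsum => s; apply: lin_scale.
exact: (lin_comp (t2 _) (n1 _)).
Qed.

Definition tens_mul (t t' : T) : T :=
  tlift (fun a b => tlift (tens_mul4 a b) t') t.

Lemma tens_mul4_bilin a b : bilin (tens_mul4 a b).
Proof. by split=> [b'|a']; [exact: tens_mul4_lin3 | exact: tens_mul4_lin4]. Qed.
Lemma tens_mul_bilin1 t' : bilin (fun a b => tlift (tens_mul4 a b) t').
Proof.
split=> [b|a].
  apply: (tlift_param (g := fun a => tens_mul4 a b)) => [a|a' b'].
    exact: tens_mul4_bilin.
  exact: tens_mul4_lin1.
apply: (tlift_param (g := fun b => tens_mul4 a b)) => [b|a' b'].
  exact: tens_mul4_bilin.
exact: tens_mul4_lin2.
Qed.
Lemma tens_mul_bilin : bilin tens_mul.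
Proof.
split=> [t'|t]; first exact: (tlift_linear (tens_mul_bilin1 t')).
apply: (tlift_param (g := fun t' a b => tlift (tens_mul4 a b) t')) => [t'|a b].
  exact: tens_mul_bilin1.
exact: (tlift_linear (tens_mul4_bilin a b)).
Qed.
Lemma tens_mul_tens p q a b a' b' : homog q b -> homog p a' ->
  tens_mul (tens a b) (tens a' b') =
    sgn K (q * p) *: tens (cmul a a') (cmul b b').
Proof.
move=> hb ha; rewrite /tens_mul (tlift_tens _ _ (tens_mul_bilin1 _)).
by rewrite (tlift_tens _ _ (tens_mul4_bilin a b)) (tens_mul4E _ _ hb ha).
Qed.

Lemma tens_mul_homog m n (x y : gtensor A B) : homog m x -> homog n y ->
  @homog K (gtensor A B) (m + n) (tens_mul x y).
Proof.
have [m1 m2] := tens_mul_bilin; have L := @tens_proj_linear K A B (m + n).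
move=> hx; move: y; apply: (gtensor_ext (lin_comp L (m2 x)) (m2 x)).
move=> p q a b epq ha hb; move: x hx.
apply: (gtensor_ext (lin_comp L (m1 _)) (m1 _)) => p' q' a' b' epq' ha' hb'.
rewrite (tens_mul_tens _ _ hb' ha) (linZ L); congr (_ *: _).
rewrite -epq -epq' addrACA; apply: homog_tens; exact: cmul_homog.
Qed.

Lemma tens_mulA x y z : tens_mul x (tens_mul y z) = tens_mul (tens_mul x y) z.
Proof.
have [m1 m2] := tens_mul_bilin.
move: x; apply: (tens_homog_ext (m1 _) (lin_comp (m1 z) (m1 y))).
move=> p q a b ha hb.
move: y; apply: (tens_homog_ext (lin_comp (m2 _) (m1 z)) (lin_comp (m1 z) (m2 _))).
move=> p' q' a' b' ha' hb'.
move: z; apply: (tens_homog_ext (lin_comp (m2 _) (m2 _)) (m2 _)).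
move=> p2 q2 a2 b2 ha2 hb2.
rewrite (tens_mul_tens _ _ hb' ha2) (tens_mul_tens _ _ hb ha') (linZ (m2 _)) (linZ (m1 _)).
rewrite (tens_mul_tens _ _ hb (cmul_homog ha' ha2)).
rewrite (tens_mul_tens _ _ (cmul_homog hb hb') ha2) !scalerA !cmulA; congr (_ *: _).
rewrite !sgnE !(parM, parD) -!signr_addb; congr (_ ^+ _).
by case: (par p'); case: (par q); case: (par q'); case: (par p2).
Qed.

Lemma tens_mulC m n (x y : gtensor A B) : homog m x -> homog n y ->
  tens_mul x y = sgn K (m * n) *: tens_mul y x.
Proof.
have [m1 m2] := tens_mul_bilin.
move=> hx; move: y; apply: (gtensor_ext (m2 _) (lin_scale _ (m1 _))).
move=> p q a b epq ha hb; move: x hx.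
apply: (gtensor_ext (m1 _) (lin_scale _ (m2 _))) => p' q' a' b' epq' ha' hb'.
have [t1 t2] := tens_bilin A B.
rewrite (tens_mul_tens _ _ hb' ha) (tens_mul_tens _ _ hb ha').
rewrite (cmulC ha' ha) (cmulC hb' hb) (linZ (t1 _)) (linZ (t2 _)) !scalerA.
congr (_ *: _); rewrite -epq -epq' !sgnE !(parM, parD) -!signr_addb.
by congr (_ ^+ _); case: (par p'); case: (par q); case: (par q'); case: (par p).
Qed.

Lemma tens_mul_diff m (x y : ctensor A B) : homog m x ->
  tens_diff (tens_mul x y) =
  tens_mul (tens_diff x) y + sgn K m *: tens_mul x (tens_diff y).
Proof.
have [m1 m2] := tens_mul_bilin; have D := @tens_diff_linear K A B.
have [t1 t2] := tens_bilin A B.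
move=> hx; move: y; apply: (tens_homog_ext (lin_comp D (m2 x))
  (lin_add (m2 _) (lin_scale _ (lin_comp (m2 x) D)))).
move=> p q a b ha hb; move: x hx.
apply: (gtensor_ext (lin_comp D (m1 _))
  (lin_add (lin_comp (m1 _) D) (lin_scale _ (m1 _)))) => p' q' a' b' <- ha' hb'.
rewrite (tens_mul_tens _ _ hb' ha) (linZ D) (tens_diff_tens _ (cmul_homog ha' ha)).
rewrite (tens_diff_tens _ ha') (tens_diff_tens _ ha) !(linD (m1 _)) !(linD (m2 _)).
rewrite !(linZ (m1 _)) !(linZ (m2 _)).
rewrite (tens_mul_tens _ _ hb' ha) (tens_mul_tens _ _ (cdiff_homog hb') ha).
rewrite (tens_mul_tens _ _ hb' (cdiff_homog ha)) (tens_mul_tens _ _ hb' ha).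
rewrite (cmul_diff _ ha') (cmul_diff _ hb') (linD (t1 _)) (linD (t2 _)).
rewrite (linZ (t1 _)) (linZ (t2 _)) !scalerDr !scalerA addrACA -!addrA.
congr (_ + _); rewrite addrCA [in RHS]addrCA addrC [in RHS]addrC -!addrA.
rewrite [in LHS]addrC -!addrA.
rewrite [RHS]addrCA; congr (_ + _); last rewrite addrC; last congr (_ + _);
  congr (_ *: _); rewrite !sgnE !(parM, parD) -!signr_addb; congr (_ ^+ _);
  by case: (par p'); case: (par q'); case: (par p).
Qed.

Definition tens_cdga : cdga K :=
  @Cdga K (ctensor A B) _ tens_mul_bilin tens_mul_homog tens_mulA tens_mulC
    tens_mul_diff.
End TensorAlgebra.

Section CobarAlgebra.
Variables (K : fieldType) (charK : [pchar K] =i pred0) (C : lieCoalg K).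
Local Notation S := (gshift C).

Lemma smulC m n (a b : sym S) : @homog K (gsym S) m a -> @homog K (gsym S) n b ->
  smul a b = sgn K (m * n) *: smul b a.
Proof.
have [m1 m2] := smul_bilin S.
move=> + hb; move: a.
apply: (gsym_ext (m1 _) (lin_scale _ (m2 _))) => ds w hw <-.
elim: ds w hw => [|d ds IH] [|v w] // => [_|[hv hw]].
  by rewrite word0 (lin0 (m1 _)) (lin0 (m2 _)) scaler0.
case: w hw => [|v' w] hw.
  by case: ds hw {IH} => // _; rewrite big_seq1; apply: smul_comm.
have -> : word [:: v, v' & w] = smul (word [:: v]) (word (v' :: w)).
  by rewrite smul_word.
rewrite -smulA (IH _ hw) (linZ (m2 _)) smulA (smul_comm hv hb) (linZ (m1 _)).
rewrite scalerA -smulA big_cons; congr (_ *: _).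
by rewrite mulrDl sgnD mulrC.
Qed.

Definition cobar_cdga : cdga K :=
  @Cdga K (cobar C charK) _ (smul_bilin S) (@smul_homog K S)
    (@smulA K S) smulC (@cobar_diff_smul K C).
End CobarAlgebra.

(** * Morphisms *)

Section Morphisms.
Variables (K : fieldType) (X Y : cdga K) (p : cdgaMor X Y).
Let lp : linear p := chain_linear p.

Lemma parity_mor x : p (parity x) = parity (p x).
Proof.
rewrite (parity_chain (k := 0) lp) ?sgnE ?expr0 ?scale1r // => n v.
by rewrite addr0; apply: chain_homog.
Qed.

Variable C : lieCoalg K.

Lemma tmul_mor (phi psi : C -> X) t : linear phi -> linear psi ->
  p (tmul phi psi t) = tmul (fun c => p (phi c)) (fun c => p (psi c)) t.
Proof.
move=> l1 l2; have [l1' l2'] := (lin_comp lp l1, lin_comp lp l2).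
move: t; apply: (tens_ext (lin_comp lp (tmul_linear l1 l2)) (tmul_linear l1' l2')).
by move=> a b; rewrite !tmul_tens // cdgaMor_mul.
Qed.

Lemma conv_mor (psi : C -> X) t : linear psi ->
  p (conv psi t) = conv (fun c => p (psi c)) t.
Proof.
move=> l; rewrite /conv tmul_mor //; last exact: (lin_comp (@parity_linear K X) l).
by congr (tmul _ _ t); apply/funext => c; rewrite parity_mor.
Qed.

Lemma degree1_mor (psi : C -> X) : degree1 psi -> degree1 (fun c => p (psi c)).
Proof.
move=> [l h]; split; first exact: (lin_comp lp l).
by move=> n c hc; apply: chain_homog; apply: h.
Qed.

Lemma twisting_mor (psi : C -> X) : twisting psi -> twisting (fun c => p (psi c)).
Proof.
move=> [d mc]; split=> [|c]; first exact: degree1_mor.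
rewrite /curv -(conv_mor _ (proj1 d)) -(chain_diff p) -(linD lp) -(linZ lp).
by rewrite -(linN lp) -(linD lp) -/(curv psi c) mc (lin0 lp).
Qed.

Lemma ext_mor (psi : C -> X) a : degree1 psi ->
  p (ext psi a) = ext (fun c => p (psi c)) a.
Proof.
move=> d; apply: (@ext_uniq K C Y _ (degree1_mor d) (fun a => p (ext psi a))).
- exact: (lin_comp lp (ext_linear d)).
- by move=> u v; rewrite (ext_smul d) cdgaMor_mul.
- by move=> c; rewrite (ext_word d).
Qed.
End Morphisms.

Section ProductProjections.
Variables (K : fieldType) (X Y : cdga K).
Lemma fst_homog n (x : product X Y) : homog n x -> homog n x.1.
Proof. by move=> /gprod_homogP[]. Qed.
Lemma snd_homog n (x : product X Y) : homog n x -> homog n x.2.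
Proof. by move=> /gprod_homogP[]. Qed.
Definition prod_fst : cdgaMor (product X Y) X :=
  @CdgaMor K (product X Y) X (@ChainMap K (product X Y) X fst
    (@lin_fst K X Y) fst_homog (fun=> erefl)) (fun _ _ => erefl).
Definition prod_snd : cdgaMor (product X Y) Y :=
  @CdgaMor K (product X Y) Y (@ChainMap K (product X Y) Y snd
    (@lin_snd K X Y) snd_homog (fun=> erefl)) (fun _ _ => erefl).
End ProductProjections.

(** * Collapsing a tensor factor by a linear form *)

Section Collapse.
Variables (K : fieldType) (A B : cdga K).

Lemma scal_mor0 (X : cdga K) (p : cdgaMor X (scalars K)) n x :
  homog n x -> n != 0 -> p x = 0.
Proof. by move=> hx; have /conc_homogP := chain_homog p hx. Qed.

Lemma scale_bilin (V W : lmodType K) (p : V -> K^o) :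
  linear p -> bilin (fun v (w : W) => p v *: w).
Proof.
move=> lp; split=> [w|v] a x y; first by rewrite lp scalerDl scalerA.
by rewrite scalerDr !scalerA mulrC.
Qed.
Lemma scale_bilinr (V W : lmodType K) (p : W -> K^o) :
  linear p -> bilin (fun (v : V) w => p w *: v).
Proof.
move=> lp; split=> [w|v] a x y; last by rewrite lp scalerDl scalerA.
by rewrite scalerDr !scalerA mulrC.
Qed.

(** Only a linear form is asked of p: besides evaluation at a point, which is an algebra map, this
    also serves for integration over the interval. *)
Definition lcollapse (V W : lmodType K) (p : V -> K^o) : tensor V W -> W :=
  tlift (fun v w => p v *: w).
Definition rcollapse (V W : lmodType K) (p : W -> K^o) : tensor V W -> V :=
  tlift (fun v w => p w *: v).

Section Left.
Variable p : cdgaMor A (scalars K).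
Let lp : linear (p : A -> K^o) := chain_linear p.
Let L : linear (@lcollapse A B p) := tlift_linear (scale_bilin B lp).
Lemma lcollapseE (a : A) (b : B) : lcollapse p (tens a b) = p a *: b.
Proof. by rewrite /lcollapse (tlift_tens _ _ (scale_bilin B lp)). Qed.

Lemma lcollapse_homog n (t : gtensor A B) : homog n t -> homog n (lcollapse p t).
Proof.
move: t; apply: (gtensor_ext (lin_comp (@gproj_linear K B n) L) L).
move=> i j a b <- ha hb; rewrite lcollapseE.
have [->|hi] := eqVneq i 0; first by rewrite add0r (linZ (@gproj_linear K B _)) hb.
by rewrite (scal_mor0 p ha hi) scale0r (lin0 (@gproj_linear K B _)).
Qed.
Lemma lcollapse_diff (t : ctensor A B) : lcollapse p (tens_diff t) = cdiff (lcollapse p t).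
Proof.
move: t; apply: (tens_homog_ext (lin_comp L (@tens_diff_linear K A B))
  (lin_comp (@cdiff_linear K B) L)) => i j a b ha hb.
rewrite (tens_diff_tens _ ha) (linD L) (linZ L) !lcollapseE (linZ (@cdiff_linear K B)).
rewrite (chain_diff p) scale0r add0r.
have [->|hi] := eqVneq i 0; first by rewrite sgnE expr0 scale1r.
by rewrite (scal_mor0 p ha hi) !scale0r scaler0.
Qed.
Lemma lcollapse_mul (t t' : tens_cdga A B) :
  lcollapse p (cmul t t') = cmul (lcollapse p t) (lcollapse p t').
Proof.
have [m1 m2] := tens_mul_bilin A B; have [n1 n2] := cmul_bilin B.
move: t; apply: (tens_homog_ext (lin_comp L (m1 _)) (lin_comp (n1 _) L)).
move=> i j a b ha hb; move: t'.
apply: (tens_homog_ext (lin_comp L (m2 _)) (lin_comp (n2 _) L)).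
move=> i' j' a' b' ha' hb'; rewrite (tens_mul_tens _ _ hb ha') (linZ L) !lcollapseE.
rewrite (linZ (n1 _)) (linZ (n2 _)) cdgaMor_mul.
rewrite -[p a' *: _ in RHS]/(p a' *: _) !scalerA.
have [->|hi] := eqVneq i' 0; first by rewrite mulr0 sgnE expr0 mul1r.
by rewrite (scal_mor0 p ha' hi) /= !mulr0.
Qed.
Definition lcollapse_mor : cdgaMor (tens_cdga A B) B :=
  @CdgaMor K (tens_cdga A B) B (@ChainMap K (tens_cdga A B) B _ L
    lcollapse_homog lcollapse_diff) lcollapse_mul.
End Left.

Section Right.
Variable p : cdgaMor B (scalars K).
Let lp : linear (p : B -> K^o) := chain_linear p.
Let L : linear (@rcollapse A B p) := tlift_linear (scale_bilinr A lp).
Lemma rcollapseE (a : A) (b : B) : rcollapse p (tens a b) = p b *: a.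
Proof. by rewrite /rcollapse (tlift_tens _ _ (scale_bilinr A lp)). Qed.

Lemma rcollapse_homog n (t : gtensor A B) : homog n t -> homog n (rcollapse p t).
Proof.
move: t; apply: (gtensor_ext (lin_comp (@gproj_linear K A n) L) L).
move=> i j a b <- ha hb; rewrite rcollapseE.
have [->|hj] := eqVneq j 0; first by rewrite addr0 (linZ (@gproj_linear K A _)) ha.
by rewrite (scal_mor0 p hb hj) scale0r (lin0 (@gproj_linear K A _)).
Qed.
Lemma rcollapse_diff (t : ctensor A B) : rcollapse p (tens_diff t) = cdiff (rcollapse p t).
Proof.
move: t; apply: (tens_homog_ext (lin_comp L (@tens_diff_linear K A B))
  (lin_comp (@cdiff_linear K A) L)) => i j a b ha hb.
rewrite (tens_diff_tens _ ha) (linD L) (linZ L) !rcollapseE (linZ (@cdiff_linear K A)).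
by rewrite (chain_diff p) scale0r scaler0 addr0.
Qed.
Lemma rcollapse_mul (t t' : tens_cdga A B) :
  rcollapse p (cmul t t') = cmul (rcollapse p t) (rcollapse p t').
Proof.
have [m1 m2] := tens_mul_bilin A B; have [n1 n2] := cmul_bilin A.
move: t; apply: (tens_homog_ext (lin_comp L (m1 _)) (lin_comp (n1 _) L)).
move=> i j a b ha hb; move: t'.
apply: (tens_homog_ext (lin_comp L (m2 _)) (lin_comp (n2 _) L)).
move=> i' j' a' b' ha' hb'; rewrite (tens_mul_tens _ _ hb ha') (linZ L) !rcollapseE.
rewrite (linZ (n1 _)) (linZ (n2 _)) cdgaMor_mul !scalerA.
have [->|hj] := eqVneq j 0; first by rewrite mul0r sgnE expr0 mul1r.
by rewrite (scal_mor0 p hb hj) /= !mul0r !mulr0.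
Qed.
Definition rcollapse_mor : cdgaMor (tens_cdga A B) A :=
  @CdgaMor K (tens_cdga A B) A (@ChainMap K (tens_cdga A B) A _ L
    rcollapse_homog rcollapse_diff) rcollapse_mul.
End Right.
End Collapse.

(** * Dupont's contraction of K[t,dt] *)

Section IntervalForms.
Variables (K : fieldType) (charK : [pchar K] =i pred0).
Local Notation F := (forms K).

Lemma natS_neq0 n : n.+1%:R != 0 :> K.
Proof. by rewrite ((pcharf0P _).1 charK). Qed.

Definition antideriv (g : {poly K}) : {poly K} :=
  \poly_(i < (size g).+1) (if i is j.+1 then g`_j / j.+1%:R else 0).

Lemma coef_antideriv g i :
  (antideriv g)`_i = if i is j.+1 then g`_j / j.+1%:R else 0.
Proof.
rewrite coef_poly ltnS; case: ltnP => //; case: i => // i hi.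
by rewrite nth_default ?mul0r // -ltnS.
Qed.
Lemma antideriv_linear : linear antideriv.
Proof.
move=> a f g; apply/polyP => -[|i]; rewrite coefD coefZ !coef_antideriv.
  by rewrite mulr0 addr0.
by rewrite coefD coefZ mulrDl mulrA.
Qed.
Lemma antiderivK g : (antideriv g)^`() = g.
Proof.
apply/polyP => i; rewrite coef_deriv coef_antideriv -(mulr_natr (_ / _)) divfK //.
exact: natS_neq0.
Qed.
Lemma derivK f : antideriv f^`() = f - f.[0]%:P.
Proof.
apply/polyP => -[|i]; rewrite coef_antideriv coefB coefC ?horner_coef0 ?subrr //=.
by rewrite coef_deriv subr0 -(mulr_natr f`_i.+1) mulfK // natS_neq0.
Qed.
Lemma antideriv0 g : (antideriv g).[0] = 0.
Proof. by rewrite horner_coef0 coef_antideriv. Qed.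

Definition form_ev (a : K) (w : F) : scalars K := w.1.[a].
Definition form_int (w : F) : K^o := (antideriv w.2).[1].
(** The primitive starting at 0, corrected by t times the integral so as to vanish at t = 1 as
    well. *)
Definition dupont (w : F) : F := (antideriv w.2 - form_int w *: 'X, 0).
(** In characteristic 0 its vanishing says that the dt coefficient is constant. Being a linear map,
    it carries this condition over to tensor products. *)
Definition dt_deriv (w : F) : {poly K} := w.2^`().
(** Together with [form1] and [form_dt] this spans the Whitney forms of the interval, a subcomplex
    but not a subalgebra. *)
Definition form0 : F := (1 - 'X, 0).
Definition form1 : F := ('X, 0).
Definition form_dt : F := (0, 1).

Lemma form_ev_linear a : linear (form_ev a).
Proof. by move=> k x y; rewrite /form_ev /= hornerD hornerZ. Qed.
Lemma form_ev_homog a n w : homog n w -> homog n (form_ev a w).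
Proof.
move=> /form_homogP[h _]; apply/conc_homogP => /h e.
by rewrite /form_ev e horner0.
Qed.
Lemma form_ev_diff a w : form_ev a (cdiff w) = cdiff (form_ev a w).
Proof. by rewrite /form_ev /= horner0. Qed.
Lemma form_ev_mul a w w' :
  form_ev a (cmul w w') = cmul (form_ev a w) (form_ev a w').
Proof. exact: hornerM. Qed.
Definition ev_mor a : cdgaMor F (scalars K) :=
  @CdgaMor K F (scalars K) (@ChainMap K F (scalars K) _ (form_ev_linear a)
    (form_ev_homog a) (form_ev_diff a)) (form_ev_mul a).

Definition form_const (x : scalars K) : F := (x%:P, 0).
Lemma form_const_linear : linear form_const.
Proof.
move=> k x y; congr pair; last by rewrite /= scaler0 addr0.
by rewrite -[RHS]/(k *: x%:P + y%:P) -mul_polyC -polyCM -polyCD.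
Qed.
Lemma form_const_homog n x : homog n x -> homog n (form_const x).
Proof.
move=> /conc_homogP h; apply/form_homogP; split=> //= hn.
by rewrite h.
Qed.
Lemma form_const_diff x : form_const (cdiff x) = cdiff (form_const x).
Proof. by congr pair; rewrite /= ?derivC // . Qed.
Lemma form_const_mul x y :
  form_const (cmul x y) = cmul (form_const x) (form_const y).
Proof. by congr pair; rewrite /= ?polyCM // mul0r mulr0 addr0. Qed.
Definition const_mor : cdgaMor (scalars K) F :=
  @CdgaMor K (scalars K) F (@ChainMap K (scalars K) F _ form_const_linear
    form_const_homog form_const_diff) form_const_mul.

Lemma form_int_linear : linear form_int.
Proof. by move=> k x y; rewrite /form_int antideriv_linear hornerD hornerZ. Qed.
Lemma dupont_linear : linear dupont.
Proof.
apply: lin_pair; last exact: lin_zero.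
apply: lin_add; first exact: (lin_comp antideriv_linear (@lin_snd K _ _)).
apply: lin_opp => k x y; rewrite form_int_linear scalerDl.
by rewrite -[k *: form_int x]/(k * form_int x) scalerA.
Qed.
Lemma dt_deriv_linear : linear dt_deriv.
Proof. by move=> k x y; rewrite /dt_deriv derivD derivZ. Qed.
Lemma dupont_homog n w : homog n w -> homog (n - 1) (dupont w).
Proof.
move=> /form_homogP[_ h]; apply/form_homogP; split=> //= hn.
have e : w.2 = 0 by apply: h; rewrite -subr_eq0.
by rewrite /form_int e !(lin0 antideriv_linear) horner0 scale0r subr0.
Qed.
Lemma form_int_homog n w : homog n w -> n != 1 -> form_int w = 0.
Proof.
by move=> /form_homogP[_ h] /h; rewrite /form_int => ->;
  rewrite (lin0 antideriv_linear) horner0.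
Qed.

Lemma homog_form1 : homog 0 form1. Proof. exact/form_homogP. Qed.
Lemma homog_form0 : homog 0 form0. Proof. exact/form_homogP. Qed.
Lemma homog_dt : homog 1 form_dt. Proof. exact/form_homogP. Qed.
Lemma form0_diff : cdiff form0 = - form_dt.
Proof. by congr pair; rewrite /= ?oppr0 // derivB derivX derivC sub0r. Qed.
Lemma form_dt_diff : cdiff form_dt = 0.
Proof. by congr pair; rewrite /= derivC. Qed.
Lemma ev_form0 : (form_ev 0 form0 = 1) * (form_ev 1 form0 = 0).
Proof. by rewrite /form_ev /= !(hornerE, subr0, subrr). Qed.
Lemma ev_form1 : (form_ev 0 form1 = 0) * (form_ev 1 form1 = 1).
Proof. by rewrite /form_ev /= !hornerE. Qed.
Lemma ev_dt a : form_ev a form_dt = 0.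
Proof. by rewrite /form_ev /= horner0. Qed.
Lemma ev_dupont w : (form_ev 0 (dupont w) = 0) * (form_ev 1 (dupont w) = 0).
Proof.
by rewrite /form_ev /= !hornerE antideriv0 /form_int ?mulr0 ?mulr1 !subrr.
Qed.
Lemma dt_deriv_dupont w : dt_deriv (dupont w) = 0.
Proof. by rewrite /dt_deriv /= derivC. Qed.

(** The subtracted term is the Whitney form with the same end values and the same integral as w;
    both components are the fundamental theorem of calculus. *)
Lemma dupontK w : cdiff (dupont w) + dupont (cdiff w) =
  w - (form_ev 0 w *: form0 + form_ev 1 w *: form1 + form_int w *: form_dt).
Proof.
case: w => f g; rewrite /dupont /form_int /form_ev /=.
rewrite derivK.
set c := (antideriv g).[1].
rewrite -[LHS]/(0 + (f - f.[0]%:P - ((f - f.[0]%:P).[1] *: 'X)),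
   (antideriv g - c *: 'X)^`() + 0).
rewrite -[RHS]/(f - (f.[0] *: (1 - 'X) + f.[1] *: 'X + c *: 0),
   g - (f.[0] *: 0 + f.[1] *: 0 + c *: 1)).
rewrite derivB derivZ derivX antiderivK !scaler0 !addr0 !add0r; congr pair.
rewrite hornerD hornerN hornerC -!mul_polyC !rmorphD !rmorphN /=.
by ring.
Qed.
Lemma form_int_diff w : form_int (cdiff w) = form_ev 1 w - form_ev 0 w.
Proof. by rewrite /form_int /form_ev /= derivK hornerD hornerN hornerC. Qed.
End IntervalForms.

Section FormsTensor.
Variables (K : fieldType) (charK : [pchar K] =i pred0) (B : cdga K).
Local Notation F := (forms K).
Local Notation FB := (tens_cdga F B).

Definition tev a : cdgaMor FB B := lcollapse_mor B (ev_mor a).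
Definition tdupont : tensor F B -> tensor F B := tmap (@dupont K) id.
Definition tint : tensor F B -> B := lcollapse (@form_int K).
Definition tdt_deriv : tensor F B -> tensor {poly K} B := tmap (@dt_deriv K) id.

Let ld : linear (@dupont K) := @dupont_linear K.
Let li : linear (@form_int K) := @form_int_linear K.
Let l1 : linear (@id B) := @lin_id K B.
Let D := @tens_diff_linear K F B.
Let t1 := proj1 (tens_bilin F B).
Let t2 := proj2 (tens_bilin F B).

Lemma tevE a (w : F) b : tev a (tens w b) = form_ev a w *: b.
Proof. exact: (@lcollapseE K F B (ev_mor a)). Qed.
Lemma tdupontE w b : tdupont (tens w b) = tens (dupont w) b.
Proof. exact: tmap_tens. Qed.
Lemma tintE w b : tint (tens w b) = form_int w *: b.
Proof. by rewrite /tint /lcollapse (tlift_tens _ _ (scale_bilin B li)). Qed.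
Lemma tdt_derivE w b : tdt_deriv (tens w b) = tens (dt_deriv w) b.
Proof. by apply: tmap_tens => //; exact: dt_deriv_linear. Qed.
Lemma tev_linear a : linear (tev a). Proof. exact: chain_linear. Qed.
Lemma tdupont_linear : linear tdupont. Proof. exact: tmap_linear. Qed.
Lemma tint_linear : linear tint.
Proof. exact: (tlift_linear (scale_bilin B li)). Qed.
Lemma tdt_deriv_linear : linear tdt_deriv.
Proof. by apply: tmap_linear => //; exact: dt_deriv_linear. Qed.

Lemma tdupont_homog n (t : FB) : homog n t -> @homog K FB (n - 1) (tdupont t).
Proof.
have L := @tens_proj_linear K F B (n - 1); have T := tdupont_linear.
move: t; apply: (gtensor_ext (lin_comp L T) T) => p q w b <- hw hb.
rewrite tdupontE addrAC; apply: (@homog_tens K F B) => //.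
exact: dupont_homog.
Qed.

Lemma tint_homog n (t : FB) : homog n t -> homog (n - 1) (tint t).
Proof.
have L := @gproj_linear K B (n - 1); have T := tint_linear.
move: t; apply: (gtensor_ext (lin_comp L T) T) => p q w b <- hw hb.
rewrite tintE; have [->|hp] := eqVneq p 1.
  by apply: homogZ; rewrite addrAC subrr add0r.
by rewrite (form_int_homog hw hp) scale0r (lin0 (@gproj_linear K B _)).
Qed.

Lemma tdupontK t : tens_diff (tdupont t) + tdupont (tens_diff t) =
  t - (tens (form0 K) (tev 0 t) + tens (form1 K) (tev 1 t) + tens (form_dt K) (tint t)).
Proof.
have T := tdupont_linear; have lt a := tev_linear a.
move: t; apply: (tens_homog_ext (lin_add (lin_comp D T) (lin_comp T D))
  (lin_add (@lin_id K _) (lin_opp (lin_add (lin_add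
    (lin_comp (t2 (form0 K)) (lt 0)) (lin_comp (t2 (form1 K)) (lt 1)))
    (lin_comp (t2 (form_dt K)) tint_linear))))).
move=> p q w b hw hb; rewrite (tens_diff_tens _ hw) tdupontE (linD T) (linZ T).
rewrite !tdupontE (tens_diff_tens _ (dupont_homog hw)).
have -> : sgn K (p - 1) = - sgn K p.
  by rewrite -{2}[p](subrK 1) sgn_add1 opprK.
rewrite scaleNr addrACA addNr addr0 -(linD (t1 _)) dupontK //.
rewrite !tevE tintE !(linZ (t2 _)) -!(linZ (t1 _)).
by rewrite (linD (t1 _)) (linN (t1 _)) !(linD (t1 _)).
Qed.

(** Stokes' formula on the interval, with the last sign coming from moving d past dt. It makes
    [tint] a chain homotopy between the two end evaluations. *)
Lemma tint_diff t :
  tint (tens_diff t) = tev 1 t - tev 0 t - cdiff (tint t).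
Proof.
have T := tint_linear; have lB := @cdiff_linear K B.
move: t; apply: (tens_homog_ext (lin_comp T D) (lin_add (lin_add (tev_linear 1)
  (lin_opp (tev_linear 0))) (lin_opp (lin_comp lB T)))).
move=> p q w b hw hb; rewrite (tens_diff_tens _ hw) (linD T) (linZ T) !tintE.
rewrite !tevE form_int_diff // scalerDl scaleNr (linZ lB); congr (_ + _).
have [->|hp] := eqVneq p 1; first by rewrite sgnE expr1 scaleN1r.
by rewrite (form_int_homog hw hp) !scale0r scaler0 oppr0.
Qed.

Lemma tev_dupont t : (tev 0 (tdupont t) = 0) * (tev 1 (tdupont t) = 0).
Proof.
have T := tdupont_linear; have lt a := tev_linear a.
split; move: t; apply: (tens_ext (lin_comp (lt _) T) (@lin_zero K _ _)) => w b;
  by rewrite tdupontE tevE ev_dupont scale0r.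
Qed.

Lemma tdt_deriv_dupont t : tdt_deriv (tdupont t) = 0.
Proof.
move: t; apply: (tens_ext (lin_comp tdt_deriv_linear tdupont_linear)
  (@lin_zero K _ _)) => w b.
rewrite tdupontE tdt_derivE dt_deriv_dupont.
exact: (lin0 (proj1 (tens_bilin {poly K} B) b)).
Qed.
End FormsTensor.

(** * Rectification along a quasi-isomorphism *)

Section Cone.
Variables (K : fieldType) (A B : complex K) (F : chain_map A B).
Local Notation P := (gprod A (gshift B)).
Let lF : linear F := chain_linear F.
Let lA := @cdiff_linear K A.
Let lB := @cdiff_linear K B.

(** The signs are dictated by Stokes' formula: for a form b on the interval with b(0) = F a and b(1)
    = 0, passing from (a, b) to (a, [tint] b) commutes with the differentials. *)
Definition cone_diff (x : P) : P := (cdiff x.1, - F x.1 - cdiff x.2).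
Lemma cone_diff_linear : linear cone_diff.
Proof.
apply: lin_pair; first exact: (lin_comp lA (@lin_fst K A B)).
apply: lin_add; apply: lin_opp; first exact: (lin_comp lF (@lin_fst K A B)).
exact: (lin_comp lB (@lin_snd K A B)).
Qed.
Lemma cone_diff_homog n x : @homog K P n x -> @homog K P (n + 1) (cone_diff x).
Proof.
move=> /gprod_homogP[h1 /homog_unshift h2]; apply/gprod_homogP; split => /=.
  exact: cdiff_homog.
apply: (homog_shift (V := B)); apply: homogD; apply: homogN.
  exact: chain_homog.
by have := cdiff_homog h2; rewrite subrK.
Qed.
Lemma cone_diffK x : cone_diff (cone_diff x) = 0.
Proof.
rewrite /cone_diff /= cdiffK (linD lB) !(linN lB) cdiffK (chain_diff F).
by rewrite subr0 opprK addNr.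
Qed.
Definition cone := Cplx cone_diff_linear cone_diff_homog cone_diffK.

(** For a cocycle (a, b), F a = - d b is exact, so a = d u by injectivity on cohomology. Then F u +
    b is a cocycle, equal to F v + d w by surjectivity, and (u - v, - w) is a primitive. *)
Lemma cone_acyclic : quasi_isomorphism F -> acyclic cone.
Proof.
move=> qF n [a b] /gprod_homogP[/= ha /homog_unshift hb] e.
have [da eb] : cdiff a = 0 /\ - F a - cdiff b = 0 by case: e.
have [qi _] := qF n; have [_ qs] := qF (n - 1).
have [|u hu eu] := qi a ha da.
  exists (- b); first exact: homogN.
  by rewrite (linN lB); apply/eqP; rewrite -subr_eq0 opprK -oppr_eq0 opprD eb.
have [|| v [hv dv] [w hw ew]] := qs (F u + b).
- by apply: homogD => //; exact: chain_homog.
- rewrite (linD lB) -(chain_diff F) -eu; apply/eqP.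
  by rewrite -oppr_eq0 opprD eb.
exists (u - v, - w).
  apply/gprod_homogP; split; last exact: homogN.
  by apply: homogD => //; apply: homogN.
congr pair => /=; first by rewrite (linD lA) (linN lA) dv subr0.
rewrite (linN lB) opprK (linD lF) (linN lF) opprD opprK -addrA -ew addrA addNr.
by rewrite add0r.
Qed.
End Cone.

Section Rectification.
Variables (K : fieldType) (charK : [pchar K] =i pred0).
Variables (A B : cdga K) (f : cdgaMor A B).
Hypothesis qf : quasi_isomorphism f.
Variables (C : lieCoalg K) (psi : C -> B).
Hypothesis tw : twisting psi.
Local Notation F := (forms K).
Local Notation FB := (tens_cdga F B).

(* H lifts psi along the path fibration A x_B B[t,dt] -> B, (a, b) |-> b(1).
   The kernel of the latter retracts, by the Dupont homotopy, onto the cone of f;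
   the resulting contraction only produces forms whose dt part is constant. *)
Lemma rectification : exists (G : C -> A) (H : C -> FB),
  [/\ twisting G, twisting H, forall c, tev B 0 (H c) = f (G c),
      forall c, tev B 1 (H c) = psi c & forall c, tdt_deriv (H c) = 0].
Proof.
have [h' [lh' hh' hK']] := acyclic_contraction (cone_acyclic qf).
have lf := chain_linear f; have [dpsi mc] := tw; have [lpsi hpsi] := dpsi.
have [t1 t2] := tens_bilin F B; have lP x := chain_linear (tev B x).
pose P := product A FB.
(* Integration over the interval, a chain map to the cone on [I], followed by the contraction of the
   cone. *)
pose r (x : P) : A * B := h' (x.1, tint x.2).
have lr : linear r.
  apply: (lin_comp lh'); apply: (@lin_pair K A B P); first exact: lin_fst.
  exact: (lin_comp (@tint_linear K B) (@lin_snd K _ _)).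
have lr1 : linear (fun x => (r x).1) by move=> a x y; rewrite lr.
have lr2 : linear (fun x => (r x).2) by move=> a x y; rewrite lr.
(* The cone includes into [I] by sending (u, v) to (u, (1 - t) f u + dt v). Here this inclusion is
   applied to [r x] and Dupont's homotopy is added; the latter vanishes at both ends, so the values
   lie in [I] for every x. *)
pose h (x : P) : P := ((r x).1, tdupont x.2 + tens (form0 K) (f (r x).1)
  + tens (form_dt K) (r x).2).
(* The straight path t psi from 0 = f 0 to psi: it has the right value at t = 1 and no dt part. *)
pose psi0 c : P := (0, tens (form1 K) (psi c)).
pose I (x : P) := tev B 0 x.2 = f x.1 /\ tev B 1 x.2 = 0.
have lh : linear h.
  apply: (@lin_pair K A (tensor F B) P) => //; apply: lin_add.
    apply: lin_add; first exact: (lin_comp (@tdupont_linear K B) (@lin_snd K _ _)).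
    exact: (lin_comp (t2 _) (lin_comp lf lr1)).
  exact: (lin_comp (t2 _) lr2).
have hr n x : homog n x -> homog (n - 1) (r x).1 /\ homog (n - 1 - 1) (r x).2.
  move=> /gprod_homogP[h1 h2].
  have /hh' /gprod_homogP[h3 h4] : @homog K (cone f) n (x.1, tint x.2).
    by apply/gprod_homogP; split=> //=; apply: (tint_homog h2).
  by split.
have evt1 b : (tev B 0 (tens (form1 K) b) = 0) * (tev B 1 (tens (form1 K) b) = b).
  by split; rewrite tevE ev_form1 ?scale0r ?scale1r.
have evt0 b : (tev B 0 (tens (form0 K) b) = b) * (tev B 1 (tens (form0 K) b) = 0).
  by split; rewrite tevE ev_form0 ?scale0r ?scale1r.
have evdt x b : tev B x (tens (form_dt K) b) = 0 by rewrite tevE ev_dt scale0r.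
have hI x : tev B 0 (h x).2 = f (h x).1 /\ tev B 1 (h x).2 = 0.
  rewrite -[(h x).2]/(_ + _ + _) !(linD (lP _)) !tev_dupont !evt0 !evdt.
  by rewrite add0r !addr0.
have tZ (w : F) (b : B) : dt_deriv w = 0 -> tdt_deriv (tens w b) = 0.
  move=> hw; rewrite tdt_derivE hw.
  exact: (lin0 (proj1 (tens_bilin {poly K} B) b)).
have lt := @tdt_deriv_linear K B.
have hdt x : tdt_deriv (h x).2 = 0.
  rewrite -[(h x).2]/(_ + _ + _) !(linD lt) tdt_deriv_dupont !tZ ?/dt_deriv /= ?derivC //.
  by rewrite !addr0.
have dpsi0 : degree1 psi0.
  split=> [|n c hc]; first by apply: (@lin_pair K A (tensor F B) C);
    [exact: lin_zero | exact: (lin_comp (t2 _) lpsi)].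
  apply/gprod_homogP; split; first exact: homog0.
  rewrite -[n + 1]add0r; apply: (@homog_tens K F B); first exact: homog_form1.
  exact: hpsi.
have [||||||Psi [[dPsi mcPsi] fixP]] :=
    @deformation K charK C P psi0 I h dpsi0 _ _ lh.
- by split; rewrite ?(lin0 (lP _)) ?(lin0 lf).
- move=> a x y [x0 x1] [y0 y1]; split;
    rewrite -?[(_ + _).1]/(a *: x.1 + y.1) -[(_ + _).2]/(a *: x.2 + y.2);
    rewrite lP ?x0 ?y0 ?x1 ?y1 ?lf //.
  by rewrite scaler0 addr0.
- move=> n x hx; have [h1 h2] := hr n x hx; have [h3 h4] := (gprod_homogP _ _).1 hx.
  apply/gprod_homogP; split=> //=; apply: homogD; last first.
    have -> : n - 1 = 1 + (n - 1 - 1) by rewrite [RHS]addrC subrK.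
    exact: (@homog_tens K F B _ _ _ _ (homog_dt K) h2).
  apply: homogD; first exact: (tdupont_homog h4).
  rewrite -[n - 1]add0r; apply: (@homog_tens K F B); first exact: homog_form0.
  exact: (chain_homog f).
- by move=> x _; exact: hI.
- case=> a b [x0 x1]; have {}x0 : tev B 0 b = f a := x0.
  have {}x1 : tev B 1 b = 0 := x1.
  rewrite -[LHS]/(cdiff (h (a, b)).1 + (h (cdiff a, tens_diff b)).1,
    tens_diff (h (a, b)).2 + (h (cdiff a, tens_diff b)).2).
  have Er : cone_diff f (r (a, b)) + r (cdiff a, tens_diff b) = (a, tint b).
    rewrite -[RHS](hK' (a, tint b) : _ = (a, tint b) :> cone f) /r /=.
    congr (_ + h' (_, _)); rewrite (tint_diff charK) x0 x1 /=.
    by rewrite sub0r.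
  move: Er; rewrite /h /=; case: (r (a, b)) => u v; case: (r _) => u' v' [E1 E2].
  congr pair; first exact: E1.
  have Dl := @tens_diff_linear K F B.
  rewrite !(linD Dl) (tens_diff_tens _ (homog_form0 K)) (tens_diff_tens _ (homog_dt K)).
  rewrite form0_diff form_dt_diff (lin0 (t1 _)) (linN (t1 _)) add0r.
  rewrite sgnE expr0 scale1r sgnE expr1 scaleN1r.
  rewrite -(chain_diff f).
  move: (tdupontK charK b); rewrite x0 x1 (lin0 (t2 _)) addr0.
  have -> : f a = f (cdiff u) + f u' by rewrite -(linD lf) -E1.
  rewrite -E2 /= !(linD (t2 _)) !(linN (t2 _)).
  move: (tens_diff (tdupont b)) (tdupont (tens_diff b)) => Z1 Z2.
  rewrite !addrA => EZ.
  by rewrite [LHS](ACl (1*5*(3*6*2*4*7))) /= EZ subrK.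
(* At t = 1 the residue becomes the curvature of [psi], which is 0. At t = 0 the terms from [psi0]
   vanish, and the remaining quadratic terms match because f is multiplicative. *)
- move=> psi' dpsi' Ipsi' c; have lpsi' := proj1 dpsi'.
  pose g c := (psi' c).1; pose H c : FB := (psi' c).2.
  have [I0 I1] : (forall c, tev B 0 (H c) = f (g c)) /\
      forall c, tev B 1 (H c) = psi c.
    split=> c'; have [i0 i1] := Ipsi' c'.
      move: i0; rewrite -[(_ - _).1]/(g c' - 0) -[(_ - _).2]/(H c' - tens _ _).
      by rewrite (linD (lP _)) (linN (lP _)) evt1 !subr0.
    move: i1; rewrite -[(_ - _).2]/(H c' - tens _ _).
    by rewrite (linD (lP _)) (linN (lP _)) evt1 => /eqP; rewrite subr_eq0 => /eqP.
  have E1 : (residue psi0 psi' c).1 = - (2^-1 *: conv g (cobracket c)).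
    rewrite -[LHS]/(cdiff 0 + 0 - 2^-1 *: prod_fst A FB (conv psi' (cobracket c))).
    rewrite (lin0 (@cdiff_linear K A)) !add0r; congr (- (_ *: _)).
    exact: (conv_mor (prod_fst A FB)).
  have E2 : (residue psi0 psi' c).2 = tens_diff (tens (form1 K) (psi c)) +
      tens (form1 K) (psi (cdiff c)) - 2^-1 *: (conv H (cobracket c) : FB).
    rewrite -[LHS]/(_ + _ - 2^-1 *: prod_snd A FB (conv psi' (cobracket c))).
    congr (_ + _ - _ *: _); exact: (conv_mor (prod_snd A FB)).
  have lH : linear H by exact: (lin_comp (@lin_snd K _ _) lpsi').
  have lg : linear g by exact: (lin_comp (@lin_fst K _ _) lpsi').
  split.
    rewrite E1 E2 (linD (lP _)) (linN (lP _)) (linD (lP _)) (linZ (lP _)) evt1.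
    rewrite (chain_diff (tev B 0)) evt1 (lin0 (@cdiff_linear K B)) !add0r.
    rewrite (conv_mor (tev B 0) _ lH) (linN lf) (linZ lf) (conv_mor f _ lg).
    by congr (- (_ *: conv _ _)); apply/funext => c'.
  rewrite E2 (linD (lP _)) (linN (lP _)) (linD (lP _)) (linZ (lP _)) evt1.
  rewrite (chain_diff (tev B 1)) evt1 (conv_mor (tev B 1) _ lH).
  have -> : (fun c => tev B 1 (H c)) = psi by apply/funext => c'.
  exact: mc.
exists (fun c => (Psi c).1), (fun c => (Psi c).2); split.
- exact: (twisting_mor (prod_fst A FB)).
- exact: (twisting_mor (prod_snd A FB)).
- move=> c; have [-> _] := fixP c; move: (residue _ _ _) => x; have [h0 _] := hI x.
  rewrite -[(_ - _).1]/(0 - (h x).1) -[(_ - _).2]/(tens (form1 K) (psi c) - (h x).2).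
  by rewrite (linD (lP _)) (linN (lP _)) evt1 h0 !sub0r (linN lf).
- move=> c; have [-> _] := fixP c; move: (residue _ _ _) => x; have [_ h1] := hI x.
  rewrite -[(_ - _).2]/(tens (form1 K) (psi c) - (h x).2).
  by rewrite (linD (lP _)) (linN (lP _)) evt1 h1 subr0.
(* The path t psi has no dt part, and every value of [h] has a constant one. *)
- move=> c; have [-> _] := fixP c; move: (residue _ _ _) => x.
  rewrite -[(_ - _).2]/(tens (form1 K) (psi c) - (h x).2).
  by rewrite (linD lt) (linN lt) hdt subr0 tZ // /dt_deriv /= derivC.
Qed.
End Rectification.

(** * Gauge equivalence and paths *)

Section GaugePaths.
Variables (K : fieldType) (charK : [pchar K] =i pred0) (C : lieCoalg K).
Local Notation F := (forms K).
Local Notation G := (dual C).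
Local Notation SK := (scalars K).

Definition scal_map (x : G) : C -> SK := fun c => (x : gdual C) c.

Lemma gdual_exists (u : C -> K^o) n : linear u ->
  (forall m c, m != - n -> homog m c -> u c = 0) ->
  exists x : G, homog n x /\ forall c, (x : gdual C) c = u c.
Proof.
move=> lu hu; have hin : u \in @gdual_pred K C.
  apply: gdual_in => //; exists [:: - n] => m c; rewrite inE => hm hc.
  exact: hu hc.
by exists (GDual hin : G); split=> //; apply/dual_homogP.
Qed.

(** The sign conventions agree: x lives on degree -1, so d x matters only in degree -2, where
    [dual_diff] has sign +1, while the bracket of two elements of degree 1 carries the sign -1 found
    in [curv]. *)
Lemma twisting_MC (x : G) :
  is_MC x <-> twisting (scal_map x).
Proof.
have lx := gdual_linear (x : gdual C).
have hdeg : homog 1 x <-> degree1 (scal_map x).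
  rewrite dual_homogP; split=> [h|[_ h] m c hm hc].
    split=> // n c hc; apply/conc_homogP => hn; apply: h hc.
    by apply: contra hn => /eqP ->; rewrite addNr.
  have /conc_homogP := h _ _ hc; apply; apply: contra hm => /eqP e.
  by rewrite -[m](addrK 1) e sub0r.
have key : homog 1 x -> forall c, (cdiff x + 2^-1 *: bracket x x : gdual C) c =
    curv (scal_map x) c.
  move=> h1; have dx : degree1 (scal_map x) by apply/hdeg.
  apply: (homog_ext (gdual_linear _) (curv_linear dx)) => m c hc.
  rewrite -[LHS]/(dual_diff x c + 2^-1 * dual_bracket x x c).
  rewrite (dual_bracketE _ h1 h1) (dual_diff_homog_val _ hc).
  rewrite /curv /conv (_ : (fun c => parity _) = scal_map x); last first.
    by apply/funext => c'; rewrite (@parity_homog K SK 0) ?scale1r.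
  rewrite -[tmul _ _ _]/(dual_pair0 x x (cobracket c)) add0r -scalerN; congr (_ + _).
    have [->|hm] := eqVneq m (- 2); first by rewrite sgnE expr0 mul1r.
    have hm' : m + 1 != - 1.
      by apply: contra hm => /eqP e; rewrite -[m](addrK 1) e.
    rewrite -[RHS]/((x : gdual C) (cdiff c)).
    by move/dual_homogP: h1 => h1; rewrite (h1 _ _ hm' (cdiff_homog hc)) mulr0.
  by congr (_ * _); rewrite sgnE mulN1r.
split=> [[h1 mc]|[d1 mc]].
  by split=> [|c]; [apply/hdeg | rewrite -key // mc].
have h1 : homog 1 x by apply/hdeg.
by split=> //; apply: gdualP => c; rewrite key // mc.
Qed.

Lemma MC_exists (u : C -> SK) : twisting u ->
  exists x : MC G, forall c, (val x : gdual C) c = u c.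
Proof.
move=> tw; have [[lu hu] _] := tw.
have [|x [_ ex]] := @gdual_exists u 1 lu.
  move=> m c hm hc; have /conc_homogP := hu _ _ hc; apply.
  by apply: contra hm => /eqP e; rewrite -[m](addrK 1) e sub0r.
have mx : `[< is_MC x >].
  by apply/asboolP/twisting_MC; rewrite (_ : scal_map x = u) //; apply/funext.
by exists (exist (fun x : G => `[< is_MC x >]) x mx).
Qed.

Lemma MC_twisting (x : MC G) :
  twisting (scal_map (val x)).
Proof. by apply/twisting_MC; case: x => x /= /asboolP. Qed.

Lemma MC_eq (x y : MC G) : (forall c, (val x : gdual C) c = (val y : gdual C) c) -> x = y.
Proof. by move=> h; apply: val_inj; apply: gdualP. Qed.

Section Path.
Variables (kap : C -> F) (lam : G) (X : nat -> G).
Hypotheses (tw : twisting kap) (lam0 : homog 0 lam).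
Hypothesis (kap_lam : forall c, (kap c).2 = ((lam : gdual C) c)%:P).
Hypothesis (kap_X : forall k c, (X k : gdual C) c = (kap c).1`_k).

Let lk : linear kap. Proof. by case: tw => -[]. Qed.
Let hk n c : homog n c -> homog (n + 1) (kap c).
Proof. by case: tw => -[_ h] _; apply: h. Qed.

Lemma path_homog k : homog 1 (X k).
Proof.
apply/dual_homogP => m c hm hc; rewrite kap_X.
have [h _] := (form_homogP _ _).1 (hk hc); rewrite h ?coef0 //.
by apply: contra hm => /eqP e; rewrite -[m](addrK 1) e sub0r.
Qed.

Lemma form_parity (w : F) : parity w = (w.1, - w.2).
Proof.
case: w => f g; have -> : ((f, g) : F) = ((f, 0) : F) + (0, g).
  by congr pair; rewrite /= ?addr0 ?add0r.
rewrite (linD (@parity_linear K F)) (@parity_homog K F 0) ?(@parity_homog K F 1);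
  try by apply/form_homogP.
rewrite !sgnE expr0 scale1r expr1 scaleN1r.
by congr pair; rewrite /= ?oppr0 ?addr0 ?add0r.
Qed.

Lemma coef_conv k t : (conv kap t).2`_k =
  dual_pair0 (X k) lam t - dual_pair0 lam (X k) t.
Proof.
have lp := lin_comp (@parity_linear K F) lk.
move: t; apply: (tens_ext (U := K^o) _ (lin_add (dual_pair0_linear (X k) lam)
  (lin_opp (dual_pair0_linear lam (X k))))).
  move=> a x y; rewrite (conv_linear lk) /= coefD coefZ //.
move=> a b; rewrite /conv tmul_tens // form_parity !dual_pair0_tens !kap_X /=.
by rewrite !kap_lam coefD mulNr coefN coefMC coefCM.
Qed.

(** The coefficient of t^k dt in the Maurer-Cartan equation for [kap]. Its two quadratic terms
    coincide by antisymmetry of the cobracket, which absorbs the factor 1/2. *)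
Lemma path_step k c : k.+1%:R * (X k.+1 : gdual C) c =
  - ((if k is 0%N then (lam : gdual C) (cdiff c) else 0) +
     dual_pair0 lam (X k) (cobracket c)).
Proof.
have [_ mc] := tw; have := congr1 (fun w : F => w.2`_k) (mc c).
rewrite /curv -[(_ - _ : F).2]/((kap c).1^`() + (kap (cdiff c)).2
  - 2^-1 *: (conv kap (cobracket c)).2).
rewrite !coefB coefD coefZ coef_deriv coef_conv kap_lam coefC coef0.
have -> : dual_pair0 (X k) lam (cobracket c) = - dual_pair0 lam (X k) (cobracket c).
  have := dual_pair0_swap (cobracket c) (path_homog k) lam0.
  rewrite cobracket_anti (linN (dual_pair0_linear _ _)) mulr0 mul1r => <-.
  by rewrite opprK.
rewrite -kap_X; move: (X k.+1 : gdual C) => Y.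
have -> : (if k == 0%N then (lam : gdual C) (cdiff c) else 0) =
  (if k is 0%N then (lam : gdual C) (cdiff c) else 0) by case: (k).
move: (if k is 0%N then _ else _) (dual_pair0 _ _ _) => u v e.
apply/eqP; rewrite -addr_eq0 addrA; apply/eqP; rewrite -[RHS]e -opprD mulrN opprK.
by rewrite mulr_natl -mulr2n -(mulr_natl v) mulKf //; exact: (natS_neq0 charK 1).
Qed.

Lemma path_recursion k : k.+1%:R *: X k.+1 =
  (if k is 0%N then cdiff lam else 0) - bracket lam (X k).
Proof.
apply: gdualP => c; rewrite -[LHS]/(k.+1%:R * (X k.+1 : gdual C) c) path_step.
rewrite -[RHS]/((if k is 0%N then dual_diff lam else 0 : gdual C) c -
  dual_bracket lam (X k) c).
rewrite (dual_bracketE _ lam0 (path_homog k)) mul0r mul1r opprD; congr (_ - _).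
case: k => [|k]; last by rewrite oppr0.
move: c; apply: (homog_ext (lin_opp (lin_comp (gdual_linear lam) (@cdiff_linear K C)))
  (gdual_linear _)) => m c hc.
rewrite (dual_diff_homog_val _ hc); have [->|hm] := eqVneq m (- 1).
  by rewrite sgnE expr1 mulN1r.
have hm' : m + 1 != - 0.
  by apply: contra hm => /eqP e; rewrite -[m](addrK 1) e oppr0 sub0r.
by move/dual_homogP: lam0 => h; rewrite (h _ _ hm' (cdiff_homog hc)) mulr0 oppr0.
Qed.

(** Beyond [X 1] each coefficient is a multiple of the bracket of [lam] with the previous one and so
    gains one level. The index is shifted because [X 1] contains the term d lam, which passes
    through no cobracket. In particular the path is polynomial on each element. *)
Lemma deep_path k : deep (X := K^o) k (X k.+1 : gdual C).
Proof.
have lX j : linear (X j : gdual C) := gdual_linear _.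
elim: k => [|k IH]; first exact: linear_deep0.
have E c : - k.+2%:R^-1 *: (dual_pair0 lam (X k.+1) (cobracket c) : K^o) =
    (X k.+2 : gdual C) c.
  have := path_step k.+1 c; rewrite add0r => e.
  by rewrite scale_regE mulNr -mulrN -e mulKf // natS_neq0.
apply: (deep_eq E); apply: (deep_comp (lin_scale _ (@lin_id K K^o))).
have := deep_mul (scal_mul_bilin K) (linear_deep0 (gdual_linear lam)) IH.
by rewrite add0n.
Qed.

Lemma path_sum n c M : coradical cobracket n c -> (n.+1 < M)%N ->
  \sum_(k < M) (X k : gdual C) c = (kap c).1.[1].
Proof.
move=> hc hM; rewrite (@horner_coef_wide _ M).
  by apply: eq_bigr => k _; rewrite kap_X expr1n mulr1.
apply/leq_sizeP => -[//|k] hk'; first by rewrite leqn0 in hk'; case: M hM hk'.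
rewrite -kap_X; apply: (deep_vanish (deep_path k)) => T hT; apply: hc.
apply: leq_ltn_trans hT; rewrite -ltnS; apply: leq_trans hk'; exact: ltnW.
Qed.
End Path.
End GaugePaths.

(** * Gauge transformations as paths with constant dt part *)

Section GaugeCorrespondence.
Variables (K : fieldType) (charK : [pchar K] =i pred0) (C : lieCoalg K).
Local Notation F := (forms K).
Local Notation G := (dual C).
Local Notation SK := (scalars K).

Lemma deriv_eq0 (p : {poly K}) : p^`() = 0 -> p = (p`_0)%:P.
Proof.
move=> /polyP h; apply/polyP => -[|i]; rewrite coefC //=.
have := h i; rewrite coef_deriv coef0 -mulr_natr => /eqP.
by rewrite mulf_eq0 (negPf (natS_neq0 charK i)) orbF => /eqP.
Qed.

Lemma gauge_of_path (kap : C -> F) (x y : MC G) : twisting kap ->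
  (forall c, dt_deriv (kap c) = 0) ->
  (forall c, ev_mor (0 : K) (kap c) = (val x : gdual C) c) ->
  (forall c, ev_mor (1 : K) (kap c) = (val y : gdual C) c) ->
  gauge (dual_filt C) x y.
Proof.
move=> tw hdt kx ky; have [[lk hk] _] := tw.
have l2 : linear (fun c => (kap c).2`_0 : K^o).
  by move=> a u v; rewrite lk /= coefD coefZ.
have [|lam [lam0 lamE]] := @gdual_exists K C _ 0 l2.
  move=> m c hm hc; have [_ h] := (form_homogP _ _).1 (hk _ _ hc).
  by rewrite h ?coef0 //; apply: contra hm => /eqP e; rewrite -[m](addrK 1) e oppr0.
have exX k : exists X : G, homog 1 X /\ forall c, (X : gdual C) c = (kap c).1`_k.
  apply: gdual_exists; first by move=> a u v; rewrite lk /= coefD coefZ.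
  move=> m c hm hc; have [h _] := (form_homogP _ _).1 (hk _ _ hc).
  rewrite h ?coef0 //; apply: contra hm => /eqP e.
  by rewrite -[m](addrK 1) e sub0r.
pose X k := projT1 (cid (exX k)).
have XE k c : (X k : gdual C) c = (kap c).1`_k by rewrite /X; case: cid => u [].
have kl c : (kap c).2 = ((lam : gdual C) c)%:P by rewrite lamE; apply: deriv_eq0; exact: hdt.
exists lam => //; exists X; split.
- by apply: gdualP => c; rewrite XE -kx -horner_coef0.
- exact: (path_recursion charK tw lam0 kl XE).
move=> n; exists n.+2 => M hM c hc.
rewrite -[LHS]/((\sum_(k < M) X k : gdual C) c - (val y : gdual C) c).
rewrite gdual_sum (path_sum charK tw lam0 kl XE hc) // -ky.
exact: subrr.
Qed.

(** The recursion for the coefficients is only the dt part of the Maurer-Cartan equation. A full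
    solution starting at x with dt part [lam] is therefore built by [deformation], and the given
    coefficients are recognized as its own by uniqueness. *)
Lemma path_of_gauge (x y : MC G) : gauge (dual_filt C) x y ->
  exists kap : C -> F, [/\ twisting kap,
    forall c, ev_mor (0 : K) (kap c) = (val x : gdual C) c &
    forall c, ev_mor (1 : K) (kap c) = (val y : gdual C) c].
Proof.
case=> lam lam0 [X [X0 Xrec Xsum]].
have [[lx hx] mcx] := MC_twisting x.
have ll := gdual_linear (lam : gdual C).
pose psi0 c : F := ((scal_map (val x) c)%:P, ((lam : gdual C) c)%:P).
(* Integration from 0 contracts the forms vanishing at t = 0. Its values have no dt part and vanish
   at 0, so the fixed point keeps both [lam] and the starting point x. *)
pose h (w : F) : F := (antideriv w.2, 0).
pose I (w : F) := ev_mor (0 : K) w = 0.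
have lC : linear (fun a : K^o => a%:P).
  by move=> a u v; rewrite polyCD -mul_polyC -polyCM.
have lh : linear h.
  apply: (@lin_pair K _ _ F); last exact: lin_zero.
  exact: (lin_comp (@antideriv_linear K) (@lin_snd K _ _)).
have le := chain_linear (ev_mor (0 : K)).
have dpsi0 : degree1 psi0.
  split; first by apply: (@lin_pair K _ _ C); exact: (lin_comp lC).
  move=> n c hc; apply/form_homogP; split=> /= hn.
    by have /conc_homogP -> := hx _ _ hc.
  move/dual_homogP: lam0 => h0; rewrite (h0 n) //.
  by apply: contra hn => /eqP ->; rewrite oppr0.
have [||||||kap [tw fixP]] := @deformation K charK C F psi0 I h dpsi0 _ _ lh.
- exact: (lin0 le).
- by move=> a u v hu hv; rewrite /I le hu hv scaler0 addr0.
- move=> n w /form_homogP[_ hw]; apply/form_homogP; split=> //= hn.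
  by rewrite hw ?(lin0 (@antideriv_linear K)) // -subr_eq0.
- by move=> w _; exact: antideriv0.
- case=> f g hw; congr pair; rewrite /= ?addr0 ?antiderivK //.
  rewrite add0r (derivK charK) -[f.[0]]/(ev_mor (0 : K) (f, g)) hw.
  exact: subr0.
- move=> psi dpsi Ipsi c; have lp := proj1 dpsi.
  have E c' : ev_mor (0 : K) (psi c') = scal_map (val x) c'.
    have := Ipsi c'; rewrite /I (linD le) (linN le) => /eqP.
    rewrite subr_eq0 => /eqP ->; exact: hornerC.
  rewrite /I; have -> : ev_mor (0 : K) (residue psi0 psi c) = curv (scal_map (val x)) c.
    rewrite /residue /curv !(linD le) (linN le) (linZ le) (chain_diff (ev_mor (0 : K))).
    rewrite (conv_mor _ _ lp) (_ : (fun c => _) = scal_map (val x)); last exact/funext.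
    have e c' : ev_mor (0 : K) (psi0 c') = scal_map (val x) c' by exact: hornerC.
    by rewrite !e.
  exact: mcx.
have kl c : (kap c).2 = ((lam : gdual C) c)%:P.
  by have [-> _] := fixP c; exact: subr0.
have exX k : exists Y : G, homog 1 Y /\ forall c, (Y : gdual C) c = (kap c).1`_k.
  have [[lk hk] _] := tw.
  apply: gdual_exists; first by move=> a u v; rewrite lk /= coefD coefZ.
  move=> m c hm hc; have [h1 _] := (form_homogP _ _).1 (hk _ _ hc).
  rewrite h1 ?coef0 //; apply: contra hm => /eqP e.
  by rewrite -[m](addrK 1) e sub0r.
pose Y k := projT1 (cid (exX k)).
have YE k c : (Y k : gdual C) c = (kap c).1`_k by rewrite /Y; case: cid => u [].
have k0 c : ev_mor (0 : K) (kap c) = (val x : gdual C) c.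
  have [e _] := fixP c; rewrite e (linD le) (linN le).
  rewrite -[ev_mor (0 : K) (h _)]/((antideriv _).[0]) antideriv0 subr0.
  exact: hornerC.
(* Both sequences start at x and obey the same recursion, in which k + 1 can be cancelled. *)
have YX k : Y k = X k.
  elim: k => [|k IH].
    by apply: gdualP => c; rewrite X0 -k0 YE -horner_coef0.
  have := path_recursion charK tw lam0 kl YE k; rewrite IH -Xrec.
  by move=> /(scalerI (natS_neq0 charK k)).
exists kap; split=> // c; have [n hc] := cobracket_conil c.
have [N hN] := Xsum n; pose M := maxn N n.+2.
have := hN M (leq_maxl _ _) c hc.
rewrite -[LHS]/((\sum_(k < M) X k : gdual C) c - (val y : gdual C) c).
move=> /eqP; rewrite subr_eq0 => /eqP <-; rewrite gdual_sum.
under eq_bigr do rewrite -YX.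
by rewrite (path_sum charK tw lam0 kl YE hc) // leq_maxr.
Qed.
End GaugeCorrespondence.

(** * Homotopy invariance of the moduli *)

Section Homotopies.
Variables (K : fieldType) (charK : [pchar K] =i pred0).
Local Notation F := (forms K).
Local Notation SK := (scalars K).

Lemma ev_rcollapse (B : cdga K) (b : cdgaMor B SK) (a : K) (t : tens_cdga F B) :
  ev_mor a (rcollapse_mor F b t) = b (tev B a t).
Proof.
have lb := chain_linear b.
have l1 := lin_comp (chain_linear (ev_mor a)) (chain_linear (rcollapse_mor F b)).
move: t; apply: (tens_ext l1 (lin_comp lb (chain_linear (tev B a)))) => w x.
rewrite tevE (linZ lb) -[rcollapse_mor F b _]/(rcollapse b _) rcollapseE.
rewrite (linZ (chain_linear (ev_mor a))) -[ev_mor a w]/(form_ev a w).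
by rewrite -[LHS]/(_ * _) -[RHS]/(_ * _) mulrC.
Qed.

Lemma dt_deriv_rcollapse (B : cdga K) (b : cdgaMor B SK) (t : tens_cdga F B) :
  tdt_deriv t = 0 -> dt_deriv (rcollapse_mor F b t) = 0.
Proof.
have lb : linear (b : B -> K^o) := chain_linear b.
have lr := tlift_linear (scale_bilinr {poly K} lb).
suff -> : dt_deriv (rcollapse_mor F b t) = rcollapse b (tdt_deriv t).
  by move=> ->; exact: (lin0 lr).
have ld := @dt_deriv_linear K; have lt := @tdt_deriv_linear K B.
move: t; apply: (tens_ext (lin_comp ld (chain_linear (rcollapse_mor F b)))
  (lin_comp lr lt)) => w x.
rewrite -[rcollapse_mor F b _]/(rcollapse b _) rcollapseE (linZ ld).
by rewrite tdt_derivE /rcollapse (tlift_tens _ _ (scale_bilinr {poly K} lb)).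
Qed.

(** The augmentation b acts on the coefficients of the path and not on t, so constancy of the dt
    part survives. *)
Lemma gauge_of_tens_path (C : lieCoalg K) (B : cdga K) (b : cdgaMor B SK)
    (H : C -> tens_cdga F B) (x y : MC (dual C)) : twisting H ->
  (forall c, tdt_deriv (H c) = 0) ->
  (forall c, b (tev B 0 (H c)) = (val x : gdual C) c) ->
  (forall c, b (tev B 1 (H c)) = (val y : gdual C) c) ->
  gauge (dual_filt C) x y.
Proof.
move=> tw hdt h0 h1.
apply: (gauge_of_path charK (twisting_mor (rcollapse_mor F b) tw)) => c.
- exact: dt_deriv_rcollapse.
- by rewrite ev_rcollapse.
- by rewrite ev_rcollapse.
Qed.

(** The polynomial Poincare lemma: in characteristic 0 a function with zero derivative is constant
    and every g dt has a primitive. *)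
Lemma const_mor_quasi : quasi_isomorphism (const_mor K).
Proof.
move=> n; split=> [v hv _ [w _ e]|[f g] hw e].
  have e1 : v%:P = 0 by have := congr1 fst e.
  exists 0; first exact: (@homog0 K SK).
  by apply: (@polyC_inj K); rewrite e1.
have [hf hg] := (form_homogP _ _).1 hw.
have e1 : f^`() = 0 by have := congr1 snd e.
have e2 := deriv_eq0 charK e1.
exists (f`_0 : SK); first split=> //.
  by apply/conc_homogP => /hf /= ->; rewrite coef0.
exists (antideriv g, 0); first apply/form_homogP.
  split=> //= hn; rewrite (_ : g = 0) ?(lin0 (@antideriv_linear K)) //.
  by apply: hg; rewrite -subr_eq0.
by congr pair; rewrite /= ?addr0 ?add0r ?antiderivK.
Qed.

(* Rectifying kap along K -> K[t,dt] yields z and a homotopy of paths from the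
   constant path z to kap; its two ends are paths with constant dt part from z
   to x and from z to y. *)
Lemma gauge_equiv_of_homotopy (C : lieCoalg K) (kap : C -> F) (x y : MC (dual C)) :
  twisting kap ->
  (forall c, ev_mor (0 : K) (kap c) = (val x : gdual C) c) ->
  (forall c, ev_mor (1 : K) (kap c) = (val y : gdual C) c) ->
  gauge_equiv (dual_filt C) x y.
Proof.
move=> tw h0 h1.
have [g [H [twg twH H0 H1 Hdt]]] := rectification charK const_mor_quasi tw.
have [z zE] := MC_exists twg.
have evc a (c : C) : ev_mor a (tev F 0 (H c)) = (val z : gdual C) c.
  by rewrite H0 zE; exact: hornerC.
have gx : gauge (dual_filt C) z x.
  by apply: (gauge_of_tens_path (b := ev_mor 0) twH Hdt) => c //; rewrite H1.
have gy : gauge (dual_filt C) z y.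
  by apply: (gauge_of_tens_path (b := ev_mor 1) twH Hdt) => c //; rewrite H1.
apply/asboolP; apply: (Relation_Operators.rst_trans _ _ _ z).
  exact: Relation_Operators.rst_sym (Relation_Operators.rst_step _ _ _ _ gx).
exact: Relation_Operators.rst_step.
Qed.
End Homotopies.

(** * Pulling back Maurer-Cartan elements along algebra maps of cobar constructions *)

Section Pullback.
Variables (K : fieldType) (charK : [pchar K] =i pred0).
Local Notation F := (forms K).
Local Notation SK := (scalars K).
Implicit Types (C D : lieCoalg K).
Local Notation Om := (cobar_cdga charK).

Definition ext_cdgaMor C (X : cdga K) (psi : C -> X) (tw : twisting psi) :
    cdgaMor (Om C) X :=
  @CdgaMor K (Om C) X (@ChainMap K (Om C) X _ (ext_linear (proj1 tw))
    (ext_homog (proj1 tw)) (ext_diff tw)) (ext_smul (proj1 tw)).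

(** The universal twisting: any twisting psi is its composite with the algebra map [ext psi]. *)
Definition cobar_unit C : C -> Om C := fun c => word [:: (c : gshift C)].

Lemma cobar_unit_degree1 C : degree1 (@cobar_unit C).
Proof.
split=> [|n c hc]; first exact: (@word1_lin K (gshift C)).
have -> : n + 1 = \sum_(d <- [:: n + 1]) d by rewrite big_seq1.
by apply: homog_word; split=> //; apply: homog_shift.
Qed.

Lemma ext_cobar_unit C a : ext (@cobar_unit C) a = a.
Proof. by rewrite -(@ext_uniq K C (Om C) _ (@cobar_unit_degree1 C) id). Qed.

Lemma cobar_unit_twisting C : twisting (@cobar_unit C).
Proof.
have d := @cobar_unit_degree1 C; split=> // c.
rewrite (curvE d) ext_cobar_unit -[cdiff _]/(cobar_diff _) cobar_diff_word /=.
by rewrite (lin0 (proj2 (smul_bilin (gshift C)) _)) addr0; exact: subrr.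
Qed.

(* Precomposition of algebra maps cobar C -> K with the algebra map
   cobar D -> cobar C that extends phi. *)
Definition pull C D (phi : D -> Om C) (tw : twisting phi) (x : MC (dual C)) :
    MC (dual D) :=
  projT1 (cid (MC_exists (twisting_mor (ext_cdgaMor (MC_twisting x)) tw))).

Lemma pullE C D (phi : D -> Om C) (tw : twisting phi) (x : MC (dual C)) d :
  (val (pull tw x) : gdual D) d = ext (scal_map (val x)) (phi d).
Proof. by rewrite /pull; case: cid. Qed.

(** A path from x to y extends to an algebra map from the cobar construction to K[t,dt] and can be
    composed with phi. Since phi takes values in sums of words, products of path values appear and
    the dt part need not stay constant; this is where arbitrary homotopies are needed. *)
Lemma pull_gauge_equiv C D (phi : D -> Om C) (tw : twisting phi) x y :
  gauge_equiv (dual_filt C) x y ->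
  gauge_equiv (dual_filt D) (pull tw x) (pull tw y).
Proof.
move=> /asboolP; elim=> {x y} [x y g|x|x y _ IH|x y z _ IH1 _ IH2].
- have [kap [twk k0 k1]] := path_of_gauge charK g.
  have ev a (z : MC (dual C)) : (forall c, ev_mor a (kap c) = (val z : gdual C) c) ->
      forall d, ev_mor a (ext kap (phi d)) = (val (pull tw z) : gdual D) d.
    move=> h d; rewrite pullE (ext_mor _ _ (proj1 twk)).
    by congr (ext _ _); apply/funext.
  apply: (gauge_equiv_of_homotopy charK (twisting_mor (ext_cdgaMor twk) tw));
    exact: ev.
- exact: gauge_equiv_refl.
- by rewrite gauge_equiv_sym.
- exact: gauge_equiv_trans IH1 IH2.
Qed.

(** Rectifying the universal twisting of C along the extension of phi gives G and a homotopy from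
    its composite with that extension to the identity. Evaluating coefficients by the algebra map of
    x turns the homotopy into a gauge transformation. *)
Lemma homotopy_inverse C D (phi : D -> Om C) (tw : twisting phi) :
  quasi_isomorphism (ext_cdgaMor tw) ->
  exists (G : C -> Om D) (twG : twisting G), quasi_isomorphism (ext_cdgaMor twG) /\
    forall x, gauge_equiv (dual_filt C) (pull twG (pull tw x)) x.
Proof.
move=> qphi.
have [G [H [twG twH H0 H1 Hdt]]] := rectification charK qphi (@cobar_unit_twisting C).
exists G, twG; split; last first.
  move=> x; apply/asboolP; apply: Relation_Operators.rst_step.
  pose b := ext_cdgaMor (MC_twisting x).
  apply: (gauge_of_tens_path charK (b := b) twH Hdt) => c; last first.
    by rewrite H1 -[LHS]/(ext _ _) (ext_word (proj1 (MC_twisting x))).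
  rewrite H0 pullE -[ext_cdgaMor tw _]/(ext phi _) (ext_mor b _ (proj1 tw)).
  by congr (ext _ _); apply/funext => d; rewrite /scal_map pullE.
pose Hm := ext_cdgaMor twH; pose P := ext_cdgaMor tw; pose Q := ext_cdgaMor twG.
have lP := chain_linear P; have lQ := chain_linear Q.
(* P Q is the identity on cohomology: for a cocycle v, Stokes' formula applied to the homotopy
   [Hm v] leaves only its two ends, P (Q v) and v. *)
have key n (v : Om C) : homog n v -> cdiff v = 0 ->
    exists2 u : Om C, homog (n - 1) u & v = P (Q v) + cdiff u.
  move=> hv dv; exists (tint (Hm v)).
    by apply: tint_homog; apply: (chain_homog Hm).
  have := tint_diff charK (Hm v).
  have -> : tens_diff (Hm v) = 0.
    by rewrite -[LHS]/(cdiff (Hm v)) -(chain_diff Hm) dv (lin0 (chain_linear Hm)).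
  rewrite (lin0 (@tint_linear K (Om C))).
  have -> : tev (Om C) 1 (Hm v) = v.
    rewrite (ext_mor _ _ (proj1 twH)) -[RHS]ext_cobar_unit.
    by congr (ext _ _); apply/funext.
  have -> : tev (Om C) 0 (Hm v) = P (Q v).
    rewrite (ext_mor _ _ (proj1 twH)) (ext_mor P _ (proj1 twG)).
    by congr (ext _ _); apply/funext.
  by move=> /esym /eqP; rewrite subr_eq0 subr_eq addrC => /eqP.
have lC := @cdiff_linear K (Om C); have lD := @cdiff_linear K (Om D).
move=> n; split=> [v hv dv [w hw e]|w hw dw].
  have [u hu ->] := key n v hv dv; exists (P w + u).
    by apply: homogD => //; apply: (chain_homog P).
  by rewrite e (chain_diff P) (linD lC).
have hPw := chain_homog P hw.
have dPw : cdiff (P w) = 0 by rewrite -(chain_diff P) dw (lin0 lP).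
have [u hu e] := key n (P w) hPw dPw.
(* P sends this cocycle to the boundary just found, so injectivity of P on cohomology makes w and Q
   (P w) cohomologous. *)
have [|||u' hu' e'] := (qphi n).1 (w - Q (P w)).
- by apply: homogD => //; apply: homogN; apply: (chain_homog Q).
- by rewrite (linD lD) (linN lD) dw -(chain_diff Q) dPw (lin0 lQ) subr0.
- exists u => //; rewrite -/P (linD lP) (linN lP) {1}e addrAC subrr.
  exact: add0r.
exists (P w) => //; exists u' => //.
by rewrite -e' addrC subrK.
Qed.

Definition coalg_twist C D (f : lieCoalgMor D C) : D -> Om C :=
  fun d => cobar_unit (f d).

Lemma coalg_twistE C D (f : lieCoalgMor D C) :
  coalg_twist f = (fun d => cobar_map charK f (cobar_unit d)).
Proof. by apply/funext => d; rewrite /= cobar_fun_word. Qed.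

Definition cobar_mor C D (f : lieCoalgMor D C) : cdgaMor (Om D) (Om C) :=
  @CdgaMor K (Om D) (Om C) (cobar_map charK f) (cobar_fun_smul f).

Lemma coalg_twisting C D (f : lieCoalgMor D C) : twisting (coalg_twist f).
Proof.
by rewrite coalg_twistE; apply: (twisting_mor (cobar_mor f)); exact: cobar_unit_twisting.
Qed.

Lemma ext_coalg_twist C D (f : lieCoalgMor D C) a :
  ext (coalg_twist f) a = cobar_map charK f a.
Proof.
rewrite coalg_twistE -(ext_mor (cobar_mor f) _ (@cobar_unit_degree1 D)).
by rewrite ext_cobar_unit.
Qed.

Lemma pull_coalg C D (f : lieCoalgMor D C) x :
  pull (coalg_twisting f) x = MC_map (dual_map f) x.
Proof.
apply: MC_eq => d; rewrite pullE /coalg_twist (ext_word (proj1 (MC_twisting x))).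
by [].
Qed.
End Pullback.

Theorem theorem5p12 (K : fieldType) (charK : [pchar K] =i pred0)
    (C D : lieCoalg K) (f : lieCoalgMor D C)
    (hf : weak_equivalence charK f) :
  exists Phi : moduli (dual_filt C) -> moduli (dual_filt D),
    (forall x : MC (dual C),
       Phi (\pi_(moduli (dual_filt C)) x) =
       \pi_(moduli (dual_filt D)) (MC_map (dual_map f) x)) /\
    bijective Phi.
Proof.
pose tw := coalg_twisting charK f.
have qf : quasi_isomorphism (ext_cdgaMor charK tw).
  have e : ext_cdgaMor charK tw =1 cobar_map charK f by exact: ext_coalg_twist.
  move=> n; have [qi qs] := hf n; split=> [v hv dv [w hw ew]|w hw dw].
    by apply: qi => //; exists w => //; rewrite -e.
  have [v hv [u hu eu]] := qs w hw dw.
  by exists v => //; exists u => //; rewrite e.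
have [G [twG [qG invG]]] := homotopy_inverse qf.
have [G' [twG' [_ invG']]] := homotopy_inverse qG.
(* With L, M, N the pullbacks along [tw], [twG], [twG'], one has M L ~ 1 and N M ~ 1, hence L M ~ N
   M L M ~ N M ~ 1. *)
have invG2 y : gauge_equiv (dual_filt D) (pull tw (pull twG y)) y.
  apply: (gauge_equiv_trans _ (invG' y)).
  apply: (@gauge_equiv_trans _ _ _ (pull twG' (pull twG (pull tw (pull twG y))))).
    by rewrite gauge_equiv_sym.
  by apply: pull_gauge_equiv.
pose Phi (q : moduli (dual_filt C)) := \pi_(moduli (dual_filt D)) (pull tw (repr q)).
pose Psi (q : moduli (dual_filt D)) := \pi_(moduli (dual_filt C)) (pull twG (repr q)).
have PhiE x : Phi (\pi_(moduli (dual_filt C)) x) =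
    \pi_(moduli (dual_filt D)) (pull tw x).
  apply/eqmodP; apply: pull_gauge_equiv; apply/eqmodP; exact: reprK.
have PsiE x : Psi (\pi_(moduli (dual_filt D)) x) =
    \pi_(moduli (dual_filt C)) (pull twG x).
  apply/eqmodP; apply: pull_gauge_equiv; apply/eqmodP; exact: reprK.
exists Phi; split; first by move=> x; rewrite PhiE pull_coalg.
exists Psi => q; rewrite -[q]reprK.
  by rewrite PhiE PsiE; apply/eqmodP; exact: invG.
by rewrite PsiE PhiE; apply/eqmodP; exact: invG2.
Qed.
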